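(* Let $\phi:\mathbb{R}^2\to\mathbb{R}^4$ be a smooth embedding which is a long $2$-knot. Then $\phi$ has a polynomial representation; that is, there exists a polynomial embedding $\psi:\mathbb{R}^2\to\mathbb{R}^4$, $\psi(s,t)=(x(s,t),y(s,t),z(s,t),w(s,t))$ with $x,y,z,w\in\mathbb{R}[s,t]$, such that $\phi$ is ambient isotopic to $\psi$ in $\mathbb{R}^4$.
   Context: A $2$-knot is a proper, smooth, locally flat embedding of $S^2$ in $S^4$. Removing a point from $S^2$ and its image from $S^4$ gives an embedding of $\mathbb{R}^2$ in $\mathbb{R}^4$; such an embedding is called a long $2$-knot. (The paper also describes a long $2$-knot as a proper, locally flat embedding of $\mathbb{R}^2$ in $\mathbb{R}^4$ which is asymptotic outside a compact region.) An embedding is proper if preimages of compact sets are compact. It is locally flat if each point of the image has a regular neighborhood $U$ in the ambient $4$-manifold such that the pair ($U$, $U\,\cap$ image) is homeomorphic to the standard ball pair $(D^4,D^2)$. A polynomial embedding is a smooth embedding whose coordinate functions are all real polynomials. Two embeddings of $\mathbb{R}^2$ in $\mathbb{R}^4$ with images $F$ and $F'$ are ambient isotopic if there is an ambient isotopy $\{h_u\}_{u\in[0,1]}$ of $\mathbb{R}^4$ (with $h_0=\mathrm{id}$) such that $h_1(F)=F'$. *)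

(* Defs.v *)
From mathcomp Require Import all_boot all_order all_algebra.
From mathcomp Require Import all_classical all_reals all_analysis.

Set Implicit Arguments.
Unset Strict Implicit.
Unset Printing Implicit Defensive.

Import Order.TTheory GRing.Theory Num.Theory.
Import numFieldNormedType.Exports.

Local Open Scope classical_set_scope.
Local Open Scope ring_scope.

Section SmoothMaps.
Context {R : realType}.

(** [Cn n U f]: [f] is of class C^n on the open set [U].  Only used for
    finite-dimensional [V], where continuity of all the directional derivatives
    is the same as continuity of the differential. *)
Fixpoint Cn {V W : normedModType R} (n : nat) (U : set V) (f : V -> W) : Prop :=
  match n with
  | 0%N => forall x, U x -> {for x, continuous f}
  | n'.+1 => (forall x, U x -> differentiable f x) /\
             (forall v, Cn n' U (fun x => 'D_v f x))
  end.

Definition smooth_extension {V W : normedModType R}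
    (A : set V) (f : V -> W) (p : V) (U : set V) (F : V -> W) : Prop :=
  [/\ open U, U p, forall n, Cn n U F & forall x, (U `&` A) x -> F x = f x].

(** Smoothness on an arbitrary subset of a Euclidean space: near each point of
    [A], the map extends to a C^infinity map on an open set of the ambient
    space.  The values of [f] off [A] are irrelevant. *)
Definition smooth_on {V W : normedModType R} (A : set V) (f : V -> W) : Prop :=
  forall p, A p -> exists U F, smooth_extension A f p U F.

(** Velocities at [p] of smooth curves in [A]; this is the tangent space when
    [A] is a submanifold without boundary. *)
Definition tangent {V : normedModType R} (A : set V) (p : V) : set V :=
  [set v | exists c : R^o -> V,
    [/\ smooth_on setT c, forall t, A (c t), c 0 = p & 'D_1 c 0 = v]].

(** For a submanifold [A], the restriction of ['d F p] to the tangent space does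
    not depend on the local extension [F] of [f]. *)
Definition immersion_on {V W : normedModType R} (A : set V) (f : V -> W) : Prop :=
  forall p U F, A p -> smooth_extension A f p U F ->
    forall v, tangent A p v -> 'd F p v = 0 -> v = 0.

Definition inverse_on {S T : Type} (A : set S) (B : set T)
    (f : S -> T) (g : T -> S) : Prop :=
  [/\ set_fun A B f, set_fun B A g,
      forall x, A x -> g (f x) = x & forall y, B y -> f (g y) = y].

Definition homeomorphism {S T : topologicalType} (A : set S) (B : set T)
    (f : S -> T) : Prop :=
  exists g : T -> S,
    [/\ inverse_on A B f g, {within A, continuous f} & {within B, continuous g}].

Definition diffeomorphism {V W : normedModType R} (A : set V) (B : set W)
    (f : V -> W) : Prop :=
  exists g : W -> V, [/\ inverse_on A B f g, smooth_on A f & smooth_on B g].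

Definition smooth_embedding {V W : normedModType R} (A : set V) (f : V -> W)
    : Prop :=
  [/\ smooth_on A f, immersion_on A f & homeomorphism A (f @` A) f].

End SmoothMaps.

Section Knots.
Context {R : realType}.

(** Sums of squares, as the library norm on row vectors is the sup norm. *)
Definition sqnorm {n : nat} (x : 'rV[R]_n) : R := \sum_(i < n) x 0 i ^+ 2.

(** S^n in R^(n+1). *)
Definition sphere (n : nat) : set 'rV[R]_n.+1 := [set x | sqnorm x = 1].
Arguments sphere n : clear implicits.

Definition disk4 : set 'rV[R]_4 := [set x | sqnorm x <= 1].

(** D^2 in D^4: the last two coordinates vanish. *)
Definition disk2 : set 'rV[R]_4 :=
  [set x | disk4 x /\ forall i : 'I_4, (2 <= i)%N -> x 0 i = 0].

Definition proper_on {S T : topologicalType} (A : set S) (B : set T)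
    (f : S -> T) : Prop :=
  forall C : set T, C `<=` B -> compact C -> compact (A `&` f @^-1` C).

(** The surface [F] is locally flat in the 4-manifold [M]: each point of [F] has
    a neighbourhood [U] in [M] with [(U, U `&` F)] homeomorphic to
    [(disk4, disk2)]. *)
Definition locally_flat {T : topologicalType} (M F : set T) : Prop :=
  forall y, F y -> exists (U O : set T) (h : 'rV[R]_4 -> T),
    [/\ U `<=` M, open O, O y & M `&` O `<=` U] /\
    homeomorphism disk4 U h /\ h @` disk2 = U `&` F.

Definition two_knot (K : 'rV[R]_3 -> 'rV[R]_5) : Prop :=
  [/\ set_fun (sphere 2) (sphere 4) K,
      proper_on (sphere 2) (sphere 4) K,
      smooth_embedding (sphere 2) K &
      locally_flat (sphere 4) (K @` sphere 2)].

(** [phi] is a 2-knot [K] with a point [p] of S^2 and its image removed, read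
    through identifications [a] of R^2 with S^2 \ {p} and [b] of R^4 with
    S^4 \ {K p} (for instance inverse stereographic projections). *)
Definition long_two_knot (phi : 'rV[R]_2 -> 'rV[R]_4) : Prop :=
  exists (K : 'rV[R]_3 -> 'rV[R]_5) (p : 'rV[R]_3)
         (a : 'rV[R]_2 -> 'rV[R]_3) (b : 'rV[R]_4 -> 'rV[R]_5),
    [/\ two_knot K, sphere 2 p,
        diffeomorphism setT (sphere 2 `\ p) a,
        diffeomorphism setT (sphere 4 `\ K p) b &
        forall u, b (phi u) = K (a u)].

(** Ambient isotopies are taken in the smooth category. *)
Definition ambient_isotopy (h : R -> 'rV[R]_4 -> 'rV[R]_4) : Prop :=
  [/\ smooth_on [set q : R^o * 'rV[R]_4 | 0 <= q.1 <= 1] (fun q => h q.1 q.2),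
      forall u, 0 <= u <= 1 -> diffeomorphism setT setT (h u) &
      forall x, h 0 x = x].

Definition ambient_isotopic (phi psi : 'rV[R]_2 -> 'rV[R]_4) : Prop :=
  exists h, ambient_isotopy h /\ h 1 @` range phi = range psi.

(** R[s,t] is rendered as [{poly {poly R}}], with outer variable s and inner
    variable t. *)
Definition poly_map (x y z w : {poly {poly R}}) : 'rV[R]_2 -> 'rV[R]_4 :=
  fun u => \row_(i < 4) ([:: x; y; z; w]`_i).[(u 0 0)%:P].[u 0 1].

End Knots.

(* Main.v *)
(* Let [i] be the standard plane in R^4.  In stereographic charts around [p] and
   [K p], the second one twisted linearly, the 2-knot is a germ tangent to [i].
   A diffeomorphism of R^4 that is the identity off a ball straightens this germ;
   conjugating it by the inversion gives diffeomorphisms [T] of R^4 and [al] of R^2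
   such that [Phi = T o phi o al] equals [i] outside a disk.  Such a [Phi] has a
   smooth left inverse [r] which is the projection outside a ball.

   Let the polynomial map [P] be C^1-close to [Phi - i] on a large disk, let
   [l(y) = (|y| / rho)^(2N)], and put [psi = i + P + l(i) i].  The map
   [H(y) = y + l(y) y + d(r(y))], with [d = psi - Phi - l(Phi) Phi], carries [Phi]
   to [psi].  The radial term dominates the growth of [P], so for large [N] the map
   [H] is strongly monotone, hence a diffeomorphism of R^4.

   Finally, an affine change of [psi] makes the diffeomorphism of R^4 tangent to the
   identity at 0 (whatever its orientation was), and the Alexander trick, after
   flattening the germ at 0, yields the ambient isotopy. *)
Require Import Defs.
From HB Require Import structures.
From mathcomp Require Import all_boot all_order all_algebra fingroup perm.
From mathcomp Require Import all_classical all_reals all_analysis.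
From mathcomp Require Import ring lra.
Set Implicit Arguments.
Unset Strict Implicit.
Unset Printing Implicit Defensive.
Import Order.TTheory GRing.Theory Num.Theory.
Import numFieldNormedType.Exports.
Local Open Scope classical_set_scope.
Local Open Scope ring_scope.

(** * Calculus of C^n and smooth maps *)

(** Approximating [phi] directly fails: a polynomial is close to a given map on a compact set only
    and grows without control beyond it, while the isotopy must live on all of R^4. Hence the
    normalization at infinity, which leaves a compactly supported map to approximate, and the radial
    term, whose exponent is chosen after the polynomial. The normalization is free: [al] does not
    change the image, and [T] becomes one more factor of the final diffeomorphism. New
    diffeomorphisms come from one global criterion, strong monotonicity, which takes the place of
    the inverse function theorem, of patching local inverses and of integrating vector fields.
    Besides [H], it is applied to the identity plus a map with small Lipschitz constant;
    [small_germ] produces such maps from germs with vanishing 1-jet. The correction [d] is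
    prescribed along the surface only, and composing it with the left inverse [r] extends it to
    R^4. *)

Section Calculus.
Context {R : realType}.
Implicit Types V W Z : normedModType R.

Lemma differentiable_norm V W (f : V -> W) x (e : R) : differentiable f x -> 0 < e ->
  \forall h \near (0 : V), `|f (h + x) - f x - 'd f x h| <= e * `|h|.
Proof.
move=> df e0; have := diff_locally df; move=> /eqaddoP /(_ e e0).
apply: filterS => h /=; by rewrite opprD addrA.
Qed.

Lemma differentiable_of_norm V W (f : V -> W) x (L : {linear V -> W}) :
  continuous L -> (forall e : R, 0 < e ->
    \forall h \near (0 : V), `|f (h + x) - f x - L h| <= e * `|h|) ->
  differentiable f x /\ 'd f x = L :> (V -> W).
Proof.
move=> cL H.
have E : f \o shift x = cst (f x) + L +o_ 0 id.
  apply/eqaddoP => e e0; apply: filterS (H e e0) => h /=.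
  by rewrite opprD addrA.
have D := diff_unique cL E; split => //.
by apply/diff_locallyP; rewrite D.
Qed.

Lemma near_eq_diff V W (f g : V -> W) x : {near x, f =1 g} ->
  differentiable f x -> differentiable g x /\ 'd g x = 'd f x :> (V -> W).
Proof.
move=> fg df; apply: differentiable_of_norm; first exact: diff_continuous.
move=> e e0; have := differentiable_norm df e0.
have fx := nbhs_singleton fg.
have fg' : \forall h \near (0 : V), f (h + x) = g (h + x).
  have : (h + x) @[h --> (0 : V)] --> x.
    rewrite -[X in _ --> X]add0r; apply: cvgD; [exact: cvg_id|exact: cvg_cst].
  by move=> /(_ _ fg).
by apply: filterS2 fg' => h <- ; rewrite fx.
Qed.

Lemma Cn_sub V W n (U U' : set V) (f : V -> W) :
  U' `<=` U -> Cn n U f -> Cn n U' f.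
Proof.
move=> UU; elim: n f => [|n IH] f /=; first by move=> h x /UU /h.
by move=> [h1 h2]; split=> [x /UU /h1 //|v]; exact/IH/h2.
Qed.

Lemma open_near V (U : set V) (P : V -> Prop) x : open U ->
  (forall x, U x -> P x) -> U x -> \forall y \near x, P y.
Proof. by move=> oU UP Ux; apply: filterS (open_nbhs_nbhs (conj oU Ux)). Qed.

Lemma Cn_ext V W n (U : set V) (f g : V -> W) : open U ->
  (forall x, U x -> f x = g x) -> Cn n U f -> Cn n U g.
Proof.
move=> oU; elim: n f g => [|n IH] f g fg /=.
  move=> h x Ux; have e : {near x, f =1 g} by exact: open_near fg Ux.
  rewrite /prop_for /continuous_at -(fg x Ux).
  exact: cvg_trans (near_eq_cvg e) (h x Ux).
move=> [h1 h2]; split=> [x Ux|v].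
  exact: (near_eq_diff (open_near oU fg Ux) (h1 x Ux)).1.
by apply: IH (h2 v) => x Ux; apply: near_eq_derive; exact: open_near fg Ux.
Qed.

Lemma Cn_local V W n (U : set V) (f : V -> W) :
  (forall x, U x -> exists U', U' x /\ Cn n U' f) -> Cn n U f.
Proof.
elim: n f => [|n IH] f H /=; first by move=> x /H [U' [Ux]]; exact.
split=> [x /H [U' [Ux []]] h _|v]; first exact: h.
by apply: IH => x /H [U' [Ux [_ /(_ v)]]]; exists U'.
Qed.

Lemma CnW V W n (U : set V) (f : V -> W) : Cn n.+1 U f -> Cn n U f.
Proof.
elim: n f => [|n IH] f [h1 h2]; first by move=> x /h1 /differentiable_continuous.
by split => // v; exact: IH.
Qed.

Lemma Cn_cst V W n (U : set V) (a : W) : Cn n U (cst a : V -> W).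
Proof.
elim: n a => [|n IH] a /=; first by move=> x _; exact: cvg_cst.
split=> [x _|v]; first exact: differentiable_cst.
rewrite (_ : (fun x => _) = cst 0) //.
by rewrite funeqE => x; rewrite derive_cst.
Qed.

Lemma Cn_add V W n (U : set V) (f g : V -> W) : open U ->
  Cn n U f -> Cn n U g -> Cn n U (fun x => f x + g x).
Proof.
move=> oU; elim: n f g => [|n IH] f g /=.
  by move=> h k x Ux; apply: cvgD; [exact: h|exact: k].
move=> [h1 h2] [k1 k2]; split=> [x Ux|v].
  by apply: (@differentiableD _ _ _ f g); [exact: h1|exact: k1].
apply: Cn_ext (IH _ _ (h2 v) (k2 v)) => // x Ux.
by rewrite -(@deriveD _ _ _ f g) //; apply: diff_derivable; [exact: h1|exact: k1].
Qed.

Lemma derive_linear_comp V W Z (f : V -> W) (L : {linear W -> Z}) x v :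
  continuous L -> differentiable f x -> 'D_v (fun y => L (f y)) x = L ('D_v f x).
Proof.
move=> cL df; have dL y : differentiable L y by exact: linear_differentiable.
have dLf : differentiable (L \o f) x by exact: differentiable_comp.
have -> : 'D_v (fun y => L (f y)) x = 'd (L \o f) x v by exact: deriveE.
by rewrite diff_comp // /= diff_lin // deriveE.
Qed.

Lemma Cn_linear_comp V W Z n (U : set V) (f : V -> W) (L : {linear W -> Z}) :
  open U -> continuous L -> Cn n U f -> Cn n U (fun x => L (f x)).
Proof.
move=> oU cL; elim: n f => [|n IH] f /=.
  by move=> h x Ux; apply: continuous_comp; [exact: h|exact: cL].
move=> [h1 h2]; split=> [x Ux|v].
  apply: (@differentiable_comp _ _ _ _ f L); [exact: h1|exact: linear_differentiable].
apply: (Cn_ext oU _ (IH _ (h2 v))) => x Ux.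
by rewrite derive_linear_comp //; exact: h1.
Qed.

Lemma Cn_id V n (U : set V) : open U -> Cn n U (id : V -> V).
Proof.
move=> oU; case: n => [|n]; first by move=> x _; exact: cvg_id.
split=> [x _|v]; first exact: (ex_diff (is_diff_def := is_diff_id x)).
apply: (Cn_ext _ _ (Cn_cst n U v)) => // x _ /=.
by rewrite (derive_id x v).
Qed.

Lemma Cn_linear V Z n (U : set V) (L : {linear V -> Z}) :
  open U -> continuous L -> Cn n U L.
Proof. by move=> oU cL; apply: (Cn_linear_comp (f := id)) => //; exact: Cn_id. Qed.

Lemma Cn_scale V W n (U : set V) (k : R) (f : V -> W) : open U ->
  Cn n U f -> Cn n U (fun x => k *: f x).
Proof.
move=> oU hf; apply: (Cn_linear_comp (L := ( *:%R k))) hf => // x.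
exact: scaler_continuous.
Qed.

Lemma Cn_opp V W n (U : set V) (f : V -> W) : open U ->
  Cn n U f -> Cn n U (fun x => - f x).
Proof.
move=> oU hf; apply: Cn_ext (Cn_scale (-1) oU hf) => // x _; exact: scaleN1r.
Qed.

Lemma Cn_sum V W n (U : set V) m (f : 'I_m -> V -> W) : open U ->
  (forall i, Cn n U (f i)) -> Cn n U (fun x => \sum_(i < m) f i x).
Proof.
move=> oU; elim: m f => [|m IH] f hf.
  by apply: Cn_ext (Cn_cst n U 0) => // x _; rewrite big_ord0.
apply: Cn_ext (Cn_add oU (IH (fun i => f (widen_ord (leqnSn m) i)) _)
  (hf ord_max)) => //= x _; by rewrite big_ord_recr.
Qed.

Lemma Cn_mul V n (U : set V) (f g : V -> R) : open U ->
  Cn n U f -> Cn n U g -> Cn n U (fun x => f x * g x).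
Proof.
move=> oU; elim: n f g => [|n IH] f g.
  by move=> h k x Ux; apply: cvgM; [exact: h|exact: k].
move=> hf hg; have [h1 h2] := hf; have [k1 k2] := hg; split=> [x Ux|v].
  by apply: (@differentiableM _ _ f g); [exact: h1|exact: k1].
apply: (Cn_ext oU _ (Cn_add oU (IH _ _ (CnW hf) (k2 v)) (IH _ _ (CnW hg) (h2 v)))).
move=> x Ux; have -> : (fun y => f y * g y) = f * g by [].
rewrite (@deriveM _ _ f g) //; apply: diff_derivable; [exact: h1|exact: k1].
Qed.

(* Finite-dimensionality, given by coordinates; it is what makes [Cn] stable
   under composition. *)
Definition findim W := exists m (e : 'I_m -> W) (c : 'I_m -> {linear W -> R}),
  (forall i, continuous (c i)) /\ forall w, w = \sum_i c i w *: e i.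

(** By the chain rule the derivative is the sum of the products [c i ('D_v f x) * 'D_(e i) g (f x)],
    to which the induction applies. The basis of [W] replaces the moving direction ['D_v f x] by
    fixed ones, the only ones that [Cn] speaks of. *)
Lemma Cn_comp V W n (U : set V) (U' : set W) (f : V -> W) (g : W -> R) :
  findim W -> open U -> (forall x, U x -> U' (f x)) ->
  Cn n U f -> Cn n U' g -> Cn n U (fun x => g (f x)).
Proof.
move=> [m [e [c [cc ce]]]] oU UU'.
elim: n f g UU' => [|n IH] f g UU'.
  by move=> h k x Ux; apply: continuous_comp; [exact: h|exact/k/UU'].
move=> hf [k1 k2]; have [h1 h2] := hf.
have dgf x : U x -> differentiable (g \o f) x.
  by move=> Ux; apply: differentiable_comp; [exact: h1|exact/k1/UU'].
split=> [//|v].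
have H i : Cn n U (fun x => c i ('D_v f x) * 'D_(e i) g (f x)).
  apply: Cn_mul => //; first exact: (Cn_linear_comp oU (cc i) (h2 v)).
  exact: (IH f ('D_(e i) g) UU' (CnW hf) (k2 _)).
apply: (Cn_ext oU _ (Cn_sum oU H)) => x Ux /=.
have -> : 'D_v (fun y => g (f y)) x = 'd (g \o f) x v by apply: deriveE; exact: dgf.
have dgx : differentiable g (f x) by exact/k1/UU'.
rewrite diff_comp //=; last exact: h1.
rewrite -(deriveE v (h1 x Ux)).
rewrite [in RHS](ce ('D_v f x)) linear_sum; apply: eq_bigr => i _.
by rewrite linearZ (deriveE (e i) dgx).
Qed.

Lemma Cn_inv V n (U : set V) (f : V -> R) : open U ->
  (forall x, U x -> f x != 0) -> Cn n U f -> Cn n U (fun x => (f x)^-1).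
Proof.
move=> oU f0; elim: n => [|n IH].
  by move=> h x Ux; apply: cvgV; [exact: f0|exact: h].
move=> hf; have [h1 h2] := hf; have IHf := IH (CnW hf); split=> [x Ux|v].
  by apply: differentiableV; [exact: h1|exact: f0].
apply: (Cn_ext oU _ (Cn_opp oU (Cn_mul oU (Cn_mul oU IHf IHf) (h2 v)))) => x Ux.
rewrite deriveV ?f0 //; last by apply: diff_derivable; exact: h1.
by rewrite -exprVn expr2 scaleNr.
Qed.

Lemma Cn_derive V W n (U : set V) (f : V -> W) v : Cn n.+1 U f -> Cn n U ('D_v f).
Proof. by move=> [_]; exact. Qed.

Lemma Cn_is_derive n (U : set R) (f df : R -> R) : open U ->
  (forall x, U x -> is_derive x 1 f (df x)) -> Cn n U df -> Cn n.+1 U f.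
Proof.
move=> oU H hdf; have D x : U x -> differentiable f x.
  by move=> Ux; apply/derivable1_diffP; have := H x Ux; case.
split=> [//|v]; apply: (Cn_ext oU _ (Cn_scale v oU hdf)) => x Ux.
rewrite deriveE; last exact: D.
rewrite -[v in RHS]mulr1 (_ : v * 1 = v *: (1 : R)) // linearZ /=.
by have := H x Ux => -[_ <-]; rewrite -deriveE //; exact: D.
Qed.

End Calculus.

Section SmoothAlgebra.
Context {R : realType}.
Implicit Types V W Z : normedModType R.

Definition Cinf V W (U : set V) (f : V -> W) := forall n, Cn n U f.

Lemma Cinf_sub V W (U U' : set V) (f : V -> W) :
  U' `<=` U -> Cinf U f -> Cinf U' f.
Proof. by move=> UU h n; exact: Cn_sub UU (h n). Qed.

Lemma Cinf_ext V W (U : set V) (f g : V -> W) : open U ->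
  (forall x, U x -> f x = g x) -> Cinf U f -> Cinf U g.
Proof. by move=> oU fg h n; exact: Cn_ext oU fg (h n). Qed.

Lemma Cinf_local V W (U : set V) (f : V -> W) :
  (forall x, U x -> exists U', U' x /\ Cinf U' f) -> Cinf U f.
Proof.
by move=> h n; apply: Cn_local => x /h [U' [Ux k]]; exists U'; split.
Qed.

Lemma Cinf_cst V W (U : set V) (a : W) : Cinf U (fun _ : V => a).
Proof. by move=> n; exact: Cn_cst. Qed.

Lemma Cinf_add V W (U : set V) (f g : V -> W) : open U ->
  Cinf U f -> Cinf U g -> Cinf U (fun x => f x + g x).
Proof. by move=> oU h k n; exact: Cn_add. Qed.

Lemma Cinf_opp V W (U : set V) (f : V -> W) : open U ->
  Cinf U f -> Cinf U (fun x => - f x).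
Proof. by move=> oU h n; exact: Cn_opp. Qed.

Lemma Cinf_sub2 V W (U : set V) (f g : V -> W) : open U ->
  Cinf U f -> Cinf U g -> Cinf U (fun x => f x - g x).
Proof. by move=> oU h k; apply: Cinf_add => //; exact: Cinf_opp. Qed.

Lemma Cinf_sum V W (U : set V) m (f : 'I_m -> V -> W) : open U ->
  (forall i, Cinf U (f i)) -> Cinf U (fun x => \sum_(i < m) f i x).
Proof. by move=> oU h n; apply: Cn_sum => // i; exact: h. Qed.

Lemma Cinf_mul V (U : set V) (f g : V -> R) : open U ->
  Cinf U f -> Cinf U g -> Cinf U (fun x => f x * g x).
Proof. by move=> oU h k n; exact: Cn_mul. Qed.

Lemma Cinf_exp V (U : set V) (f : V -> R) k : open U ->
  Cinf U f -> Cinf U (fun x => f x ^+ k).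
Proof.
move=> oU h; elim: k => [|k IH]; first exact: Cinf_cst.
by apply: (Cinf_ext oU _ (Cinf_mul oU h IH)) => // x _; rewrite exprS.
Qed.

Lemma Cinf_prod V (U : set V) m (f : 'I_m -> V -> R) : open U ->
  (forall i, Cinf U (f i)) -> Cinf U (fun x => \prod_(i < m) f i x).
Proof.
move=> oU; elim: m f => [|m IH] f hf.
  by apply: (Cinf_ext oU _ (Cinf_cst U (1 : R))) => // x _; rewrite big_ord0.
apply: (Cinf_ext oU _ (Cinf_mul oU (IH (fun i => f (widen_ord (leqnSn m) i)) _)
  (hf ord_max))) => //= x _; by rewrite big_ord_recr.
Qed.

Lemma Cinf_inv V (U : set V) (f : V -> R) : open U ->
  (forall x, U x -> f x != 0) -> Cinf U f -> Cinf U (fun x => (f x)^-1).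
Proof. by move=> oU f0 h n; exact: Cn_inv. Qed.

Lemma Cinf_linear V Z (U : set V) (L : {linear V -> Z}) :
  open U -> continuous L -> Cinf U L.
Proof. by move=> oU cL n; exact: Cn_linear. Qed.

Lemma Cinf_id V (U : set V) : open U -> Cinf U (id : V -> V).
Proof. by move=> oU n; exact: Cn_id. Qed.

Lemma Cinf_compR V W (U : set V) (U' : set W) (f : V -> W) (g : W -> R) :
  findim W -> open U -> (forall x, U x -> U' (f x)) ->
  Cinf U f -> Cinf U' g -> Cinf U (fun x => g (f x)).
Proof. by move=> fW oU UU h k n; exact: Cn_comp fW oU UU (h n) (k n). Qed.

Lemma Cinf_derive V W (U : set V) (f : V -> W) v : Cinf U f -> Cinf U ('D_v f).
Proof. by move=> h n; exact: Cn_derive (h n.+1). Qed.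

Lemma Cinf_differentiable V W (U : set V) (f : V -> W) x :
  Cinf U f -> U x -> differentiable f x.
Proof. by move=> /(_ 1%N) [h _] /h. Qed.

Lemma Cinf_continuous V W (U : set V) (f : V -> W) x :
  Cinf U f -> U x -> {for x, continuous f}.
Proof. by move=> /(_ 0%N) h /h. Qed.

Lemma findimR : findim R.
Proof.
exists 1%N, (fun _ => 1), (fun _ => idfun); split=> [_ x|w]; first exact: cvg_id.
by rewrite big_ord1 /= -[RHS]/(w * 1) mulr1.
Qed.

(** A named coordinate function, to which a linear structure can be attached. *)
Definition coordmx (m n : nat) (i : 'I_m) (j : 'I_n) (M : 'M[R]_(m, n)) : R := M i j.
Lemma coordmx_is_linear m n i j : linear (@coordmx m n i j).
Proof. by move=> a x y; rewrite /coordmx !mxE. Qed.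
HB.instance Definition _ m n i j := GRing.isLinear.Build R 'M[R]_(m, n) R _
  (@coordmx m n i j) (@coordmx_is_linear m n i j).

Lemma coordmx_continuous m n i j : continuous (@coordmx m n i j).
Proof. exact: coord_continuous. Qed.

Lemma findim_rV m : findim 'rV[R]_m.
Proof.
exists m, (fun i => delta_mx 0 i), (fun i => @coordmx 1 m 0 i); split=> [i|w].
  exact: coordmx_continuous.
exact: row_sum_delta.
Qed.

Lemma findim_prod V W : findim V -> findim W -> findim (V * W)%type.
Proof.
move=> [m [e [c [cc ce]]]] [m' [e' [c' [cc' ce']]]].
pose cl (i : 'I_m) (p : V * W) : R := c i p.1.
pose cr (i : 'I_m') (p : V * W) : R := c' i p.2.
have cll i : linear (cl i) by move=> a x y; rewrite /cl linearP.
have crl i : linear (cr i) by move=> a x y; rewrite /cr linearP.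
pose clM i := GRing.isLinear.Build _ _ _ _ _ (cll i).
pose clL i : {linear (V * W)%type -> R} := HB.pack (cl i) (clM i).
pose crM i := GRing.isLinear.Build _ _ _ _ _ (crl i).
pose crL i : {linear (V * W)%type -> R} := HB.pack (cr i) (crM i).
exists (m + m')%N, (fun k : 'I_(m + m') => match fintype.split k with
  inl i => (e i, 0) | inr j => (0, e' j) end),
  (fun k : 'I_(m + m') => match fintype.split k with inl i => clL i | inr j => crL j end); split.
  move=> k; case: (fintype.split k) => i x /=.
    by apply: (@continuous_comp _ _ _ fst (c i)); [exact: cvg_fst|exact: cc].
  by apply: (@continuous_comp _ _ _ snd (c' i)); [exact: cvg_snd|exact: cc'].
move=> [v w]; rewrite big_split_ord /=.
rewrite (eq_bigr (fun i => c i v *: (e i, 0 : W))); last first.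
  by move=> i _; rewrite (unsplitK (inl i)).
rewrite [X in _ + X](eq_bigr (fun i => c' i w *: (0 : V, e' i))); last first.
  by move=> i _; rewrite (unsplitK (inr i)).
have -> : \sum_(i < m) c i v *: (e i, 0 : W) = (v, 0).
  rewrite {2}(ce v); elim/big_rec2: _ => // i x y _ ->.
  by congr (_, _); rewrite /= scaler0 addr0.
have -> : \sum_(i < m') c' i w *: (0 : V, e' i) = (0, w).
  rewrite {2}(ce' w); elim/big_rec2: _ => // i x y _ ->.
  by congr (_, _); rewrite /= scaler0 addr0.
by congr (_, _); rewrite /= ?addr0 ?add0r.
Qed.

Lemma Cinf_coord V m (U : set V) (f : V -> 'rV[R]_m) i :
  open U -> Cinf U f -> Cinf U (fun x => f x 0 i).
Proof.
move=> oU h n; apply: (Cn_linear_comp (L := @coordmx 1 m 0 i)) => //.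
exact: coordmx_continuous.
Qed.

Lemma Cn_scalel V W n (U : set V) (k : V -> R) (w : W) :
  open U -> Cn n U k -> Cn n U (fun x => k x *: w).
Proof.
move=> oU h; pose d (a : R) := a *: w.
have lin : linear d by move=> ? ? ?; rewrite /d scalerDl scalerA.
pose dM := GRing.isLinear.Build _ _ _ _ _ lin.
pose dL : {linear R -> W} := HB.pack d dM.
apply: (Cn_linear_comp (L := dL)) => //; exact: scalel_continuous.
Qed.

Lemma Cn_row V n m (U : set V) (f : V -> 'rV[R]_m) :
  open U -> (forall i, Cn n U (fun x => f x 0 i)) -> Cn n U f.
Proof.
move=> oU h; have H i := Cn_scalel (delta_mx 0 i : 'rV[R]_m) oU (h i).
by apply: (Cn_ext oU _ (Cn_sum oU H)) => x _; rewrite -row_sum_delta.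
Qed.

Lemma Cinf_row V m (U : set V) (f : V -> 'rV[R]_m) :
  open U -> (forall i, Cinf U (fun x => f x 0 i)) -> Cinf U f.
Proof. by move=> oU h n; apply: Cn_row => // i; exact: h. Qed.

Lemma Cinf_rowE V m (U : set V) (F : 'I_m -> V -> R) :
  open U -> (forall i, Cinf U (F i)) -> Cinf U (fun x => \row_i F i x).
Proof.
move=> oU h; apply: Cinf_row => // i; apply: (Cinf_ext oU _ (h i)) => // x _.
by rewrite mxE.
Qed.

Lemma Cinf_comp V W m (U : set V) (U' : set W) (f : V -> W) (g : W -> 'rV[R]_m) :
  findim W -> open U -> open U' -> (forall x, U x -> U' (f x)) ->
  Cinf U f -> Cinf U' g -> Cinf U (fun x => g (f x)).
Proof.
move=> fW oU oU' UU hf hg; apply: Cinf_row => // i.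
by apply: (Cinf_compR (g := fun y => g y 0 i) fW oU UU hf); exact: Cinf_coord.
Qed.

Lemma Cinf_scale V m (U : set V) (k : V -> R) (f : V -> 'rV[R]_m) :
  open U -> Cinf U k -> Cinf U f -> Cinf U (fun x => k x *: f x).
Proof.
move=> oU hk hf; apply: Cinf_row => // i.
apply: (Cinf_ext oU _ (Cinf_mul oU hk (Cinf_coord i oU hf))) => // x _.
by rewrite mxE.
Qed.

Lemma Cinf_fst V W (U : set (V * W)) : open U -> Cinf U (fst : V * W -> V).
Proof. by move=> oU; apply: Cinf_linear => // x; exact: cvg_fst. Qed.

Lemma Cinf_snd V W (U : set (V * W)) : open U -> Cinf U (snd : V * W -> W).
Proof. by move=> oU; apply: Cinf_linear => // x; exact: cvg_snd. Qed.

Lemma Cinf_rV m (U : set 'rV[R]_m) i : open U -> Cinf U (fun x => x 0 i).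
Proof. by move=> oU; apply: Cinf_coord => //; exact: Cinf_id. Qed.

Lemma Cinf_sqnorm V m (U : set V) (f : V -> 'rV[R]_m) :
  open U -> Cinf U f -> Cinf U (fun x => sqnorm (f x)).
Proof.
move=> oU h; apply: Cinf_sum => // i; apply: Cinf_exp => //; exact: Cinf_coord.
Qed.

Lemma mulmxr_continuous m n (A : 'M[R]_(m, n)) :
  continuous (fun x : 'rV[R]_m => x *m A).
Proof.
suff : Cinf setT (fun x : 'rV[R]_m => x *m A).
  by move=> h x; exact: (Cinf_continuous h).
apply: Cinf_row => [|i]; first exact: openT.
apply: (Cinf_ext openT _ (Cinf_sum (f := fun k (x : 'rV[R]_m) => x 0 k * A k i) openT _)).
  by move=> x _; rewrite mxE.
move=> k; apply: (Cinf_mul (f := fun x : 'rV[R]_m => x 0 k) (g := fun _ => A k i)).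
- exact: openT.
- exact: (Cinf_rV k openT).
- exact: Cinf_cst.
Qed.

Lemma Cinf_mulmx V m n (U : set V) (f : V -> 'rV[R]_m) (A : 'M[R]_(m, n)) :
  open U -> Cinf U f -> Cinf U (fun x => f x *m A).
Proof.
move=> oU h; apply: Cinf_row => // i.
apply: (Cinf_ext oU _ (Cinf_sum (f := fun k x => f x 0 k * A k i) oU _)).
  by move=> x _; rewrite mxE.
by move=> k; apply: Cinf_mul => //; [exact: Cinf_coord|exact: Cinf_cst].
Qed.

(** The Leibniz formula, with permutations enumerated by ordinals to fit [Cinf_sum]. *)
Lemma Cinf_det V m (U : set V) (F : 'I_m -> 'I_m -> V -> R) :
  open U -> (forall i j, Cinf U (F i j)) ->
  Cinf U (fun x => \det (\matrix_(i, j) F i j x)).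
Proof.
move=> oU h.
have -> : (fun x => \det (\matrix_(i, j) F i j x)) =
  (fun x => \sum_(k < #|{perm 'I_m}|) (-1) ^+ (enum_val k : {perm 'I_m}) *
     \prod_(i < m) F i ((enum_val k : {perm 'I_m}) i) x).
  rewrite funeqE => x; rewrite /determinant [LHS]big_enum_val /=.
  apply: eq_big => [k|k _]; rewrite ?unfold_in //.
  by congr (_ * _); apply: eq_bigr => i _; rewrite mxE.
apply: Cinf_sum => // k; apply: Cinf_mul => //; first exact: Cinf_cst.
by apply: Cinf_prod => // i.
Qed.

End SmoothAlgebra.

Section Pair.
Context {R : realType}.

Lemma Cinf_pair (V W Z : normedModType R) (U : set V) (f : V -> W) (g : V -> Z) :
  open U -> Cinf U f -> Cinf U g -> Cinf U (fun x => (f x, g x)).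
Proof.
move=> oU hf hg n; pose il (w : W) : W * Z := (w, 0); pose ir (z : Z) : W * Z := (0, z).
have ill : linear il by move=> a x y; congr pair; rewrite /= scaler0 addr0.
have irl : linear ir by move=> a x y; congr pair; rewrite /= scaler0 addr0.
pose ilM := GRing.isLinear.Build _ _ _ _ _ ill.
pose ilL : {linear W -> (W * Z)%type} := HB.pack il ilM.
pose irM := GRing.isLinear.Build _ _ _ _ _ irl.
pose irL : {linear Z -> (W * Z)%type} := HB.pack ir irM.
have cl : continuous il by move=> w; apply: cvg_pair; [exact: cvg_id|exact: cvg_cst].
have cr : continuous ir by move=> w; apply: cvg_pair; [exact: cvg_cst|exact: cvg_id].
apply: (Cn_ext oU _ (Cn_add oU (Cn_linear_comp (L := ilL) oU cl (hf n))
  (Cn_linear_comp (L := irL) oU cr (hg n)))) => x _.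
by congr pair; rewrite /= ?addr0 ?add0r.
Qed.

End Pair.

(** * Strongly monotone maps *)

Section StronglyMonotone.
Context {R : realType}.
Variable n : nat.
Implicit Types (x y v w : 'rV[R]_n) (f g : 'rV[R]_n -> 'rV[R]_n).

(** Monotonicity needs an inner product, while the norm of row vectors is the sup norm; the factors
    [n%:R] below come from comparing the two. *)
Definition dot x y : R := \sum_(i < n) x 0 i * y 0 i.

Lemma dotC x y : dot x y = dot y x.
Proof. by apply: eq_bigr => i _; rewrite mulrC. Qed.

Lemma dotDl x y z : dot (x + y) z = dot x z + dot y z.
Proof. by rewrite -big_split; apply: eq_bigr => i _; rewrite mxE mulrDl. Qed.

Lemma dotZl a x y : dot (a *: x) y = a * dot x y.
Proof. by rewrite /dot mulr_sumr; apply: eq_bigr => i _; rewrite mxE mulrA. Qed.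

Lemma dotNl x y : dot (- x) y = - dot x y.
Proof. by rewrite -scaleN1r dotZl mulN1r. Qed.

Lemma dotDr x y z : dot x (y + z) = dot x y + dot x z.
Proof. by rewrite ![dot x _]dotC dotDl. Qed.

Lemma dotZr a x y : dot x (a *: y) = a * dot x y.
Proof. by rewrite dotC dotZl dotC. Qed.

Lemma dotNr x y : dot x (- y) = - dot x y.
Proof. by rewrite dotC dotNl dotC. Qed.

Lemma sqnorm_dot x : sqnorm x = dot x x.
Proof. by apply: eq_bigr => i _; rewrite expr2. Qed.

Lemma sqnorm_ge0 x : 0 <= sqnorm x.
Proof. by apply: sumr_ge0 => i _; exact: sqr_ge0. Qed.

Lemma le_coord_norm x i : `|x 0 i| <= `|x|.
Proof.
rewrite [leRHS]/Num.Def.normr/= mx_normrE.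
exact: (le_bigmax _ (fun ij : 'I_1 * 'I_n => `|x ij.1 ij.2|) (0, i)).
Qed.

Lemma norm_le_coord x (b : R) : 0 <= b -> (forall i, `|x 0 i| <= b) -> `|x| <= b.
Proof.
move=> b0 h; rewrite [leLHS]/Num.Def.normr/= mx_normrE.
by apply: bigmax_le => // -[i j] _ /=; rewrite (ord1 i).
Qed.

Lemma dot_le_norm x y : `|dot x y| <= n%:R * (`|x| * `|y|).
Proof.
apply: le_trans (ler_norm_sum _ _ _) _.
have -> : n%:R * (`|x| * `|y|) = \sum_(i < n) (`|x| * `|y|).
  by rewrite sumr_const card_ord mulr_natl.
apply: ler_sum => i _.
by rewrite normrM ler_pM // le_coord_norm.
Qed.

Lemma sqnorm_le_norm x : sqnorm x <= n%:R * `|x| ^+ 2.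
Proof.
by rewrite sqnorm_dot expr2; apply: le_trans (dot_le_norm _ _); exact: ler_norm.
Qed.

Lemma norm_le_sqnorm x : `|x| ^+ 2 <= sqnorm x.
Proof.
rewrite -(sqr_sqrtr (sqnorm_ge0 x)) ler_pXn2r ?nnegrE ?sqrtr_ge0 //.
apply: norm_le_coord => [|i]; first exact: sqrtr_ge0.
rewrite -sqrtr_sqr ler_wsqrtr // /sqnorm (bigD1 i) //= lerDl.
by apply: sumr_ge0 => j _; exact: sqr_ge0.
Qed.

Lemma sqnorm_eq0 x : sqnorm x <= 0 -> x = 0.
Proof.
move=> h; apply/eqP; rewrite -normr_eq0 -sqrf_eq0.
by rewrite eq_le sqr_ge0 andbT (le_trans (norm_le_sqnorm x)).
Qed.

(** Strong monotonicity in the sense of Minty and Browder: a global condition, stable under adding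
    monotone maps and small Lipschitz perturbations. *)
Definition strong_mono (c : R) f :=
  forall x y, c * sqnorm (x - y) <= dot (f x - f y) (x - y).

Lemma strong_mono_norm c f x y : 0 < c -> strong_mono c f ->
  `|x - y| <= n%:R / c * `|f x - f y|.
Proof.
move=> c0 mf; have [->|xy] := eqVneq x y.
  by rewrite !subrr normr0 mulr0.
have xy0 : 0 < `|x - y| by rewrite normr_gt0 subr_eq0.
rewrite mulrAC ler_pdivlMr // mulrC -(ler_pM2r xy0) -mulrA -expr2 -mulrA.
apply: (le_trans (y := c * sqnorm (x - y))).
  by rewrite ler_pM2l // norm_le_sqnorm.
by apply: le_trans (mf x y) (le_trans (ler_norm _) (dot_le_norm _ _)).
Qed.

(** The transpose of the usual convention: vectors are rows and matrices act on the right. *)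
Definition jacobi m (f : 'rV[R]_n -> 'rV[R]_m) x : 'M[R]_(n, m) :=
  \matrix_(i, j) 'D_(delta_mx 0 i) f x 0 j.

Lemma derive_jacobi m (f : 'rV[R]_n -> 'rV[R]_m) x v : differentiable f x -> 'D_v f x = v *m jacobi f x.
Proof.
move=> df; rewrite (deriveE v df) [in LHS](row_sum_delta v) linear_sum.
apply/rowP => j; rewrite mxE summxE; apply: eq_bigr => i _.
by rewrite linearZ /= !mxE deriveE.
Qed.

(** The inequality between [h *: v + x] and [x], divided by [h ^+ 2], passes to the limit. *)
Lemma strong_mono_derive c f x v : strong_mono c f -> differentiable f x ->
  c * sqnorm v <= dot ('D_v f x) v.
Proof.
move=> mf df.
have dv : derivable f x v by exact: diff_derivable.
have cd : continuous (fun w => dot w v).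
  move=> w; apply: (@Cinf_continuous _ _ _ setT (fun w => dot w v) w) => //.
  apply: Cinf_sum => [|i]; first exact: openT.
  apply: Cinf_mul; [exact: openT|exact: Cinf_rV openT|exact: Cinf_cst].
have H : dot (h^-1 *: ((f \o shift x) (h *: v) - f x)) v @[h --> 0^'] -->
  dot ('D_v f x) v := cvg_comp _ _ dv (cd ('D_v f x)).
apply: (cvgr_to_ge H).
near=> h => /=.
have h0 : h != 0 by near: h; exact: nbhs_dnbhs_neq.
have := mf (h *: v + x) x; rewrite addrK dotZr.
rewrite /sqnorm; under eq_bigr do rewrite mxE exprMn.
rewrite -mulr_sumr mulrCA => K.
rewrite dotZl -(ler_pM2l (x := h ^+ 2)); last by rewrite exprn_even_gt0.
by apply: le_trans K _; rewrite [leRHS]mulrA [X in X / h]expr2 mulfK.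
Unshelve. all: by end_near. Qed.

Lemma ball_rV_compact (r : R) : compact [set x : 'rV[R]_n | `|x| <= r].
Proof.
apply: bounded_closed_compact.
  exists r; split; first exact: num_real.
  by move=> s rs x /= xr; exact: le_trans xr (ltW rs).
rewrite (_ : mkset _ = (fun x : 'rV[R]_n => `|x|) @^-1` [set t | t <= r]) //.
apply: closed_comp => [x _|]; last exact: closed_le.
exact: norm_continuous.
Qed.

Lemma continuous_attains_min (m : 'rV[R]_n -> R) (r : R) : continuous m ->
  0 <= r -> (forall x, r < `|x| -> m 0 < m x) -> exists x0, forall x, m x0 <= m x.
Proof.
move=> cm r0 h.
have [||x0 _ hx0] := @EVT_min_rV R n m [set x | `|x| <= r] _ (@ball_rV_compact r).
- by exists 0; rewrite /= normr0.
- exact: continuous_subspaceT.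
exists x0 => x; have [xr|xr] := leP `|x| r; first by apply: hx0; rewrite inE.
by apply: le_trans (ltW (h x xr)); apply: hx0; rewrite inE /= normr0.
Qed.

Lemma differentiable_lip f x : differentiable f x ->
  exists2 C : R, 0 < C & \forall h \near (0 : 'rV[R]_n), `|f (h + x) - f x| <= C * `|h|.
Proof.
move=> df; have [k k0 hk] := linear_lipschitz (diff_continuous df).
exists (k + 1); first by rewrite addr_gt0.
apply: filterS (differentiable_norm df ltr01) => h hh.
rewrite -(subrK ('d f x h) (f (h + x) - f x)) addrC mulrDl.
by apply: le_trans (ler_normD _ _) _; rewrite lerD.
Qed.

(* At a minimum [x0] of [|f x - y|^2], moving in the direction [y - f x0] would
   decrease this function unless [f x0 = y]. *)
Lemma strong_mono_surj c f : 0 < c -> strong_mono c f ->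
  (forall x, differentiable f x) -> forall y, exists x, f x = y.
Proof.
move=> c0 mf df y; pose m x := sqnorm (f x - y).
have cf : continuous f by move=> x; exact: differentiable_continuous.
have cm : continuous m.
  have cs : continuous (@sqnorm R n).
    move=> x; apply: (@Cinf_continuous _ _ _ setT (@sqnorm R n) x) => //.
    exact: (Cinf_sqnorm openT (Cinf_id openT)).
  move=> x; apply: (@continuous_comp _ _ _ (fun x => f x - y)); last exact: cs.
  exact: (cvgB (cf x) (cvg_cst y)).
pose N : R := n%:R; have N0 : 0 <= N by [].
(* For [|x| > r], [strong_mono_norm] gives [|f x - y| > (N + 1) * |f 0 - y|]; the factor [N + 1]
   survives the comparison of norms, so [m 0 < m x]. *)
pose r := N / c * ((N + 1) * `|f 0 - y| + `|f 0 - y|).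
have fy0 := normr_ge0 (f 0 - y).
have r0 : 0 <= r by rewrite /r mulr_ge0 ?divr_ge0 ?addr_ge0 ?mulr_ge0 ?addr_ge0 // ltW.
have [x0 hx0] : exists x0, forall x, m x0 <= m x.
  apply: (continuous_attains_min cm r0) => x rx.
  have := strong_mono_norm x 0 c0 mf; rewrite subr0 => /(lt_le_trans rx).
  rewrite /r => Hlt.
  have {}Hlt : (N + 1) * `|f 0 - y| + `|f 0 - y| < `|f x - f 0|.
    rewrite ltNge; apply/negP => H; move: Hlt; rewrite ltNge => /negP; apply.
    by rewrite ler_wpM2l // divr_ge0 // ltW.
  have : (N + 1) * `|f 0 - y| < `|f x - y|.
    have := ler_normB (f x - y) (f 0 - y); rewrite opprB subrKA => /(lt_le_trans Hlt).
    by rewrite ltrD2r.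
  move=> H; apply: lt_le_trans (norm_le_sqnorm _).
  apply: le_lt_trans (sqnorm_le_norm _) _.
  apply: (le_lt_trans (y := ((N + 1) * `|f 0 - y|) ^+ 2)).
    rewrite exprMn ler_wpM2r ?sqr_ge0 // -/N; nra.
  by rewrite ltr_pXn2r ?nnegrE // mulr_ge0 // addr_ge0.
exists x0; apply/eqP; rewrite -subr_eq0; apply/eqP.
set w := f x0 - y; apply/sqnorm_eq0; rewrite leNgt; apply/negP => w0.
have [C C0 hC] := differentiable_lip (df x0).
have w1 : 0 <= `|w| ^+ 2 by exact: sqr_ge0.
(* Expand [sqnorm w <= sqnorm (w + D)] for the step [- (h *: w)]: by monotonicity the linear term is
   at most [- 2 * c * h * sqnorm w], while [sqnorm D] is of order [h ^+ 2]. *)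
have K h : 0 < h -> `|f (- (h *: w) + x0) - f x0| <= C * `|h *: w| ->
    2 * c * sqnorm w <= h * (N * C ^+ 2 * `|w| ^+ 2).
  move=> h0; rewrite normrZ gtr0_norm // => hl.
  set D := f (- (h *: w) + x0) - f x0 in hl *.
  have E : f (- (h *: w) + x0) - y = w + D.
    by rewrite /w /D [RHS]addrC subrKA.
  have := mf (- (h *: w) + x0) x0; rewrite addrK -/D => MF.
  have := hx0 (- (h *: w) + x0); rewrite /m E -/w.
  move: MF; clearbody D w => MF.
  rewrite !sqnorm_dot dotDl !dotDr (dotC D w).
  move: MF; rewrite dotNr dotZr (dotC D w).
  rewrite sqnorm_dot dotNl dotNr opprK dotZl dotZr.
  have : dot D D <= N * (C * (h * `|w|)) ^+ 2.
    rewrite -sqnorm_dot; apply: le_trans (sqnorm_le_norm _) _.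
    by rewrite ler_wpM2l // ler_pXn2r ?nnegrE // ?mulr_ge0 // ?mulr_ge0 // ltW.
  move: (dot w w) (dot w D) (dot D D) `|w| => a b d e H1 H2 H3.
  have H4 : c * (h * a) <= - b.
    by rewrite -(ler_pM2l h0); lra.
  rewrite -(ler_pM2l h0); lra.
pose k := 2 * c * sqnorm w; pose M := N * C ^+ 2 * `|w| ^+ 2.
have k0 : 0 < k by rewrite !mulr_gt0.
have M0 : 0 <= M := mulr_ge0 (mulr_ge0 N0 (sqr_ge0 C)) w1.
have : \forall h \near (0 : R)^'+, 0 < h /\
   `|f (- (h *: w) + x0) - f x0| <= C * `|- (h *: w)| /\ h * M < k.
  near=> h; split; [by []|split].
    near: h; have T : - (h *: w) @[h --> (0 : R)^'+] --> (0 : 'rV[R]_n).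
      rewrite -[X in _ --> X]oppr0 -(scale0r w); apply: cvgN.
      apply: cvg_at_right_filter; exact: scalel_continuous.
    exact: (T _ hC).
  have : h < k / (M + 1).
    by near: h; apply: nbhs_right_lt; rewrite divr_gt0 // ltr_wpDl.
  rewrite ltr_pdivlMr ?ltr_wpDl // mulrDr mulr1; apply: lt_trans.
  by rewrite ltrDl.
move=> /filter_ex [h [h0 [h1 h2]]]; move: h1; rewrite normrN => /(K h h0).
by rewrite leNgt h2.
Unshelve. all: by end_near. Qed.

End StronglyMonotone.

Lemma linear_bound_cvg0 {R : realType} {V W : normedModType R} (u : V -> W) (N : R) :
  0 <= N -> (forall h, `|u h| <= N * `|h|) -> u h @[h --> (0 : V)] --> (0 : W).
Proof.
move=> N0 hu; apply/cvgr0Pnorm_le => d d0; near=> h.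
apply: le_trans (hu _) _.
have : `|h| < d / (N + 1) by near: h; apply: nbhs0_lt; rewrite divr_gt0 // ltr_wpDl.
rewrite ltr_pdivlMr ?ltr_wpDl // mulrDr mulr1 mulrC => /ltW; apply: le_trans.
by rewrite lerDl.
Unshelve. all: by end_near. Qed.

(** * Smoothness of the inverse of a strongly monotone map *)

Section InverseFunction.
Context {R : realType}.
Variable n : nat.
Implicit Types (x y v w : 'rV[R]_n) (f g : 'rV[R]_n -> 'rV[R]_n).

Lemma strong_mono_jacobi_unit (c : R) f x : 0 < c -> strong_mono c f ->
  differentiable f x -> jacobi f x \in unitmx.
Proof.
move=> c0 mf df; rewrite -row_free_unit; apply/row_freeP.
have : row_free (jacobi f x).
  apply: inj_row_free => v Jv.
  have := strong_mono_derive v mf df; rewrite derive_jacobi // Jv.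
  rewrite (_ : dot 0 v = 0); last by rewrite -(scale0r v) dotZl mul0r.
  by rewrite pmulr_rle0 // => /sqnorm_eq0.
by move/row_freeP.
Qed.

(** Cramer's rule, a form in which the inverse is visibly smooth in the partial derivatives. *)
Lemma invmx_jacobiE f x v j : jacobi f x \in unitmx ->
  (v *m invmx (jacobi f x)) 0 j =
  \sum_(i < n) v 0 i * ((\det (jacobi f x))^-1 * cofactor (jacobi f x) j i).
Proof.
move=> uJ; rewrite mxE; apply: eq_bigr => i _.
by rewrite /invmx uJ !mxE.
Qed.

Lemma Cinf_jacobi f i j : Cinf setT f -> Cinf setT (fun x => jacobi f x i j).
Proof.
move=> hf; apply: (Cinf_ext openT _ (Cinf_coord j openT (Cinf_derive (delta_mx 0 i) hf))).
by move=> x _; rewrite mxE.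
Qed.

Lemma Cinf_cofactor m (F : 'rV[R]_n -> 'M[R]_m) i j :
  (forall i j, Cinf setT (fun x => F x i j)) -> Cinf setT (fun x => cofactor (F x) i j).
Proof.
move=> h; apply: Cinf_mul; [exact: openT|exact: Cinf_cst|].
pose G (a b : 'I_m.-1) x := F x (lift i a) (lift j b).
apply: (Cinf_ext openT _ (Cinf_det (F := G) openT _)) => [x _|a b]; last exact: h.
by congr (\det _); apply/matrixP => a b; rewrite !mxE.
Qed.

Lemma Cinf_invmx_jacobi f v : Cinf setT f -> (forall x, jacobi f x \in unitmx) ->
  Cinf setT (fun x => v *m invmx (jacobi f x)).
Proof.
move=> hf uJ; apply: Cinf_row => [|j]; first exact: openT.
have hJ := fun i j => Cinf_jacobi i j hf.
pose G i x := v 0 i * ((\det (jacobi f x))^-1 * cofactor (jacobi f x) j i).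
apply: (Cinf_ext openT _ (Cinf_sum (f := G) openT _)) => [x _|i].
  by rewrite invmx_jacobiE.
apply: Cinf_mul; [exact: openT|exact: Cinf_cst|].
apply: Cinf_mul; [exact: openT| |exact: Cinf_cofactor].
apply: Cinf_inv; first exact: openT.
  by move=> x _; rewrite -unitfE -unitmxE.
apply: (Cinf_ext openT _ (Cinf_det (F := fun i j x => jacobi f x i j) openT _)) => //.
by move=> x _; congr (\det _); apply/matrixP => a b; rewrite mxE.
Qed.

(** Strong monotonicity makes [g] Lipschitz, so the first-order error of [f] at [g y], transported
    by the inverse Jacobian, is small compared with the increment of [y]. *)
Lemma inverse_differentiable f g y (c : R) : 0 < c -> strong_mono c f ->
  differentiable f (g y) -> (forall z, f (g z) = z) ->
  differentiable g y /\ 'd g y = (fun v => v *m invmx (jacobi f (g y))) :> (_ -> _).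
Proof.
move=> c0 mf df fg; set x := g y; set J := jacobi f x.
have uJ : J \in unitmx by exact: strong_mono_jacobi_unit mf df.
pose L : {linear 'rV[R]_n -> 'rV[R]_n} := mulmxr (invmx J).
have cL : continuous L by exact: mulmxr_continuous.
have [k k0 hk] := linear_lipschitz cL.
pose N : R := n%:R / c; have N0 : 0 <= N by rewrite divr_ge0 // ltW.
have lipg z z' : `|g z - g z'| <= N * `|z - z'|.
  by have := strong_mono_norm (g z) (g z') c0 mf; rewrite !fg.
have [|dg Eg] := @differentiable_of_norm R _ _ g y L cL; last first.
  by split => //; rewrite Eg.
move=> e e0.
(* Compensates the bound [k] of the inverse Jacobian and the Lipschitz constant [N] of [g]; [+ 1]
   keeps the denominator positive in dimension 0. *)
have e'0 : 0 < e / (k * (N + 1)) by rewrite divr_gt0 // mulr_gt0 // ltr_wpDl.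
have := differentiable_norm df e'0; rewrite -/x => near0.
have gc : g (h + y) - g y @[h --> (0 : 'rV[R]_n)] --> (0 : 'rV[R]_n).
  by apply: (@linear_bound_cvg0 _ _ _ _ N) => // h; rewrite -[X in N * `|X|](addrK y).
have : \forall h \near (0 : 'rV[R]_n), `|f ((g (h + y) - g y) + x) - f x
    - 'd f x (g (h + y) - g y)| <= e / (k * (N + 1)) * `|g (h + y) - g y|.
  exact: gc _ near0.
apply: filterS => h; set u := g (h + y) - g y.
have ux : u + x = g (h + y) by rewrite /u /x subrK.
rewrite ux !fg addrK -deriveE // derive_jacobi // -/J => H.
have -> : u - h *m invmx J = - L (h - u *m J).
  by rewrite /L /= mulmxBl mulmxK // opprB.
rewrite normrN; apply: le_trans (hk _) _.
apply: le_trans (ler_wpM2l (ltW k0) H) _.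
have := lipg (h + y) y; rewrite addrK -/u => hu.
have -> : k * (e / (k * (N + 1)) * `|u|) = e / (N + 1) * `|u|.
  have N1 : 0 < N + 1 by rewrite ltr_wpDl.
  by field; rewrite (gt_eqF N1) (gt_eqF k0).
rewrite -mulrA ler_pM2l // ler_pdivrMl ?ltr_wpDl //.
by apply: le_trans hu _; rewrite ler_wpM2r // lerDl.
Qed.

(** Smoothness is a bootstrap: the derivative of [g] is the inverse Jacobian, a smooth map, composed
    with [g], so each degree of regularity of [g] yields the next. *)
Lemma strong_mono_diffeo (c : R) f : 0 < c -> Cinf setT f -> strong_mono c f ->
  exists g, [/\ Cinf setT g, cancel f g & cancel g f].
Proof.
move=> c0 hf mf.
have df x : differentiable f x by exact: (Cinf_differentiable hf).
have sf := strong_mono_surj c0 mf df.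
have [g fg] := choice sf.
have injf : injective f.
  move=> x y fxy; apply/eqP; rewrite -subr_eq0 -normr_le0.
  by have := strong_mono_norm x y c0 mf; rewrite fxy subrr normr0 mulr0.
exists g; split=> [|x|y]; [|exact/injf/fg|exact: fg].
have D y := inverse_differentiable c0 mf (df (g y)) fg.
have uJ x : jacobi f x \in unitmx by exact: strong_mono_jacobi_unit mf (df x).
elim=> [|m IH]; first by move=> y _; exact: differentiable_continuous (D y).1.
split=> [y _|v]; first exact: (D y).1.
have hN := Cinf_invmx_jacobi v hf uJ.
have H j : Cn m setT (fun y => (v *m invmx (jacobi f (g y))) 0 j).
  exact: (Cn_comp (findim_rV n) openT (fun _ _ => I) IH (Cinf_coord j openT hN m)).
have H' := Cn_row openT H.
apply: (Cn_ext openT _ H') => y _.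
by rewrite (deriveE v (D y).1) (D y).2.
Qed.

End InverseFunction.

(** * Mean value estimates *)

Section MeanValue.
Context {R : realType}.

Lemma mean_value_scalar (V : normedModType R) (B : set V) (f : V -> R) (C : R) x y :
  (forall t : R, 0 <= t <= 1 -> B (x + t *: (y - x))) ->
  (forall z, B z -> differentiable f z) ->
  (forall z, B z -> `|'D_(y - x) f z| <= C * `|y - x|) ->
  `|f y - f x| <= C * `|y - x|.
Proof.
move=> seg df bd; pose p (t : R) : V := x + t *: (y - x).
have dp (t : R) : differentiable p t /\ 'd p t = (fun s : R => s *: (y - x)) :> (_ -> _).
  have D : is_diff t p (0 + (fun s : R => s *: (y - x))).
    exact: (is_diffD (is_diff_cst x t) (is_diff_scalel t (y - x))).
  by split; [exact: (ex_diff (is_diff_def := D))|rewrite diff_val add0r].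
have hp (t : R) : t \in `[0, 1] -> is_derive t 1 (f \o p) ('D_(y - x) f (p t)).
  rewrite in_itv /= => t01; have dft := df _ (seg t t01).
  have D : differentiable (f \o p) t := differentiable_comp (dp t).1 dft.
  apply: DeriveDef; first exact: diff_derivable D.
  by rewrite (deriveE (1 : R) D) (diff_comp (dp t).1 dft) /= (dp t).2 scale1r (deriveE _ dft).
have hc : {within `[0, 1 : R], continuous (f \o p)}.
  by apply: derivable_within_continuous => t /hp; case.
have ho (t : R) : t \in `]0, 1[ -> is_derive t 1 (f \o p) ('D_(y - x) f (p t)).
  by move=> t01; apply: hp; exact: subset_itv_oo_cc t01.
have [c c01] := @MVT_segment R (f \o p) (fun t : R => 'D_(y - x) f (p t)) 0 1 ler01 ho hc.
have p1 : p 1 = y by rewrite /p scale1r addrC subrK.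
have p0 : p 0 = x by rewrite /p scale0r addr0.
rewrite subr0 mulr1 /= p1 p0 => ->.
by apply: bd; apply: seg; move: c01; rewrite in_itv.
Qed.

Lemma segment_ball (V : normedModType R) (x0 x y : V) (r t : R) : 0 <= t <= 1 ->
  `|x - x0| <= r -> `|y - x0| <= r -> `|x + t *: (y - x) - x0| <= r.
Proof.
move=> /andP[t0 t1] hx hy.
have -> : x + t *: (y - x) - x0 = (1 - t) *: (x - x0) + t *: (y - x0).
  rewrite scalerBl scale1r -[x + _ - x0]addrA [_ - x0]addrC addrA -[RHS]addrA.
  congr (_ + _); rewrite addrC -scalerBr; congr (_ *: _).
  by rewrite opprB addrA subrK.
apply: le_trans (ler_normD _ _) _; rewrite !normrZ ger0_norm ?subr_ge0 // ger0_norm //.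
have -> : r = (1 - t) * r + t * r by rewrite -mulrDl subrK mul1r.
by rewrite lerD // ler_wpM2l // subr_ge0.
Qed.

Lemma derive_bound n (V : normedModType R) (f : 'rV[R]_n -> V) (c : R) x v :
  differentiable f x -> (forall i, `|'D_(delta_mx 0 i) f x| <= c) ->
  `|'D_v f x| <= n%:R * c * `|v|.
Proof.
move=> df h; rewrite (deriveE v df) [in leLHS](row_sum_delta v) linear_sum.
apply: le_trans (ler_norm_sum _ _ _) _.
have -> : n%:R * c * `|v| = \sum_(i < n) (`|v| * c).
  by rewrite sumr_const card_ord -[RHS]mulr_natl [`|v| * c]mulrC mulrA.
apply: ler_sum => i _; rewrite linearZ normrZ -deriveE //.
by rewrite ler_pM // le_coord_norm.
Qed.

(** The scalar theorem is applied to each coordinate, which is enough for the sup norm. *)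
Lemma mean_value n m (U : set 'rV[R]_n) (f : 'rV[R]_n -> 'rV[R]_m) (c r : R) x0 x y :
  0 <= c -> (forall z, `|z - x0| <= r -> differentiable f z) ->
  (forall z i, `|z - x0| <= r -> `|'D_(delta_mx 0 i) f z| <= c) ->
  `|x - x0| <= r -> `|y - x0| <= r -> `|f x - f y| <= n%:R * c * `|x - y|.
Proof.
move=> c0 df bd hx hy; apply: norm_le_coord => [|j].
  by rewrite !mulr_ge0.
have dj z : differentiable f z -> differentiable (fun w => f w 0 j) z /\
    forall v, 'D_v (fun w => f w 0 j) z = 'D_v f z 0 j.
  move=> dfz; have dc := @linear_differentiable R _ _ (@coordmx R 1 m 0 j) (f z)
     (@coordmx_continuous R 1 m 0 j).
  split=> [|v]; first exact: (differentiable_comp dfz dc).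
  exact: (derive_linear_comp v (@coordmx_continuous R 1 m 0 j) dfz).
have := @mean_value_scalar _ [set z | `|z - x0| <= r] (fun w => f w 0 j) (n%:R * c) y x.
rewrite !mxE; apply.
- by move=> t t01; exact: segment_ball.
- by move=> z /df /dj [].
- move=> z zr; rewrite (dj z (df z zr)).2.
  apply: le_trans (le_coord_norm _ _) _; apply: derive_bound; first exact: df.
  by move=> i; exact: bd.
Qed.

Lemma norm_bounded_on_ball n (V : normedModType R) (f : 'rV[R]_n -> V) (r : R) :
  continuous f -> exists2 C : R, 0 <= C & forall x, `|x| <= r -> `|f x| <= C.
Proof.
move=> cf; have [r0|r0] := leP 0 r; last first.
  by exists 0 => // x xr; have := le_lt_trans (le_trans (normr_ge0 x) xr) r0; rewrite ltxx.
have cn : continuous (fun x => `|f x|).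
  by move=> x; apply: (continuous_comp (cf x)); exact: norm_continuous.
have [||x0 _ hx0] := @EVT_max_rV R n (fun x => `|f x|) [set x | `|x| <= r] _
  (@ball_rV_compact _ _ r).
- by exists 0; rewrite /= normr0.
- exact: continuous_subspaceT.
by exists `|f x0| => // x xr; apply: hx0; rewrite inE.
Qed.

Lemma smooth_lipschitz_on_ball n m (f : 'rV[R]_n -> 'rV[R]_m) (r : R) :
  Cinf setT f -> exists2 C : R, 0 <= C &
    forall x y, `|x| <= r -> `|y| <= r -> `|f x - f y| <= C * `|x - y|.
Proof.
move=> hf.
have H (i : 'I_n) : exists C : R, 0 <= C /\
    forall x, `|x| <= r -> `|'D_(delta_mx 0 i) f x| <= C.
  have [|C C0 hC] := @norm_bounded_on_ball n _ ('D_(delta_mx 0 i) f) r.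
    by move=> x; apply: (@Cinf_continuous _ _ _ setT) => //; exact: Cinf_derive.
  by exists C.
have [C hC] := choice H; pose c := \sum_i C i.
have Cc i : C i <= c.
  by rewrite /c (bigD1 i) //= lerDl sumr_ge0 // => j _; exact: (hC j).1.
have c0 : 0 <= c by apply: sumr_ge0 => j _; exact: (hC j).1.
exists (n%:R * c) => [|x y hx hy]; first by rewrite mulr_ge0.
apply: (@mean_value n m setT f c r 0) => //; rewrite ?subr0 //.
  by move=> z _; exact: (Cinf_differentiable hf).
move=> z i; rewrite subr0 => zr; exact: le_trans ((hC i).2 z zr) (Cc i).
Qed.

End MeanValue.

(** * Cutoff functions and small germs *)

Section Cutoff.
Context {R : realType}.

(* [expinv k x] is [x^-k * exp(-1/x)] on the positive axis, extended by 0; the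
   derivative of [expinv k] is a combination of [expinv k.+1] and [expinv k.+2]. *)
Definition expinv (k : nat) (x : R) : R :=
  if 0 < x then x ^- k * expR (- x^-1) else 0.

(** For positive [k], raise [y / k <= expR (y / k)] to the power [k]. *)
Lemma expR_ge_pow (k : nat) (y : R) : 0 <= y -> y ^+ k <= k%:R ^+ k * expR y.
Proof.
case: k => [|k] y0; first by rewrite !expr0 mul1r -expR0 ler_expR.
have k0 : (0 : R) < k.+1%:R by rewrite ltr0n.
have -> : expR y = expR (y / k.+1%:R) ^+ k.+1.
  by rewrite -expRM_natl -mulr_natl mulrCA divff ?mulr1 // gt_eqF.
rewrite -exprMn ler_pXn2r ?nnegrE ?mulr_ge0 ?expR_ge0 ?(ltW k0) //.
rewrite -ler_pdivrMl // mulrC; apply: le_trans (expR_ge1Dx _).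
by rewrite lerDr.
Qed.

(** [expR_ge_pow] at [x^-1] with exponent [k.+2]. The square that is left over makes [expinv k]
    differentiable at 0, with derivative 0. *)
Lemma expinv_le (k : nat) (x : R) : `|expinv k x| <= (k.+2)%:R ^+ k.+2 * x ^+ 2.
Proof.
rewrite /expinv; case: ifPn => [x0|_]; last first.
  by rewrite normr0; apply: mulr_ge0; [apply: exprn_ge0|exact: sqr_ge0].
rewrite ger0_norm; last by rewrite mulr_ge0 ?expR_ge0 // invr_ge0 exprn_ge0 // ltW.
have xV : 0 <= x^-1 by rewrite invr_ge0 ltW.
have := expR_ge_pow k.+2 xV.
rewrite expRN -exprVn => H.
rewrite -ler_pdivlMr; last by rewrite invr_gt0 expR_gt0.
rewrite invrK -(ler_pM2r (x := x^-1 ^+ 2)); last by rewrite exprn_gt0 // invr_gt0.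
rewrite -exprD addn2; apply: le_trans H _.
move: (_%:R ^+ _) (expR _) => a e; rewrite (_ : _ * x^-1 ^+ 2 = a * e) //.
by field; rewrite gt_eqF.
Qed.

Lemma is_derive_expinv (k : nat) (x : R) :
  is_derive x 1 (expinv k) (expinv k.+2 x - k%:R * expinv k.+1 x).
Proof.
have [x0|x0|x0] := ltgtP x 0.
- have -> : expinv k.+2 x - k%:R * expinv k.+1 x = 0.
    by rewrite /expinv ltNge (ltW x0) /= mulr0 subr0.
  apply: (@near_eq_is_derive R R R (cst 0) (expinv k) x 1 0 _ (is_derive_cst (0 : R) x (1 : R))).
  near=> y; rewrite /expinv /= ltNge; suff -> : y <= 0 by [].
  by apply: ltW; near: y; exact: lt_nbhsl.
- pose f (y : R) := y ^- k * expR (- y^-1).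
  apply: (@near_eq_is_derive R R R f (expinv k) x 1).
    near=> y; rewrite /expinv; suff -> : 0 < y by [].
    by near: y; exact: lt_nbhsr.
  have xn0 : x != 0 by rewrite gt_eqF.
  have dV : is_derive x 1 (@GRing.inv R) (- x ^- 2).
    by have := is_deriveV xn0 (is_derive_id x (1 : R)); rewrite scaler1.
  have dE : is_derive x 1 (expR \o (- @GRing.inv R)) (expR (- x^-1) * x ^- 2).
    have := @is_derive1_comp R expR (- @GRing.inv R) x _ _ (is_derive_expR (- x^-1)) (is_deriveN dV).
    by rewrite opprK.
  have EX y : (@GRing.inv R ^+ k) y = y^-1 ^+ k.
    by elim: (k) => [|m IH]; rewrite ?expr0 // !exprS -IH.
  have := is_deriveM (is_deriveX k dV) dE.
  have -> : (@GRing.inv R ^+ k * (expR \o - @GRing.inv R)) = f.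
    by apply/funext => y; rewrite -[LHS]/((@GRing.inv R ^+ k) y * expR (- y^-1)) EX exprVn.
  rewrite EX /expinv x0 => D; apply: (is_derive_eq D); rewrite /=.
  rewrite -[(- _) x]/(- x^-1); move: (expR _) => e {D EX dE dV f}; rewrite /GRing.scale /= -!exprVn; case: k => [|k] /=.
    by rewrite !mul0r; ring.
  by rewrite !exprS; ring.
- rewrite x0 /expinv !ltxx mulr0 subr0 -/(expinv k).
  have [|D E] := @differentiable_of_norm R R R (expinv k) 0 ( *:%R (0 : R))
    (@scaler_continuous _ _ (0 : R)); last first.
    apply: DeriveDef; first exact: diff_derivable.
    by rewrite (deriveE (1 : R) D) E; exact: mul0r.
  move=> e e0; pose C : R := k.+2%:R ^+ k.+2.
  have C0 : 0 < C by rewrite exprn_gt0 // ltr0n.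
  have : \forall h \near (0 : R), `|h| < e / C by apply: nbhs0_lt; rewrite divr_gt0.
  apply: filterS => h he; rewrite -[X in _ - _ - X]/(0 * h) mul0r subr0 addr0 [expinv k 0]/expinv ltxx subr0.
  apply: le_trans (expinv_le k h) _; rewrite -/C -real_normK ?num_real // expr2 mulrA.
  by rewrite ler_wpM2r // mulrC -ler_pdivlMr // ltW.
Unshelve. all: by end_near. Qed.

Lemma Cinf_expinv k : Cinf setT (expinv k).
Proof.
move=> n; elim: n k => [|n IH] k.
  move=> x _; apply: differentiable_continuous; apply/derivable1_diffP.
  exact: (@ex_derive _ _ _ _ _ _ _ (is_derive_expinv k x)).
apply: (Cn_is_derive openT (fun x _ => is_derive_expinv k x)).
exact: (Cn_add openT (IH k.+2) (Cn_opp openT (Cn_scale k%:R openT (IH k.+1)))).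
Qed.

Lemma expinv0_gt0 x : 0 < x -> 0 < expinv 0 x.
Proof. by move=> x0; rewrite /expinv x0 expr0 invr1 mul1r expR_gt0. Qed.

Lemma expinv0_ge0 x : 0 <= expinv 0 x.
Proof.
by have [/expinv0_gt0/ltW//|x0] := ltP 0 x; rewrite /expinv ltNge x0.
Qed.

Lemma expinv_eq0 k x : x <= 0 -> expinv k x = 0.
Proof. by move=> x0; rewrite /expinv ltNge x0. Qed.

(** The usual quotient of flat functions; the two summands of the denominator vanish on disjoint
    half-lines. *)
Definition step (t : R) : R :=
  expinv 0 (2 - t) / (expinv 0 (2 - t) + expinv 0 (t - 1)).

Lemma step_den_gt0 t : 0 < expinv 0 (2 - t) + expinv 0 (t - 1).
Proof.
have [t2|t2] := ltP t 2.
  by rewrite ltr_pwDl // ?expinv0_ge0 // expinv0_gt0 // subr_gt0.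
by rewrite ltr_wpDl ?expinv0_ge0 // expinv0_gt0 //; lra.
Qed.

Lemma step1 t : t <= 1 -> step t = 1.
Proof.
move=> t1; rewrite /step [expinv 0 (t - 1)]expinv_eq0 ?subr_le0 // addr0 divff //.
by rewrite gt_eqF // expinv0_gt0 //; lra.
Qed.

Lemma step0 t : 2 <= t -> step t = 0.
Proof. by move=> t2; rewrite /step expinv_eq0 ?subr_le0 // mul0r. Qed.

Lemma step01 t : 0 <= step t <= 1.
Proof.
rewrite /step divr_ge0 ?expinv0_ge0 ?(ltW (step_den_gt0 t)) //=.
by rewrite ler_pdivrMr ?step_den_gt0 // mul1r lerDl expinv0_ge0.
Qed.

Lemma Cinf_step : Cinf setT step.
Proof.
have H1 : Cinf setT (fun t : R => expinv 0 (2 - t)).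
  apply: (Cinf_compR findimR openT (fun _ _ => I) _ (Cinf_expinv 0)).
  exact: (Cinf_sub2 openT (Cinf_cst _ _) (Cinf_id openT)).
have H2 : Cinf setT (fun t : R => expinv 0 (t - 1)).
  apply: (Cinf_compR findimR openT (fun _ _ => I) _ (Cinf_expinv 0)).
  exact: (Cinf_sub2 openT (Cinf_id openT) (Cinf_cst _ _)).
apply: (Cinf_mul openT H1 (Cinf_inv openT _ (Cinf_add openT H1 H2))) => t _.
by rewrite gt_eqF // step_den_gt0.
Qed.

Section Bump.
Variable n : nat.

(* The sum of squares makes [cutoff] smooth; the constant [n + 1] accounts for the
   comparison with the sup norm. *)
Definition cutoff (x : 'rV[R]_n) : R := step (sqnorm x / (n%:R + 1)).

Lemma Cinf_cutoff : Cinf setT cutoff.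
Proof.
apply: (Cinf_compR findimR openT (fun _ _ => I) _ Cinf_step).
apply: (Cinf_mul openT (Cinf_sqnorm openT (Cinf_id openT)) (Cinf_cst _ _)).
Qed.

Lemma cutoff01 x : 0 <= cutoff x <= 1. Proof. exact: step01. Qed.

Lemma cutoff1 x : `|x| <= 1 -> cutoff x = 1.
Proof.
move=> x1; apply: step1; have N0 : 0 <= (n%:R : R) by [].
rewrite ler_pdivrMr ?ltr_wpDl // mul1r.
apply: le_trans (sqnorm_le_norm x) _.
by apply: (@le_trans _ _ n%:R); rewrite ?lerDl // ler_piMr // exprn_ile1.
Qed.

(** A square root would give a sharper radius; this one works because [|x| <= |x| ^+ 2] there. *)
Lemma cutoff0 x : 2 * (n%:R + 1) <= `|x| -> cutoff x = 0.
Proof.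
move=> x2; apply: step0; have N0 : 0 <= (n%:R : R) by [].
rewrite ler_pdivlMr ?ltr_wpDl //.
apply: le_trans (norm_le_sqnorm x).
apply: (le_trans x2); rewrite expr2 ler_peMr //.
by apply: le_trans x2; lra.
Qed.

(** The ball exceeds the support by a collar of width 1: two points on either side of the collar
    have distance at least 1, and their values differ by at most 1. *)
Lemma cutoff_lipschitz : exists2 C : R, 0 <= C &
  forall x y, `|cutoff x - cutoff y| <= C * `|x - y|.
Proof.
pose b (x : 'rV[R]_n) : 'rV[R]_1 := \row_(i < 1) cutoff x.
have [C C0 hC] := @smooth_lipschitz_on_ball R n 1 b (2 * (n%:R + 1) + 1)
  (Cinf_rowE openT (fun _ => Cinf_cutoff)).
have {}hC x y : `|x| <= 2 * (n%:R + 1) + 1 -> `|y| <= 2 * (n%:R + 1) + 1 ->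
    `|cutoff x - cutoff y| <= C * `|x - y|.
  move=> hx hy; apply: le_trans (hC x y hx hy).
  by have := le_coord_norm (b x - b y) 0; rewrite !mxE.
exists (C + 1) => [|x y]; first by rewrite addr_ge0.
wlog xy : x y / `|x| <= `|y|.
  by move=> H; case/orP: (le_total `|x| `|y|) => /H // ; rewrite distrC (distrC y).
have [y1|y1] := leP `|y| (2 * (n%:R + 1) + 1).
  apply: le_trans (hC x y (le_trans xy y1) y1) _.
  by rewrite ler_wpM2r // lerDl.
have [x1|x1] := leP (2 * (n%:R + 1)) `|x|.
  rewrite !cutoff0 ?subrr ?normr0 ?mulr_ge0 ?addr_ge0 //.
  exact: le_trans x1 xy.
rewrite [cutoff y]cutoff0 ?subr0; last by apply: ltW; apply: lt_trans y1; rewrite ltrDl.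
have /andP[b0 b1] := cutoff01 x; rewrite ger0_norm //; apply: le_trans b1 _.
have : 1 <= `|x - y|.
  rewrite distrC; apply: le_trans (lerB_dist _ _); lra.
by move: `|x - y| => d d1; nra.
Qed.

End Bump.
End Cutoff.

(** * Germs with vanishing 1-jet *)

Section SmallGerm.
Context {R : realType}.

Lemma near_closed_ball (V : normedModType R) (P : set V) (x0 : V) :
  (\forall z \near x0, P z) -> exists2 r : R, 0 < r & forall z, `|z - x0| <= r -> P z.
Proof.
move=> /nbhs_ballP[e /= e0 he]; exists (e / 2); first by rewrite divr_gt0.
move=> z hz; apply: he; rewrite -ball_normE /= distrC.
by apply: le_lt_trans hz _; rewrite ltr_pdivrMr // ltr_pMr // ltr1n.
Qed.

Lemma near_forall_fin (V : normedModType R) (I : finType) (P : I -> set V) (x0 : V) :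
  (forall i, \forall z \near x0, P i z) -> \forall z \near x0, forall i, P i z.
Proof. exact: filter_forall. Qed.

Lemma small_near (V W : normedModType R) (U : set V) (f : V -> W) x0 (c : R) :
  Cinf U f -> U x0 -> f x0 = 0 -> 0 < c -> \forall z \near x0, `|f z| <= c.
Proof.
move=> hf Ux f0 c0.
have : f @ x0 --> (0 : W) by rewrite -f0; exact: (Cinf_continuous hf Ux).
by move=> /cvgr0Pnorm_le; apply.
Qed.

Lemma open_norm_lt n (x0 : 'rV[R]_n) (r : R) : open [set x : 'rV[R]_n | `|x - x0| < r].
Proof.
rewrite (_ : mkset _ = ball x0 r); first exact: ball_open.
by rewrite -ball_normE; apply/seteqP; split=> x /=; rewrite distrC.
Qed.

Lemma open_norm_gt n (x0 : 'rV[R]_n) (r : R) : open [set x : 'rV[R]_n | r < `|x - x0|].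
Proof.
rewrite (_ : mkset _ = (fun x : 'rV[R]_n => `|x - x0|) @^-1` [set t | r < t]) //.
apply: open_comp => [x _|]; last exact: open_gt.
apply: (@continuous_comp _ _ _ (fun x : 'rV[R]_n => x - x0) (@Num.norm R _)).
  exact: (cvgB (@cvg_id _ (nbhs x)) (cvg_cst x0)).
exact: norm_continuous.
Qed.

(** Multiply [e] by a cutoff at scale [d]. Its derivative is of order [1 / d], but on its support,
    of radius [d * S], the germ is at most a small multiple of [d], because the derivatives of [e]
    vanish at [x0]; the product of the two does not depend on [d]. *)
Lemma small_germ n m (U : set 'rV[R]_n) (e : 'rV[R]_n -> 'rV[R]_m) x0 (eta r : R) :
  open U -> U x0 -> Cinf U e -> e x0 = 0 -> (forall v, 'D_v e x0 = 0) ->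
  0 < eta -> 0 < r ->
  exists e' : 'rV[R]_n -> 'rV[R]_m, [/\ Cinf setT e',
    exists2 d : R, 0 < d & forall x, `|x - x0| <= d -> e' x = e x,
    forall x, r <= `|x - x0| -> e' x = 0 &
    forall x y, `|e' x - e' y| <= eta * `|x - y|].
Proof.
move=> oU Ux he ex0 dex0 eta0 r0.
have [L L0 hL] := @cutoff_lipschitz R n.
pose N : R := n%:R; have N0 : 0 <= N by [].
pose S := 2 * (N + 1); have S0 : 0 < S by rewrite mulr_gt0 // ltr_wpDl.
(* Chosen for [N * c * (1 + L * S) <= eta]: the 1 stands for the variation of [e], [L * S] for that
   of the cutoff. *)
pose c := eta / ((N + 1) * (1 + L * S)).
have N1 : 0 < N + 1 by rewrite ltr_wpDl.
have LS1 : 0 < 1 + L * S by rewrite ltr_pwDl // mulr_ge0 // ltW.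
have den0 : 0 < (N + 1) * (1 + L * S) by rewrite mulr_gt0.
have c0 : 0 < c by rewrite divr_gt0.
have NcE : N * c * (1 + L * S) <= eta.
  have -> : N * c * (1 + L * S) = eta * (N / (N + 1)).
    by rewrite /c; field; rewrite (gt_eqF N1) (gt_eqF LS1).
  by rewrite ler_piMr // ?ltW // ltr_pdivrMr ?ltr_wpDl // mul1r ltrDl.
have [r1 r10 hr1] : exists2 r1 : R, 0 < r1 & forall z, `|z - x0| <= r1 ->
    U z /\ forall i, `|'D_(delta_mx 0 i) e z| <= c.
  apply: near_closed_ball; apply: (@near_andP 'rV[R]_n (nbhs x0) _ _ _).2.
  split; first exact: (open_nbhs_nbhs (conj oU Ux)).
  apply: (@near_forall_fin 'rV[R]_n 'I_n
    (fun i => [set z | `|'D_(delta_mx 0 i) e z| <= c]) x0) => i.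
  exact: (small_near (Cinf_derive (delta_mx 0 i) he) Ux (dex0 _) c0).
pose s := Num.min r1 r; have s0 : 0 < s by rewrite lt_min r10.
(* The cutoff then vanishes from radius [d * S = s / 2] on, strictly inside the ball where the
   derivatives are controlled. *)
pose d := s / (2 * S); have d0 : 0 < d by rewrite divr_gt0 // mulr_gt0.
have dS : d * S = s / 2.
  by rewrite /d; field; rewrite gt_eqF.
have s2 : s / 2 < s by rewrite ltr_pdivrMr // ltr_pMr // ltr1n.
have sr1 : s <= r1 by rewrite ge_min lexx.
have sr : s <= r by rewrite ge_min lexx orbT.
have lipe x y : `|x - x0| <= r1 -> `|y - x0| <= r1 -> `|e x - e y| <= N * c * `|x - y|.
  apply: (@mean_value R n m U e c r1 x0 x y (ltW c0)) => [z zr|z i zr].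
    exact: (Cinf_differentiable he (hr1 z zr).1).
  exact: (hr1 z zr).2.
pose b x := cutoff (d^-1 *: (x - x0)).
have hb : Cinf setT b.
  apply: (Cinf_compR (findim_rV n) openT (fun _ _ => I) _ (@Cinf_cutoff R n)).
  apply: (Cinf_scale openT (Cinf_cst _ _)).
  exact: (Cinf_sub2 openT (Cinf_id openT) (Cinf_cst _ _)).
have nd x : `|d^-1 *: (x - x0)| = `|x - x0| / d.
  by rewrite normrZ normfV gtr0_norm // mulrC.
have b0 x : s / 2 <= `|x - x0| -> b x = 0.
  by move=> hx; apply: cutoff0; rewrite nd ler_pdivlMr // -/S mulrC dS.
have b1 x : `|x - x0| <= d -> b x = 1.
  by move=> hx; apply: cutoff1; rewrite nd ler_pdivrMr // mul1r.
have b01 x : `|b x| <= 1.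
  by rewrite /b; have /andP[h1 h2] := cutoff01 (d^-1 *: (x - x0)); rewrite ger0_norm.
have lipb x y : `|b x - b y| <= L / d * `|x - y|.
  apply: le_trans (hL _ _) _; rewrite -scalerBr opprB addrA subrK normrZ.
  by rewrite normfV gtr0_norm // mulrA.
clearbody b; exists (fun x => b x *: e x); split.
- apply: Cinf_local => x _.
  have [xs|xs] := ltP `|x - x0| s.
    exists [set z | `|z - x0| < s]; split=> //.
    have oB := @open_norm_lt n x0 s.
    apply: (Cinf_scale oB (Cinf_sub (subsetT _) hb)).
    apply: (Cinf_sub _ he) => z /= zs.
    exact: (hr1 z (le_trans (ltW zs) sr1)).1.
  exists [set z | s / 2 < `|z - x0|]; split; first exact: lt_le_trans s2 xs.
  apply: (Cinf_ext (@open_norm_gt n x0 (s / 2)) _ (Cinf_cst _ 0)) => z /= hz.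
  by rewrite b0 ?scale0r // ltW.
- by exists d => // x /b1 ->; rewrite scale1r.
- move=> x hx; rewrite b0 ?scale0r //; apply: le_trans hx.
  exact: le_trans (ltW s2) sr.
(* Only [y] must lie where [e] is controlled; [x] matters only if its cutoff is nonzero. The
   remaining cases follow by symmetry. *)
have main x y : `|y - x0| <= s / 2 -> (b x != 0 -> `|x - x0| <= s / 2) ->
    `|b x *: e x - b y *: e y| <= eta * `|x - y|.
  move=> hy hx.
  have hy1 : `|y - x0| <= r1 by apply: le_trans hy (le_trans (ltW s2) sr1).
  have ey : `|e y| <= N * c * (d * S).
    have := lipe y x0 hy1; rewrite subrr normr0 ex0 subr0 => /(_ (ltW r10)) h.
    by apply: le_trans h _; rewrite dS ler_wpM2l // mulr_ge0 // ltW.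
  have -> : b x *: e x - b y *: e y = b x *: (e x - e y) + (b x - b y) *: e y.
    by rewrite scalerBr scalerBl addrA subrK.
  apply: le_trans (ler_normD _ _) _; rewrite !normrZ.
  have T2 : `|b x - b y| * `|e y| <= N * c * (L * S) * `|x - y|.
    apply: le_trans (ler_pM _ _ (lipb x y) ey) _ => //.
    have -> : L / d * `|x - y| * (N * c * (d * S)) = N * c * (L * S) * `|x - y|.
      by field; rewrite gt_eqF.
    exact: lexx.
  have T1 : `|b x| * `|e x - e y| <= N * c * `|x - y|.
    have [->|bx] := eqVneq (b x) 0.
      by rewrite normr0 mul0r mulr_ge0 // mulr_ge0 // ltW.
    have hx1 : `|x - x0| <= r1 by apply: le_trans (hx bx) (le_trans (ltW s2) sr1).
    apply: le_trans (lipe x y hx1 hy1).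
    by rewrite ler_piMl.
  apply: le_trans (lerD T1 T2) _.
  by rewrite -mulrDl -{1}[N * c]mulr1 -mulrDr ler_wpM2r.
have supp x : b x != 0 -> `|x - x0| <= s / 2.
  by move=> bx; rewrite leNgt; apply/negP => /ltW /b0 b0x; rewrite b0x eqxx in bx.
move=> x y; have [hy|hy] := leP `|y - x0| (s / 2); first exact: main (supp x).
have [hx|hx] := leP `|x - x0| (s / 2).
  by rewrite distrC (distrC x); apply: main => //; exact: supp.
by rewrite !b0 ?(ltW hx) ?(ltW hy) // !scale0r subrr normr0 mulr_ge0 // ltW.
Qed.

End SmallGerm.

(** * Isotopies *)

Section Isotopy.
Context {R : realType}.

Definition gdiffeo n (h g : 'rV[R]_n -> 'rV[R]_n) :=
  [/\ Cinf setT h, Cinf setT g, cancel h g & cancel g h].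

Lemma gdiffeo_sym n (h g : 'rV[R]_n -> 'rV[R]_n) : gdiffeo h g -> gdiffeo g h.
Proof. by case. Qed.

Lemma gdiffeo_comp n (h g h' g' : 'rV[R]_n -> 'rV[R]_n) :
  gdiffeo h g -> gdiffeo h' g' -> gdiffeo (h' \o h) (g \o g').
Proof.
move=> [h1 g1 hg gh] [h2 g2 hg' gh']; split.
- exact: (Cinf_comp (findim_rV n) openT openT (fun _ _ => I) h1 h2).
- exact: (Cinf_comp (findim_rV n) openT openT (fun _ _ => I) g2 g1).
- exact: can_comp.
- exact: can_comp.
Qed.

(** The constant is uniform in [u], so the straight-line homotopy from the identity is an
    isotopy. *)
Lemma lipschitz_strong_mono n (E : 'rV[R]_n -> 'rV[R]_n) (eta u : R) : 0 <= eta ->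
  (forall x y, `|E x - E y| <= eta * `|x - y|) -> n%:R * eta <= 1 / 2 -> 0 <= u <= 1 ->
  strong_mono (1 / 2) (fun x => x + u *: E x).
Proof.
move=> eta0 lE neta /andP[u0 u1] x y.
have -> : x + u *: E x - (y + u *: E y) = (x - y) + u *: (E x - E y).
  by rewrite scalerBr opprD addrACA.
rewrite dotDl dotZl -sqnorm_dot.
have h1 := dot_le_norm (E x - E y) (x - y); have h2 := lE x y.
have h3 := norm_le_sqnorm (x - y); have N0 : 0 <= (n%:R : R) by [].
have h4 : `|dot (E x - E y) (x - y)| <= 1 / 2 * sqnorm (x - y).
  apply: le_trans h1 _; apply: (@le_trans _ _ (n%:R * eta * `|x - y| ^+ 2)).
    by rewrite expr2 -mulrA ler_wpM2l // mulrA ler_wpM2r.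
  by apply: ler_pM; rewrite ?mulr_ge0 ?sqr_ge0.
have h5 : u * dot (E x - E y) (x - y) >= - (1 / 2 * sqnorm (x - y)).
  have h6 : `|u * dot (E x - E y) (x - y)| <= 1 / 2 * sqnorm (x - y).
    by rewrite normrM ger0_norm //; apply: le_trans h4; rewrite ler_piMl.
  by have := ler_norm (- (u * dot (E x - E y) (x - y))); rewrite normrN; lra.
lra.
Qed.

Lemma lipschitz_gdiffeo n (E : 'rV[R]_n -> 'rV[R]_n) (eta u : R) : 0 <= eta ->
  Cinf setT E ->
  (forall x y, `|E x - E y| <= eta * `|x - y|) -> n%:R * eta <= 1 / 2 -> 0 <= u <= 1 ->
  exists g, gdiffeo (fun x => x + u *: E x) g.
Proof.
move=> eta0 hE lE neta u01.
have hf : Cinf setT (fun x => x + u *: E x).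
  apply: (Cinf_add openT (Cinf_id openT)).
  exact: (Cinf_scale openT (Cinf_cst _ _) hE).
have [|g [h1 h2 h3]] := strong_mono_diffeo _ hf (lipschitz_strong_mono eta0 lE neta u01).
  by rewrite divr_gt0.
by exists g.
Qed.

Lemma lipschitz_constant_exists (n : nat) :
  exists2 eta : R, 0 < eta & n%:R * eta <= 1 / 2.
Proof.
have n0 : 0 <= (n%:R : R) by [].
exists (2 * (n%:R + 1))^-1; first by rewrite invr_gt0 mulr_gt0 // ltr_wpDl.
rewrite invfM mulrCA mul1r ler_piMr ?invr_ge0 //.
by rewrite ler_pdivrMr ?ltr_wpDl // mul1r lerDl.
Qed.

(** Smoothness in [u] over the whole line provides the extensions that [smooth_on] demands over
    [[0, 1]]; invertibility is asked on [[0, 1]] only. *)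
Definition isotopic_to_id n (h : 'rV[R]_n -> 'rV[R]_n) :=
  exists A : R -> 'rV[R]_n -> 'rV[R]_n,
    [/\ Cinf setT (fun q : R^o * 'rV[R]_n => A q.1 q.2),
        forall u, 0 <= u <= 1 -> exists g, gdiffeo (A u) g,
        forall x, A 0 x = x & forall x, A 1 x = h x].

(* [A u x = k (u x) / u] is smooth at [u = 0] because [k] is the identity near 0. *)
Lemma alexander_isotopy n (k g : 'rV[R]_n -> 'rV[R]_n) (d : R) : gdiffeo k g ->
  0 < d -> (forall x, `|x| <= d -> k x = x) -> isotopic_to_id k.
Proof.
move=> kg d0 kid; have [hk hg gk kgK] := kg.
pose A (u : R) (x : 'rV[R]_n) := if u == 0 then x else u^-1 *: k (u *: x).
exists A; split.
- pose V := (R^o * 'rV[R]_n)%type.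
  have h1 : Cinf (setT : set V) (fst : V -> R) by exact: Cinf_fst openT.
  have h2 : Cinf (setT : set V) (snd : V -> 'rV[R]_n) by exact: Cinf_snd openT.
  have h12 : Cinf (setT : set V) (fun q : V => (q.1 : R) *: q.2).
    exact: (Cinf_scale openT h1 h2).
  apply: Cinf_local => -[u x] _.
  have [u0|u0] := eqVneq u 0.
    pose U : set V := (fun q : V => (q.1 : R) *: q.2) @^-1` [set y | `|y - 0| < d].
    have oU : open U.
      apply: open_comp; last exact: open_norm_lt.
      by move=> q _; exact: (Cinf_continuous h12).
    exists U; split.
      by rewrite /U /= u0 scale0r subr0 normr0.
    apply: (Cinf_ext oU _ (Cinf_sub (@subsetT _ U) h2)) => -[v y] /=.
    rewrite /U /A /= subr0 => vy; case: eqP => // /eqP v0.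
    by rewrite kid ?scalerA ?mulVf ?scale1r // ltW.
  pose U : set V := (fst : V -> R) @^-1` [set y | y != 0].
  have oU : open U.
    apply: open_comp; last exact: open_neq.
    by move=> q _; exact: (Cinf_continuous h1).
  exists U; split => //.
  have hU : Cinf U (fun q : V => (q.1 : R)^-1 *: k ((q.1 : R) *: q.2)).
    apply: (Cinf_scale oU).
      by apply: (Cinf_inv oU _ (Cinf_sub (@subsetT _ U) h1)).
    apply: (Cinf_comp (findim_rV n) oU openT (fun _ _ => I) _ hk).
    exact: (Cinf_sub (@subsetT _ U) h12).
  apply: (Cinf_ext oU _ hU) => -[v y]; rewrite /U /A /= => /negbTE ->; by [].
- move=> u _; have [u0|u0] := eqVneq u 0.
    have -> : A u = id by apply/funext => x; rewrite /A u0 eqxx.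
    by exists id; split => //; exact: (Cinf_id openT).
  have -> : A u = fun x => u^-1 *: k (u *: x).
    by apply/funext => x; rewrite /A (negbTE u0).
  have sm (f : 'rV[R]_n -> 'rV[R]_n) : Cinf setT f ->
      Cinf setT (fun x => u^-1 *: f (u *: x)).
    move=> hf; apply: (Cinf_scale openT (Cinf_cst _ _)).
    apply: (Cinf_comp (findim_rV n) openT openT (fun _ _ => I) _ hf).
    exact: (Cinf_scale openT (Cinf_cst _ _) (Cinf_id openT)).
  exists (fun x => u^-1 *: g (u *: x)); split; [exact: sm|exact: sm| |].
    by move=> x; rewrite scalerA divff // scale1r gk scalerA mulVf // scale1r.
  by move=> x; rewrite scalerA divff // scale1r kgK scalerA mulVf // scale1r.
- by move=> x; rewrite /A eqxx.
- by move=> x; rewrite /A oner_eq0 invr1 !scale1r.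
Qed.

(* [k = (k o D') o D], where [D = id + e'] agrees with [k] near 0 and [e'] has a
   small Lipschitz constant: [k o D'] is handled by Alexander's trick, and
   [D] by [id + u e']. *)
Lemma tangent_to_id_isotopic n (k g : 'rV[R]_n -> 'rV[R]_n) : gdiffeo k g ->
  k 0 = 0 -> (forall v, 'D_v k 0 = v) -> isotopic_to_id k.
Proof.
move=> kg k0 dk; have [hk hg gk kgK] := kg.
have [eta eta0 neta] := lipschitz_constant_exists n.
have he : Cinf setT (fun x => k x - x) by exact: (Cinf_sub2 openT hk (Cinf_id openT)).
have de v : 'D_v (fun x => k x - x) 0 = 0.
  have dk0 : derivable k 0 v by apply: diff_derivable; exact: (Cinf_differentiable hk).
  have -> : (fun x => k x - x) = k - id by [].
  by rewrite (deriveB dk0 (@derivable_id R 'rV[R]_n 0 v)) dk derive_id subrr.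
have e0 : k 0 - 0 = 0 by rewrite k0 subr0.
have [e' [he' [d d0 hd] _ lip]] := small_germ openT (I : setT 0) he e0 de eta0 ltr01.
have lipge0 := ltW eta0.
have [D' Dg] : exists g, gdiffeo (fun x => x + (1 : R) *: e' x) g.
  apply: (lipschitz_gdiffeo lipge0 he' lip neta); by rewrite ler01 lexx.
have Dgc := gdiffeo_comp (gdiffeo_sym Dg) kg.
pose k' := k \o D'.
(* [k' x = x] as soon as [D' x] lies in the ball where the inverse of [D'] agrees with [k]; a linear
   bound on [D'] gives a ball of such [x]. *)
have [c c0 lipD] : exists2 c : R, 0 < c & forall y, `|D' y| <= c * `|y|.
  have mono := lipschitz_strong_mono lipge0 lip neta (introT andP (conj ler01 (lexx (1 : R)))).
  have [_ _ K1 K2] := Dg.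
  exists (n%:R / (1 / 2) + 1) => [|y].
    by rewrite ltr_wpDl // divr_ge0 // divr_ge0.
  have half0 : 0 < 1 / 2 :> R by rewrite divr_gt0.
  have := strong_mono_norm (D' y) 0 half0 mono.
  rewrite K2 scale1r (_ : e' 0 = 0) ?addr0 ?subr0; last first.
    by rewrite hd ?subrr ?normr0 ?ltW // k0.
  by move=> h; apply: le_trans h _; rewrite ler_wpM2r // lerDl.
have k'id x : `|x| <= d / c -> k' x = x.
  move=> hx; have hD : `|D' x - 0| <= d.
    by rewrite subr0; apply: le_trans (lipD x) _; rewrite mulrC -ler_pdivlMr.
  have [_ _ K1 K2] := Dg.
  by rewrite /k' /= -[RHS]K2 scale1r hd // addrC subrK.
have [A [A1 A2 A3 A4]] := alexander_isotopy Dgc (divr_gt0 d0 c0) k'id.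
exists (fun u x => A u (x + u *: e' x)); split.
- pose V := (R^o * 'rV[R]_n)%type.
  have h1 : Cinf (setT : set V) (fst : V -> R) by exact: Cinf_fst openT.
  have h2 : Cinf (setT : set V) (snd : V -> 'rV[R]_n) by exact: Cinf_snd openT.
  have h3 : Cinf (setT : set V) (fun q => q.2 + (q.1 : R) *: e' q.2).
    apply: (Cinf_add openT h2 (Cinf_scale openT h1 _)).
    exact: (Cinf_comp (findim_rV n) openT openT (fun _ _ => I) h2 he').
  have h4 : Cinf (setT : set V) (fun q => (q.1, q.2 + (q.1 : R) *: e' q.2) : V).
    exact: (Cinf_pair openT h1 h3).
  apply: (Cinf_comp (findim_prod findimR (findim_rV n)) openT openT (fun _ _ => I) h4 A1).
- move=> u u01; have [gA hA] := A2 u u01.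
  have [gE hE] := lipschitz_gdiffeo lipge0 he' lip neta u01.
  by exists (gE \o gA); exact: gdiffeo_comp hE hA.
- by move=> x; rewrite scale0r addr0 A3.
- by move=> x; rewrite A4 /=; have [_ _ K1 K2] := Dg; rewrite K1.
Qed.

End Isotopy.

(** * Polynomial functions and C^1 approximation *)

Section PolynomialFunctions.
Context {R : realType}.

Definition polyfun (f : 'rV[R]_2 -> R) :=
  exists P : {poly {poly R}}, forall u, f u = P.[(u 0 0)%:P].[u 0 1].

Lemma polyfun_cst c : polyfun (fun _ => c).
Proof. by exists c%:P%:P => u; rewrite !hornerC. Qed.

Lemma polyfun_fst : polyfun (fun u => u 0 0).
Proof. by exists 'X => u; rewrite hornerX hornerC. Qed.

Lemma polyfun_snd : polyfun (fun u => u 0 1).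
Proof. by exists 'X%:P => u; rewrite hornerC hornerX. Qed.

Lemma polyfun_add f g : polyfun f -> polyfun g -> polyfun (fun u => f u + g u).
Proof. by move=> [P hP] [Q hQ]; exists (P + Q) => u; rewrite !hornerD hP hQ. Qed.

Lemma polyfun_mul f g : polyfun f -> polyfun g -> polyfun (fun u => f u * g u).
Proof. by move=> [P hP] [Q hQ]; exists (P * Q) => u; rewrite !hornerM hP hQ. Qed.

Lemma polyfun_exp f k : polyfun f -> polyfun (fun u => f u ^+ k).
Proof. by move=> [P hP]; exists (P ^+ k) => u; rewrite !horner_exp hP. Qed.

Lemma polyfun_ext f g : f =1 g -> polyfun f -> polyfun g.
Proof. by move=> fg [P hP]; exists P => u; rewrite -fg. Qed.

Lemma polyfun_sum m (f : 'I_m -> 'rV[R]_2 -> R) :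
  (forall i, polyfun (f i)) -> polyfun (fun u => \sum_(i < m) f i u).
Proof.
elim: m f => [|m IH] f hf.
  by apply: polyfun_ext (polyfun_cst 0) => u; rewrite big_ord0.
apply: polyfun_ext (polyfun_add (IH (fun i => f (widen_ord (leqnSn m) i)) _)
  (hf ord_max)) => //= x; by rewrite big_ord_recr.
Qed.

Lemma polyfun_poly_map (psi : 'rV[R]_2 -> 'rV[R]_4) :
  (forall i, polyfun (fun u => psi u 0 i)) ->
  exists x y z w, psi = poly_map x y z w.
Proof.
move=> h; have [P hP] := choice h.
exists (P 0), (P 1), (P 2), (P 3); apply/funext => u; apply/rowP => i.
rewrite mxE (hP i u); congr (_.[_].[_]).
by move: i => [[|[|[|[|//]]]] hi] /=; congr P; apply: val_inj.
Qed.

(** The induction principle of the algebra generated by the two coordinates; it spares double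
    inductions on [{poly {poly R}}]. *)
Lemma polyfun_ind (Q : ('rV[R]_2 -> R) -> Prop) :
  (forall c, Q (fun _ => c)) -> Q (fun u => u 0 0) -> Q (fun u => u 0 1) ->
  (forall f g, Q f -> Q g -> Q (fun u => f u + g u)) ->
  (forall f g, Q f -> Q g -> Q (fun u => f u * g u)) ->
  forall f, polyfun f -> Q f.
Proof.
move=> Qc Q0 Q1 Qadd Qmul f [P hP]; rewrite (funext hP) {f hP}.
have Qp (p : {poly R}) : Q (fun u => p.[u 0 1]).
  elim/poly_ind: p => [|p c IH].
    by rewrite (_ : (fun _ => _) = fun _ => 0) //; apply/funext => u; rewrite horner0.
  rewrite (_ : (fun _ => _) = fun u : 'rV[R]_2 => p.[u 0 1] * u 0 1 + c).
    by apply: (Qadd _ (fun _ => c)) => //; exact: Qmul.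
  by apply/funext => u; rewrite hornerMXaddC.
elim/poly_ind: P => [|P c IH].
  by rewrite (_ : (fun _ => _) = fun _ => 0) //; apply/funext => u; rewrite !horner0.
rewrite (_ : (fun _ => _) =
    fun u : 'rV[R]_2 => P.[(u 0 0)%:P].[u 0 1] * u 0 0 + c.[u 0 1]).
  by apply: Qadd => //; exact: Qmul.
by apply/funext => u; rewrite hornerMXaddC hornerD hornerM hornerC.
Qed.

Lemma Cinf_polyfun f : polyfun f -> Cinf setT f.
Proof.
move: f; apply: polyfun_ind.
- by move=> c; exact: Cinf_cst.
- exact: Cinf_rV openT.
- exact: Cinf_rV openT.
- by move=> f g; exact: Cinf_add openT.
- by move=> f g; exact: Cinf_mul openT.
Qed.

End PolynomialFunctions.

(** * Reduction to an arbitrary diffeomorphism of R^4 *)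

Section Reduction.
Context {R : realType}.

Lemma Cinf_smooth_on (V W : normedModType R) (A : set V) (f : V -> W) :
  Cinf setT f -> smooth_on A f.
Proof. by move=> hf p _; exists setT, f; split => //; exact: openT. Qed.

Lemma isotopic_to_id_ambient (h : 'rV[R]_4 -> 'rV[R]_4) (phi psi : 'rV[R]_2 -> 'rV[R]_4) :
  isotopic_to_id h -> h @` range phi = range psi -> ambient_isotopic phi psi.
Proof.
move=> [A [A1 A2 A3 A4]] hr; exists A; split; last first.
  by rewrite -hr; congr image; apply/funext => x; exact: A4.
split; [exact: Cinf_smooth_on A1| |exact: A3].
move=> u u01; have [g [h1 h2 h3 h4]] := A2 u u01.
exists g; split; [by split|exact: Cinf_smooth_on|exact: Cinf_smooth_on].
Qed.

Lemma left_inverse_diff (V W : normedModType R) (f : V -> W) (g : W -> V) x v :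
  differentiable f x -> differentiable g (f x) -> cancel f g ->
  'd g (f x) ('d f x v) = v.
Proof.
move=> df dg fg; have := diff_comp df dg; have -> : g \o f = id by apply/funext.
move=> /(congr1 (fun F => F v)) /= <-.
by rewrite (diff_val (is_diff_def := is_diff_id x)).
Qed.

Lemma gdiffeo_jacobi_unit n (h g : 'rV[R]_n -> 'rV[R]_n) x :
  gdiffeo h g -> jacobi h x \in unitmx.
Proof.
move=> [hh hg K1 K2]; rewrite -row_free_unit; apply: inj_row_free => v.
have dh : differentiable h x by exact: (Cinf_differentiable hh).
have dg : differentiable g (h x) by exact: (Cinf_differentiable hg).
rewrite -derive_jacobi // deriveE // => dv.
have E := left_inverse_diff v dh dg K1.
exact: (etrans (esym E) (etrans (congr1 ('d g (h x)) dv) (raddf0 _))).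
Qed.

Lemma normalized_isotopic_to_id n (h g : 'rV[R]_n -> 'rV[R]_n) : gdiffeo h g ->
  isotopic_to_id (fun x => (h x - h 0) *m invmx (jacobi h 0)).
Proof.
move=> hg; have uJ := gdiffeo_jacobi_unit 0 hg; have [hh hg' K1 K2] := hg.
set J := jacobi h 0 in uJ *.
apply: (@tangent_to_id_isotopic _ _ _ (fun y => g (y *m J + h 0))).
- split.
  + apply: (Cinf_mulmx _ openT).
    exact: (Cinf_sub2 openT hh (Cinf_cst _ _)).
  + apply: (Cinf_comp (findim_rV n) openT openT (fun _ _ => I) _ hg').
    exact: (Cinf_add openT (Cinf_mulmx _ openT (Cinf_id openT)) (Cinf_cst _ _)).
  + by move=> x; rewrite mulmxKV // subrK K1.
  + by move=> x; rewrite K2 addrK mulmxK.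
- by rewrite subrr mul0mx.
- move=> v; have dh : differentiable h 0 by exact: (Cinf_differentiable hh).
  pose L : {linear 'rV[R]_n -> 'rV[R]_n} := mulmxr (invmx J).
  have cL : continuous L by exact: mulmxr_continuous.
  have d1 : derivable h 0 v by exact: diff_derivable.
  have dc : derivable (cst (h 0) : 'rV[R]_n -> 'rV[R]_n) 0 v by exact: derivable_cst.
  have D : differentiable (h - cst (h 0)) 0.
    by apply: differentiableB => //; exact: differentiable_cst.
  have -> := derive_linear_comp v cL D.
  rewrite (deriveB d1 dc) derive_cst subr0 derive_jacobi //.
  exact: mulmxK.
Qed.

(** A globally smooth left inverse gives the immersion property by the chain rule and, by
    restriction, the continuous inverse on the image. *)
Lemma smooth_embedding_left_inverse n m (f : 'rV[R]_n -> 'rV[R]_m) l :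
  Cinf setT f -> Cinf setT l -> cancel f l -> smooth_embedding setT f.
Proof.
move=> hf hl fl; split; first exact: Cinf_smooth_on.
  move=> p U F _ [oU Up hF Ff] v _.
  have dF : differentiable F p by exact: (Cinf_differentiable hF).
  have [df dFE] := near_eq_diff (open_near oU (fun x Ux => Ff x (conj Ux I)) Up) dF.
  have dl : differentiable l (f p) by exact: (Cinf_differentiable hl).
  rewrite -dFE => dv; have E := left_inverse_diff v df dl fl.
  exact: (etrans (esym E) (etrans (congr1 ('d l (f p)) dv) (raddf0 _))).
exists l; split; first split => //.
- by move=> y [x _ <-]; rewrite fl.
- by apply: continuous_subspaceT => x; exact: (Cinf_continuous hf).
- by apply: continuous_subspaceT => x; exact: (Cinf_continuous hl).
Qed.

(** Affine maps of R^4 preserve polynomial embeddings, so reaching [psi] by any diffeomorphism is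
    enough. The map [l], composed with the inverse affine map, certifies that the modified [psi] is
    an embedding. *)
Lemma polynomial_representation_reduction (phi psi : 'rV[R]_2 -> 'rV[R]_4)
    (h g : 'rV[R]_4 -> 'rV[R]_4) (l : 'rV[R]_4 -> 'rV[R]_2) :
  gdiffeo h g -> h @` range phi = range psi ->
  (forall i, polyfun (fun u => psi u 0 i)) -> Cinf setT l -> cancel psi l ->
  exists x y z w : {poly {poly R}},
    smooth_embedding setT (poly_map x y z w) /\
    ambient_isotopic phi (poly_map x y z w).
Proof.
move=> hg hr ppsi hl pl.
pose J := jacobi h 0; pose psi' u := (psi u - h 0) *m invmx J.
have uJ : J \in unitmx by exact: gdiffeo_jacobi_unit hg.
have ppsi' i : polyfun (fun u => psi' u 0 i).
  apply: polyfun_ext (polyfun_sum (f := fun (k : 'I_4) u => (psi u 0 k - h 0 0 k) * invmx J k i) _).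
    by move=> u; rewrite mxE; apply: eq_bigr => k _; rewrite !mxE.
  move=> k; apply: polyfun_mul; last exact: polyfun_cst.
  by apply: polyfun_add => //; exact: polyfun_cst.
have [x [y [z [w E]]]] := polyfun_poly_map ppsi'.
exists x, y, z, w; rewrite -E; split.
  apply: (@smooth_embedding_left_inverse _ _ _ (fun v => l (v *m J + h 0))).
  - by apply: (Cinf_row openT) => i; exact: Cinf_polyfun.
  - apply: (Cinf_comp (findim_rV 4) openT openT (fun _ _ => I) _ hl).
    exact: (Cinf_add openT (Cinf_mulmx _ openT (Cinf_id openT)) (Cinf_cst _ _)).
  - by move=> u; rewrite /psi' mulmxKV // subrK pl.
apply: (isotopic_to_id_ambient (normalized_isotopic_to_id hg)).
apply/seteqP; split=> v /=.
  move=> [t [u _ <-] <-].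
  have : range psi (h (phi u)) by rewrite -hr; exists (phi u) => //; exists u.
  by move=> [u' _ E']; exists u' => //; rewrite /psi' E'.
move=> [u _ <-].
have : (h @` range phi) (psi u) by rewrite hr; exists u.
by move=> [t pt E']; exists t => //; rewrite E'.
Qed.

End Reduction.

(** * Bernstein approximation in two variables *)

Section Bernstein.
Context {R : realType}.

(* [binmean n x f] is the mean of [f] under the binomial law with parameters
   [n] and [x]; the recursion conditions on the first trial. *)
Fixpoint binmean (n : nat) (x : R) (f : nat -> R) : R :=
  if n is n'.+1 then x * binmean n' x (f \o S) + (1 - x) * binmean n' x f else f 0%N.

Lemma binmean_affine n x (f : nat -> R) a b :
  binmean n x (fun j => a + b * f j) = a + b * binmean n x f.
Proof.
by elim: n f => [|n IH] f //=; rewrite (IH f) (IH (f \o S)); ring.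
Qed.

Lemma binmean_le n x (f h : nat -> R) : 0 <= x <= 1 ->
  (forall j, (j <= n)%N -> f j <= h j) -> binmean n x f <= binmean n x h.
Proof.
move=> /andP[x0 x1]; elim: n f h => [|n IH] f h fh /=; first exact: fh.
apply: lerD; apply: ler_wpM2l; rewrite ?subr_ge0 //; apply: IH => j jn; apply: fh => //.
exact: leqW.
Qed.

(** The recursion shifts the centre to [a - 1], hence the second moment about an arbitrary point; at
    [a = n x] it is the binomial variance. *)
Lemma binmean_variance n x a :
  binmean n x (fun j => (j%:R - a) ^+ 2) = n%:R * x * (1 - x) + (n%:R * x - a) ^+ 2.
Proof.
elim: n a => [|n IH] a /=; first by ring.
have -> : (fun j : nat => (j%:R - a) ^+ 2) \o S = (fun j => (j%:R - (a - 1)) ^+ 2).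
  by apply/funext => j /=; rewrite -natr1; ring.
by rewrite !IH -natr1; ring.
Qed.

Lemma polyfun_binmean n (x : 'rV[R]_2 -> R) (f : nat -> 'rV[R]_2 -> R) :
  polyfun x -> (forall j, polyfun (f j)) ->
  polyfun (fun u => binmean n (x u) (fun j => f j u)).
Proof.
move=> px; elim: n f => [|n IH] f pf /=; first exact: pf.
apply: polyfun_add; apply: polyfun_mul.
- exact: px.
- by apply: (IH (fun j => f j.+1)).
- apply: polyfun_ext (polyfun_add (polyfun_cst 1) (polyfun_mul (polyfun_cst (-1)) px)).
  by move=> u; rewrite mulN1r.
- exact: IH.
Qed.

Definition vec2 (s t : R) : 'rV[R]_2 := \row_(i < 2) [:: s; t]`_i.

Lemma norm_vec2_le s t b : `|s| <= b -> `|t| <= b -> `|vec2 s t| <= b.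
Proof.
move=> hs ht; apply: norm_le_coord => [|i]; first exact: le_trans hs.
by rewrite mxE; case: i => -[|[|//]] /= _.
Qed.

(** The nodes subdivide [[-M, M]] and have mean [s]; their variance is [4 M^2 x (1 - x) / n], and
    [x (1 - x) <= 1 / 4]. *)
Lemma binmean_node n (M s : R) : 0 < M -> (0 < n)%N -> `|s| <= M ->
  binmean n ((s + M) / (2 * M)) (fun j => (2 * M * (j%:R / n%:R) - M - s) ^+ 2)
    <= M ^+ 2 / n%:R.
Proof.
move=> M0 n0 sM; have nn0 : (0 : R) < n%:R by rewrite ltr0n.
set x := (s + M) / (2 * M).
have sE : s = 2 * M * x - M by rewrite /x; field; rewrite gt_eqF.
have -> : (fun j : nat => (2 * M * (j%:R / n%:R) - M - s) ^+ 2) =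
    (fun j : nat => 0 + (2 * M / n%:R) ^+ 2 * (j%:R - n%:R * x) ^+ 2).
  by apply/funext => j; rewrite sE; field; rewrite gt_eqF.
rewrite binmean_affine binmean_variance subrr expr0n /= addr0 add0r.
rewrite ler_pdivlMr //.
have -> : (2 * M / n%:R) ^+ 2 * (n%:R * x * (1 - x)) * n%:R = M ^+ 2 * (4 * (x * (1 - x))).
  by field; rewrite gt_eqF.
rewrite ler_piMr ?sqr_ge0 //.
have : 0 <= (x - 1 / 2) ^+ 2 by exact: sqr_ge0.
by move: x {sE} => x; lra.
Qed.

(** Chebyshev's argument in the form [|r| <= eta + r ^+ 2 / eta]: the Lipschitz bound on [q] is
    estimated by second moments, without separating near nodes from far ones. *)
Lemma bernstein_approx (q : 'rV[R]_2 -> R) (M C e : R) : 0 < M -> 0 <= C -> 0 < e ->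
  (forall u v, `|u| <= M -> `|v| <= M -> `|q u - q v| <= C * `|u - v|) ->
  exists2 P, polyfun P & forall u, `|u| <= M -> `|P u - q u| <= e.
Proof.
move=> M0 C0 e0 hq.
(* Half of the error goes to [eta], a quarter to each of the two variance terms. *)
pose eta := e / (2 * (C + 1)).
have C1 : 0 < C + 1 by rewrite ltr_wpDl.
have eta0 : 0 < eta by rewrite divr_gt0 // mulr_gt0.
have [n hn] : exists n : nat, 4 * (C + 1) * M ^+ 2 / (eta * e) < n.+1%:R.
  exists (Num.truncn (4 * (C + 1) * M ^+ 2 / (eta * e))).
  exact: truncnS_gt.
pose N : R := n.+1%:R; have N0 : 0 < N by rewrite ltr0n.
pose node (j : nat) := 2 * M * (j%:R / N) - M.
have nodeM j : (j <= n.+1)%N -> `|node j| <= M.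
  move=> jn; rewrite ler_norml /node.
  have j0 : 0 <= j%:R / N by rewrite divr_ge0 // ltW.
  have j1 : j%:R / N <= 1 by rewrite ler_pdivrMr // mul1r ler_nat.
  move: (j%:R / N) j0 j1 => z z0 z1.
  have h0 : 0 <= M * z by rewrite mulr_ge0 // ltW.
  have h1 : M * z <= M by rewrite ler_piMr // ltW.
  by apply/andP; split; lra.
pose x (s : R) := (s + M) / (2 * M).
have x01 s : `|s| <= M -> 0 <= x s <= 1.
  rewrite ler_norml => /andP[s0 s1]; rewrite /x divr_ge0 ?ler_pdivrMr ?mulr_gt0 //=; lra.
pose P (u : 'rV[R]_2) := binmean n.+1 (x (u 0 0)) (fun j =>
  binmean n.+1 (x (u 0 1)) (fun k => q (vec2 (node j) (node k)))).
have px i : polyfun (fun u => x (u 0 i)).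
  apply: polyfun_mul; last exact: polyfun_cst.
  apply: polyfun_add; last exact: polyfun_cst.
  case: i => -[|[|//]] /= h; [apply: polyfun_ext polyfun_fst|apply: polyfun_ext polyfun_snd];
    by move=> u; congr (u _ _); apply: val_inj.
exists P.
  apply: polyfun_binmean (px 0) _ => j; apply: polyfun_binmean (px 1) _ => k.
  exact: polyfun_cst.
move=> u uM; pose s := u 0 0; pose t := u 0 1.
have sM : `|s| <= M by apply: le_trans (le_coord_norm _ _) uM.
have tM : `|t| <= M by apply: le_trans (le_coord_norm _ _) uM.
pose a j := (node j - s) ^+ 2; pose b k := (node k - t) ^+ 2.
have hab j k : (j <= n.+1)%N -> (k <= n.+1)%N ->
    `|q (vec2 (node j) (node k)) - q u| <= C * (eta + a j / eta + b k / eta).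
  move=> jn kn; apply: le_trans (hq _ _ (norm_vec2_le (nodeM j jn) (nodeM k kn)) uM) _.
  rewrite ler_wpM2l //.
  have small (r : R) : `|r| <= eta + r ^+ 2 / eta.
    have [h|h] := leP `|r| eta; first by rewrite (le_trans h) // lerDl divr_ge0 ?sqr_ge0 // ltW.
    apply: ler_wpDl; first exact: ltW.
    by rewrite ler_pdivlMr // -real_normK ?num_real // expr2 ler_wpM2l // ltW.
  have aj : 0 <= a j / eta := divr_ge0 (sqr_ge0 _) (ltW eta0).
  have bk : 0 <= b k / eta := divr_ge0 (sqr_ge0 _) (ltW eta0).
  apply: norm_le_coord => [|i].
    exact: addr_ge0 (addr_ge0 (ltW eta0) aj) bk.
  rewrite !mxE; case: i => -[|[|//]] /= hi.
    have -> : u 0 (Ordinal hi) = s by congr (u _ _); apply: val_inj.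
    by apply: le_trans (small _) _; rewrite lerDl.
  have -> : u 0 (Ordinal hi) = t by congr (u _ _); apply: val_inj.
  by apply: le_trans (small _) _; rewrite [leRHS]addrAC lerDl.
have aE : binmean n.+1 (x s) a <= M ^+ 2 / N by exact: binmean_node.
have bE : binmean n.+1 (x t) b <= M ^+ 2 / N by exact: binmean_node.
have bound : C * (eta + M ^+ 2 / N / eta + M ^+ 2 / N / eta) <= e.
  have hN : M ^+ 2 / N / eta <= e / (4 * (C + 1)).
    have {}hn : 4 * (C + 1) * M ^+ 2 < N * (eta * e).
      by move: hn; rewrite ltr_pdivrMr // mulr_gt0.
    have C4 : 0 < 4 * (C + 1) by rewrite mulr_gt0.
    rewrite ler_pdivrMr // ler_pdivrMr // -(ler_pM2l C4).
    apply: le_trans (ltW hn) _; rewrite le_eqVlt; apply/orP; left; apply/eqP.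
    by field; rewrite gt_eqF.
  apply: (@le_trans _ _ (C * (e / (C + 1)))).
    rewrite ler_wpM2l //; rewrite -addrA.
    have -> : e / (C + 1) = eta + (e / (4 * (C + 1)) + e / (4 * (C + 1))).
      by rewrite /eta; field; rewrite gt_eqF.
    by rewrite lerD2l lerD.
  by rewrite mulrCA ler_piMr ?(ltW e0) // ler_pdivrMr // mul1r lerDl.
(* The sign [sg] treats both sides of the absolute value at once, since [binmean] is handled through
   monotonicity alone. *)
have two (sg : R) : `|sg| = 1 -> sg * (P u - q u) <= e.
  move=> sg1; apply: le_trans bound.
  have -> : sg * (P u - q u) = binmean n.+1 (x s) (fun j =>
      binmean n.+1 (x t) (fun k => sg * (q (vec2 (node j) (node k)) - q u))).
    have E1 (f : nat -> R) : (fun k => sg * (f k - q u)) = (fun k => - (sg * q u) + sg * f k).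
      by apply/funext => k; ring.
    under [in RHS]eq_fun do rewrite (E1 (fun k => q (vec2 _ (node k)))) binmean_affine.
    by rewrite binmean_affine /P; ring.
  apply: (@le_trans _ _ (binmean n.+1 (x s) (fun j =>
     (C * (eta + M ^+ 2 / N / eta)) + (C / eta) * a j))).
    apply: binmean_le => [|j jn]; first exact: x01.
    apply: (@le_trans _ _ (binmean n.+1 (x t) (fun k =>
       (C * (eta + a j / eta)) + (C / eta) * b k))).
      apply: binmean_le => [|k kn]; first exact: x01.
      apply: le_trans (ler_norm _) _; rewrite normrM sg1 mul1r.
      apply: le_trans (hab j k jn kn) _.
      by rewrite le_eqVlt; apply/orP; left; apply/eqP; ring.
    rewrite binmean_affine.
    have : C / eta * binmean n.+1 (x t) b <= C / eta * (M ^+ 2 / N).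
      by rewrite ler_wpM2l // divr_ge0 // ltW.
    move=> h; apply: (@le_trans _ _ (C * (eta + a j / eta) + C / eta * (M ^+ 2 / N))).
      by rewrite lerD2l.
    by rewrite le_eqVlt; apply/orP; left; apply/eqP; ring.
  rewrite binmean_affine.
  have : C / eta * binmean n.+1 (x s) a <= C / eta * (M ^+ 2 / N).
    by rewrite ler_wpM2l // divr_ge0 // ltW.
  move=> h; apply: (@le_trans _ _ (C * (eta + M ^+ 2 / N / eta) + C / eta * (M ^+ 2 / N))).
    by rewrite lerD2l.
  by rewrite le_eqVlt; apply/orP; left; apply/eqP; ring.
rewrite ler_norml; apply/andP; split.
  by rewrite lerNl -mulN1r; apply: two; rewrite normrN normr1.
by rewrite -[X in X <= _]mul1r; apply: two; rewrite normr1.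
Qed.

End Bernstein.

(** * Lipschitz bounds from the mixed second derivative *)

Section C1Approximation.
Context {R : realType}.
Notation e0 := (delta_mx 0 0 : 'rV[R]_2).
Notation e1 := (delta_mx 0 1 : 'rV[R]_2).

Lemma norm_delta n (i : 'I_n) : `|delta_mx 0 i : 'rV[R]_n| = 1.
Proof.
apply/eqP; rewrite eq_le; apply/andP; split.
  by apply: norm_le_coord => // j; rewrite mxE; case: (_ && _); rewrite ?normr1 ?normr0.
by apply: le_trans (le_coord_norm _ i); rewrite mxE !eqxx normr1.
Qed.

Lemma derive_scaleE (V : normedModType R) (f : V -> R) x (c : R) v : differentiable f x ->
  'D_(c *: v) f x = c * 'D_v f x.
Proof. by move=> df; rewrite (deriveE _ df) (deriveE _ df) linearZ. Qed.

Lemma derive_translate (V W : normedModType R) (f : V -> W) a v x :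
  'D_v (fun w => f (w + a)) x = 'D_v f (x + a).
Proof.
rewrite /derive; have E : (fun h : R => h^-1 *: (((fun w => f (w + a)) \o shift x) (h *: v)
    - f (x + a))) = (fun h : R => h^-1 *: ((f \o shift (x + a)) (h *: v) - f (x + a))).
  by apply/funext => h /=; rewrite addrA.
by rewrite E.
Qed.

Lemma axis_mean_value n (B : set 'rV[R]_n) (f : 'rV[R]_n -> R) i x (c C : R) :
  Cinf setT f ->
  (forall t : R, 0 <= t <= 1 -> B (x + t *: (c *: delta_mx 0 i))) ->
  (forall w, B w -> `|'D_(delta_mx 0 i) f w| <= C) ->
  `|f (x + c *: delta_mx 0 i) - f x| <= C * `|c|.
Proof.
move=> hf seg bd.
have nc : `|c *: (delta_mx 0 i : 'rV[R]_n)| = `|c| by rewrite normrZ norm_delta mulr1.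
have E : x + c *: delta_mx 0 i - x = c *: (delta_mx 0 i : 'rV[R]_n) by rewrite addrC addKr.
have := @mean_value_scalar R _ B f C x (x + c *: delta_mx 0 i).
rewrite E nc; apply => //.
  by move=> z _; exact: (Cinf_differentiable hf).
move=> z Bz; rewrite derive_scaleE; last exact: (Cinf_differentiable hf).
by rewrite normrM mulrC ler_wpM2r // bd.
Qed.

Lemma norm_rV2_le (u : 'rV[R]_2) b : (`|u| <= b) = (`|u 0 0| <= b) && (`|u 0 1| <= b).
Proof.
apply/idP/andP => [h|[h0 h1]].
  by split; apply: le_trans (le_coord_norm _ _) h.
apply: norm_le_coord => [|i]; first exact: le_trans h0.
case: i => -[|[|//]] hi; [rewrite (_ : Ordinal hi = 0)|rewrite (_ : Ordinal hi = 1)] => //;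
  exact: val_inj.
Qed.

Lemma rVD n (x y : 'rV[R]_n) k : (x + y) 0 k = x 0 k + y 0 k.
Proof. by rewrite mxE. Qed.

Lemma rVN n (x : 'rV[R]_n) k : (- x) 0 k = - x 0 k.
Proof. by rewrite mxE. Qed.

Lemma rVZ n (c : R) (x : 'rV[R]_n) k : (c *: x) 0 k = c * x 0 k.
Proof. by rewrite mxE. Qed.

Definition rVE := (rVD, rVN, rVZ).

Lemma segment_bound (a b M t : R) : 0 <= t <= 1 -> `|a| <= M -> `|a + b| <= M ->
  `|a + t * b| <= M.
Proof.
move=> /andP[t0 t1]; rewrite !ler_norml => /andP[h1 h2] /andP[h3 h4].
by apply/andP; split; nra.
Qed.

(** Going up from the bottom side bounds ['D_e0 d], hence the horizontal variation. For the vertical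
    one, the increment [d (z + c *: e1) - d z] vanishes on the left side and has its ['D_e0]
    derivative bounded by [eta * |c|]; neither ['D_e1 d] nor the symmetry of second derivatives
    enters. *)
Lemma mixed_derivative_lipschitz (d : 'rV[R]_2 -> R) (M eta : R) :
  0 <= M -> 0 <= eta -> Cinf setT d ->
  (forall u : 'rV[R]_2, `|u| <= M -> u 0 0 = - M -> d u = 0) ->
  (forall u : 'rV[R]_2, `|u| <= M -> u 0 1 = - M -> 'D_e0 d u = 0) ->
  (forall u, `|u| <= M -> `|'D_e1 ('D_e0 d) u| <= eta) ->
  forall u v, `|u| <= M -> `|v| <= M -> `|d u - d v| <= 4 * M * eta * `|u - v|.
Proof.
move=> M0 eta0 hd edge0 edge1 bd u v uM vM.
have c00 : e0 0 0 = 1 by rewrite mxE.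
have c01 : e0 0 1 = 0 by rewrite mxE.
have c10 : e1 0 0 = 0 by rewrite mxE.
have c11 : e1 0 1 = 1 by rewrite mxE.
have hd0 : Cinf setT ('D_e0 d) by exact: Cinf_derive.
have mid (w : 'rV[R]_2) (c : R) : `|w| <= M -> `|w + c *: e1| <= M ->
    forall t : R, 0 <= t <= 1 -> `|w + t *: (c *: e1)| <= M.
  rewrite !norm_rV2_le !rVE c10 c11 !mulr0 !addr0 !mulr1 => /andP[h1 h2] /andP[_ h3] t t01.
  by rewrite norm_rV2_le !rVE c10 c11 !mulr0 addr0 mulr1 h1 /=; exact: segment_bound.
have mid0 (w : 'rV[R]_2) (c : R) : `|w| <= M -> `|w + c *: e0| <= M ->
    forall t : R, 0 <= t <= 1 -> `|w + t *: (c *: e0)| <= M.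
  rewrite !norm_rV2_le !rVE c00 c01 !mulr0 !addr0 !mulr1 => /andP[h1 h2] /andP[h3 _] t t01.
  by rewrite norm_rV2_le !rVE c00 c01 !mulr0 addr0 mulr1 h2 andbT; exact: segment_bound.
have vert (w : 'rV[R]_2) (c : R) : `|w| <= M -> `|w + c *: e1| <= M ->
    `|'D_e0 d (w + c *: e1) - 'D_e0 d w| <= eta * `|c|.
  move=> h1 h2.
  exact: (@axis_mean_value 2 [set w | `|w| <= M] ('D_e0 d) 1 w c eta hd0 (mid w c h1 h2) bd).
have bd0 w : `|w| <= M -> `|'D_e0 d w| <= 2 * M * eta.
  move=> wM; pose c := w 0 1 + M.
  have wE : w = (w - c *: e1) + c *: e1 by rewrite subrK.
  have /andP[w0 w1] : (`|w 0 0| <= M) && (`|w 0 1| <= M) by rewrite -norm_rV2_le.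
  have bM : `|w - c *: e1| <= M.
    rewrite norm_rV2_le !rVE c10 c11 mulr0 subr0 w0 /= mulr1 /c opprD addrA subrr add0r.
    by rewrite normrN ger0_norm.
  have := vert (w - c *: e1) c bM; rewrite -wE => /(_ wM).
  rewrite [X in _ - X]edge1 //; last first.
    by rewrite !rVE c11 mulr1 /c opprD addrA subrr add0r.
  rewrite subr0 => h; apply: le_trans h _; rewrite mulrC ler_wpM2r //.
  by apply: le_trans (ler_normD _ _) _; rewrite (ger0_norm M0) mulrDl mul1r lerD2r.
have horiz (w : 'rV[R]_2) (c : R) : `|w| <= M -> `|w + c *: e0| <= M ->
    `|d (w + c *: e0) - d w| <= 2 * M * eta * `|c|.
  move=> h1 h2.
  exact: (@axis_mean_value 2 [set w | `|w| <= M] d 0 w c _ hd (mid0 w c h1 h2) bd0).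
have vert2 (w : 'rV[R]_2) (c : R) : `|w| <= M -> `|w + c *: e1| <= M ->
    `|d (w + c *: e1) - d w| <= 2 * M * eta * `|c|.
  move=> wM wcM; pose F z := d (z + c *: e1) - d z.
  have hs : Cinf setT (fun z => d (z + c *: e1)).
    apply: (Cinf_compR (findim_rV 2) openT (fun _ _ => I) _ hd).
    exact: (Cinf_add openT (Cinf_id openT) (Cinf_cst _ _)).
  have hF : Cinf setT F by exact: (Cinf_sub2 openT hs hd).
  have dF z : 'D_e0 F z = 'D_e0 d (z + c *: e1) - 'D_e0 d z.
    have -> : F = (fun z => d (z + c *: e1)) - d by [].
    by rewrite deriveB ?derive_translate //; apply: diff_derivable;
      [exact: (Cinf_differentiable hs)|exact: (Cinf_differentiable hd)].
  pose a := w 0 0 + M; pose w0 := w - a *: e0.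
  have wE : w = w0 + a *: e0 by rewrite subrK.
  move: (wM) (wcM); rewrite !norm_rV2_le !rVE c10 c11 mulr0 addr0 mulr1.
  move=> /andP[h1 h2] /andP[_ h3].
  have w00 : w0 0 0 = - M by rewrite !rVE c00 mulr1 /a opprD addrA subrr add0r.
  have w01 : w0 0 1 = w 0 1 by rewrite !rVE c01 mulr0 subr0.
  clearbody w0; have F0 : F w0 = 0.
    rewrite /F !edge0 ?subrr //.
    - by rewrite norm_rV2_le w00 w01 normrN (ger0_norm M0) lexx.
    - rewrite norm_rV2_le !rVD !rVZ.
      by rewrite w00 w01 c10 c11 mulr0 addr0 mulr1 normrN (ger0_norm M0) lexx.
    - by rewrite rVD w00 rVZ c10 mulr0 addr0.
  have := @axis_mean_value 2 [set z | `|z| <= M /\ `|z + c *: e1| <= M] F 0 w0 a (eta * `|c|) hF.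
  rewrite -wE F0 subr0 => H; apply: le_trans (H _ _) _.
  - move=> t t01.
    have hh : `|- M + t * a| <= M.
      apply: segment_bound => //; first by rewrite normrN ger0_norm.
      by rewrite /a addrC addrK.
    have E0 : (w0 + t *: (a *: e0)) 0 0 = - M + t * a by rewrite rVD w00 !rVZ c00 mulr1.
    have E1 : (w0 + t *: (a *: e0)) 0 1 = w 0 1 by rewrite rVD w01 !rVZ c01 !mulr0 addr0.
    split; first by rewrite /= norm_rV2_le E0 E1 hh.
    rewrite norm_rV2_le !(rVD _ (c *: e1)) E0 E1 !rVZ c10 c11.
    by rewrite mulr0 addr0 mulr1 hh.
  - by move=> z [z1 z2]; rewrite dF; exact: vert.
  have ha : `|a| <= 2 * M.
    by apply: le_trans (ler_normD _ _) _; rewrite (ger0_norm M0) mulrDl mul1r lerD2r.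
  rewrite mulrC mulrA ler_wpM2r // ler_wpM2r //.
(* The path from [u] to [v] turns at the corner [m]; each of its two pieces costs [2 * M * eta]. *)
pose m := vec2 (u 0 0) (v 0 1).
have m0 : m 0 0 = u 0 0 by rewrite mxE.
have m1 : m 0 1 = v 0 1 by rewrite mxE.
have mM : `|m| <= M.
  by move: uM vM; rewrite !norm_rV2_le m0 m1 => /andP[-> _] /andP[_ ->].
have eqv (x y : 'rV[R]_2) : x 0 0 = y 0 0 -> x 0 1 = y 0 1 -> x = y.
  move=> h0 h1; apply/rowP => -[[|[|//]] hi];
   [rewrite (_ : Ordinal hi = 0)|rewrite (_ : Ordinal hi = 1)] => //; exact: val_inj.
have uE : u = m + (u 0 1 - v 0 1) *: e1.
  by apply: eqv; rewrite rVD ?m0 ?m1 rVZ ?c10 ?c11 ?mulr0 ?mulr1 ?addr0 // addrC subrK.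
have mE : m = v + (u 0 0 - v 0 0) *: e0.
  by apply: eqv; rewrite [RHS]rVD ?m0 ?m1 rVZ ?c00 ?c01 ?mulr0 ?mulr1 ?addr0 // addrC subrK.
have k1 : `|d u - d m| <= 2 * M * eta * `|u - v|.
  rewrite {1}uE; apply: le_trans (vert2 _ _ mM _) _; first by rewrite -uE.
  rewrite ler_wpM2l ?mulr_ge0 //; have := le_coord_norm (u - v) 1; by rewrite !mxE.
have k2 : `|d m - d v| <= 2 * M * eta * `|u - v|.
  rewrite {1}mE; apply: le_trans (horiz _ _ vM _) _; first by rewrite -mE.
  rewrite ler_wpM2l ?mulr_ge0 //; have := le_coord_norm (u - v) 0; by rewrite !mxE.
rewrite -(subrKA (d m)); apply: le_trans (ler_normD _ _) _.
by apply: le_trans (lerD k1 k2) _; rewrite -mulrDl le_eqVlt; apply/orP; left; apply/eqP; ring.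
Qed.

End C1Approximation.

(** * Polynomial double antiderivatives *)

Section Antiderivative.
Context {R : realType}.
Notation e0 := (delta_mx 0 0 : 'rV[R]_2).
Notation e1 := (delta_mx 0 1 : 'rV[R]_2).

Lemma derive_powdiff n (u v : 'rV[R]_n) k m (c : R) :
  is_derive u v (fun w : 'rV[R]_n => (w 0 k ^+ m.+1 - c) / m.+1%:R) (u 0 k ^+ m * v 0 k).
Proof.
have h : Cinf setT (fun w : 'rV[R]_n => w 0 k) by exact: Cinf_rV openT.
have dk : is_derive u v (fun w : 'rV[R]_n => w 0 k) (v 0 k).
  apply: DeriveDef; first by apply: diff_derivable; exact: (Cinf_differentiable h).
  rewrite -[RHS](f_equal (fun x : 'rV[R]_n => x 0 k) (derive_id u v)).
  have did : differentiable (id : 'rV[R]_n -> 'rV[R]_n) u.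
    exact: (ex_diff (is_diff_def := is_diff_id u)).
  exact: (derive_linear_comp v (@coordmx_continuous R 1 n 0 k) did).
have dp := is_deriveX m.+1 dk.
have := is_deriveM (is_deriveB dp (is_derive_cst (c : R) u v)) (is_derive_cst (m.+1%:R^-1 : R) u v).
have -> : ((fun w : 'rV[R]_n => w 0 k) ^+ m.+1 - cst c) * cst m.+1%:R^-1 =
    (fun w : 'rV[R]_n => (w 0 k ^+ m.+1 - c) / m.+1%:R).
  apply/funext => w; rewrite -[LHS]/((((fun w : 'rV[R]_n => w 0 k) ^+ m.+1) w - c) / m.+1%:R).
  congr ((_ - _) / _); elim: (m.+1) => [|l IH]; first by rewrite expr0.
  by rewrite !exprS -IH.
move=> D; apply: (is_derive_eq D); rewrite scaler0 add0r subr0 /=.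
by rewrite -[LHS]/(m.+1%:R^-1 * (m.+1%:R * u 0 k ^+ m * v 0 k)) !mulrA mulVf ?mul1r //.
Qed.

(* [p] is the double antiderivative of [P] with respect to both variables that
   vanishes on the left and bottom sides of the square [|u| <= M]. *)
Definition antider (M : R) (P p : 'rV[R]_2 -> R) :=
  [/\ polyfun p, forall u, 'D_e1 ('D_e0 p) u = P u,
      forall u : 'rV[R]_2, u 0 0 = - M -> p u = 0 &
      forall u : 'rV[R]_2, u 0 1 = - M -> 'D_e0 p u = 0].

Lemma Cinf_derivable (V W : normedModType R) (f : V -> W) x v :
  Cinf setT f -> derivable f x v.
Proof. by move=> hf; apply: diff_derivable; exact: (Cinf_differentiable hf). Qed.

Lemma antider_lin M P Q p q (c : R) : antider M P p -> antider M Q q ->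
  antider M (fun u => c * P u + Q u) (fun u => c * p u + q u).
Proof.
move=> [p1 p2 p3 p4] [q1 q2 q3 q4].
have hp := Cinf_polyfun p1; have hq := Cinf_polyfun q1.
have lin (f g : 'rV[R]_2 -> R) v u : Cinf setT f -> Cinf setT g ->
    'D_v (fun u => c * f u + g u) u = c * 'D_v f u + 'D_v g u.
  move=> hf hg; have df : derivable f u v := Cinf_derivable hf.
    have dg : derivable g u v := Cinf_derivable hg.
  have -> : (fun u => c * f u + g u) = (c *: f) + g by [].
  by rewrite deriveD ?deriveZ //; exact: derivableZ.
have E : 'D_e0 (fun u => c * p u + q u) = (fun u => c * 'D_e0 p u + 'D_e0 q u).
  by apply/funext => u; exact: lin.
split.
- by apply: polyfun_add => //; apply: polyfun_mul => //; exact: polyfun_cst.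
- by move=> u; rewrite E lin ?p2 ?q2 //; exact: Cinf_derive.
- by move=> u hu; rewrite p3 // q3 // mulr0 addr0.
- by move=> u hu; rewrite lin // p4 // q4 // mulr0 addr0.
Qed.

Lemma antider_monomial M i j :
  exists p, antider M (fun u => u 0 0 ^+ i * u 0 1 ^+ j) p.
Proof.
(* The primitive of the [m]-th power of coordinate [k] that vanishes at [- M]. *)
pose a (k : 'I_2) m (u : 'rV[R]_2) := (u 0 k ^+ m.+1 - (- M) ^+ m.+1) / m.+1%:R.
have pc (k : 'I_2) : polyfun (fun u : 'rV[R]_2 => u 0 k).
  case: k => -[|[|//]] /= h; [apply: polyfun_ext polyfun_fst|apply: polyfun_ext polyfun_snd];
    by move=> u; congr (u _ _); apply: val_inj.
have pa k m : polyfun (a k m).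
  apply: polyfun_mul; last exact: polyfun_cst.
  by apply: polyfun_add; [exact: polyfun_exp|exact: polyfun_cst].
have da k m u v : is_derive u v (a k m) (u 0 k ^+ m * v 0 k) by exact: derive_powdiff.
have E : 'D_e0 (fun u => a 0 i u * a 1 j u) = (fun u => u 0 0 ^+ i * a 1 j u).
  apply/funext => u.
  have [_ ->] := is_deriveM (da 0 i u e0) (da 1 j u e0).
  rewrite !mxE /= mulr0 scaler0 add0r mulr1; exact: mulrC.
exists (fun u => a 0 i u * a 1 j u); split.
- exact: polyfun_mul.
- move=> u; rewrite E.
  have hx : Cinf setT (fun u : 'rV[R]_2 => u 0 0 ^+ i) by exact: Cinf_polyfun (polyfun_exp _ (pc 0)).
  have D0 : is_derive u e1 (fun u : 'rV[R]_2 => u 0 0 ^+ i) 0.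
    apply: DeriveDef; first exact: Cinf_derivable.
    case: i {E hx} => [|i]; first by rewrite (_ : (fun _ => _) = cst 1) ?derive_cst.
    have D := is_deriveM (derive_powdiff u e1 0 i 0) (is_derive_cst (i.+1%:R : R) u e1).
    have -> : (fun u : 'rV[R]_2 => u 0 0 ^+ i.+1) =
        ((fun w : 'rV[R]_2 => (w 0 0 ^+ i.+1 - 0) / i.+1%:R) * cst i.+1%:R).
      apply/funext => w; rewrite -[RHS]/((w 0 0 ^+ i.+1 - 0) / i.+1%:R * i.+1%:R).
      by rewrite subr0 divfK // pnatr_eq0.
    by have [_ ->] := D; rewrite !mxE /= !mulr0 !scaler0 addr0.
  have [_ ->] := is_deriveM D0 (da 1 j u e1).
  by rewrite !mxE /= scaler0 addr0 mulr1.
- by move=> u hu; rewrite /a hu subrr mul0r mul0r.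
- by move=> u hu; rewrite (congr1 (fun F => F u) E) /a hu subrr mul0r mulr0.
Qed.

Lemma antider_exists M P : polyfun P -> exists p, antider M P p.
Proof.
move=> [Q hQ].
have zero : exists p, antider M (fun _ => 0) p.
  have [p hp] := antider_monomial M 0 0; exists (fun u => (-1) * p u + p u).
  have := antider_lin (-1) hp hp; congr antider; apply/funext => u; ring.
have sumP m (F : 'I_m -> 'rV[R]_2 -> R) : (forall i, exists p, antider M (F i) p) ->
    exists p, antider M (fun u => \sum_(i < m) F i u) p.
  elim: m F => [|m IH] F hF.
    have [p hp] := zero; exists p; move: hp; congr antider; apply/funext => u.
    by rewrite big_ord0.
  have [p hp] := IH (fun i => F (widen_ord (leqnSn m) i)) (fun i => hF _).
  have [q hq] := hF ord_max; exists (fun u => 1 * q u + p u).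
  have := antider_lin 1 hq hp; congr antider; apply/funext => u.
  by rewrite big_ord_recr /= mul1r addrC.
have [|p hp] := sumP (size Q) (fun i u => \sum_(j < size (Q`_i)) (Q`_i)`_j * (u 0 0 ^+ i * u 0 1 ^+ j)).
  move=> i; apply: sumP => j; have [p hp] := antider_monomial M i j.
  have [z hz] := zero; exists (fun u => (Q`_i)`_j * p u + z u).
  by have := antider_lin ((Q`_i)`_j) hp hz; congr antider; apply/funext => u; rewrite addr0.
exists p; move: hp; congr antider; apply/funext => u.
rewrite hQ (horner_coef Q) horner_sum; apply: eq_bigr => i _.
rewrite hornerM horner_exp hornerC (horner_coef Q`_i) mulr_suml; apply: eq_bigr => j _.
by rewrite -mulrA [X in _ * X]mulrC.
Qed.

(* Bernstein's theorem is applied to the mixed second derivative of [g], and its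
   approximation is integrated twice. *)
Lemma c1_approx (g : 'rV[R]_2 -> R) (M0 M e : R) : Cinf setT g ->
  0 < M0 -> M0 < M -> (forall u, M0 <= `|u| -> g u = 0) -> 0 < e ->
  exists2 p, polyfun p & forall u v, `|u| <= M -> `|v| <= M ->
    `|(p u - g u) - (p v - g v)| <= e * `|u - v|.
Proof.
move=> hg M00 MM g0 e00.
have Mp : 0 < M by exact: lt_trans MM.
pose q := 'D_e1 ('D_e0 g).
have hg0 : Cinf setT ('D_e0 g) by exact: Cinf_derive.
have hq : Cinf setT q by exact: Cinf_derive.
have [C C0 hC] : exists2 C : R, 0 <= C & forall u v, `|u| <= M -> `|v| <= M ->
    `|q u - q v| <= C * `|u - v|.
  have [C C0 hC] := @smooth_lipschitz_on_ball R 2 1 (fun u => \row_(i < 1) q u) M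
    (Cinf_rowE openT (fun _ => hq)).
  exists C => // u v uM vM; apply: le_trans (hC u v uM vM).
  by have := le_coord_norm ((\row_(i < 1) q u) - (\row_(i < 1) q v)) 0; rewrite !mxE.
(* Compensates the factor [4 * M] of [mixed_derivative_lipschitz]. *)
pose eta := e / (4 * M).
have eta0 : 0 < eta by rewrite divr_gt0 // mulr_gt0.
have [P pP hP] := bernstein_approx Mp C0 eta0 hC.
have [p [p1 p2 p3 p4]] := antider_exists M pP.
exists p => //; have hp := Cinf_polyfun p1.
pose d u := p u - g u.
have hd : Cinf setT d by exact: (Cinf_sub2 openT hp hg).
have lin (f h : 'rV[R]_2 -> R) v u : Cinf setT f -> Cinf setT h ->
    'D_v (fun u => f u - h u) u = 'D_v f u - 'D_v h u.
  move=> hf hh; have -> : (fun u => f u - h u) = f - h by [].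
  by rewrite deriveB //; exact: Cinf_derivable.
have E : 'D_e0 d = (fun u => 'D_e0 p u - 'D_e0 g u) by apply/funext => u; exact: lin.
(* The left and bottom sides lie strictly outside the support of [g], so [g] satisfies the same edge
   conditions as [p]. *)
have far (u : 'rV[R]_2) (i : 'I_2) : u 0 i = - M -> M0 < `|u|.
  move=> hu; apply: lt_le_trans (le_coord_norm u i).
  by rewrite hu normrN gtr0_norm.
have Dg0 (u : 'rV[R]_2) : M0 < `|u| -> 'D_e0 g u = 0.
  move=> hu; rewrite -(derive_cst (0 : R) u e0); apply: near_eq_derive.
  have oB := @open_norm_gt R 2 0 M0.
  apply: (open_near oB) => [w /=|]; last by rewrite /= subr0.
  by rewrite subr0 => /ltW /g0.
have main := @mixed_derivative_lipschitz R d M eta (ltW Mp) (ltW eta0) hd.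
have -> : e = 4 * M * eta by rewrite /eta; field; rewrite gt_eqF.
apply: main.
- by move=> u _ hu; rewrite /d p3 // g0 ?subr0 //; apply: ltW (far u 0 hu).
- by move=> u _ hu; rewrite (congr1 (fun F => F u) E) p4 // Dg0 ?subr0 //; apply: far u 1 hu.
- move=> u uM; rewrite E lin // ?p2; last exact: Cinf_derive.
  exact: hP.
Qed.

End Antiderivative.

(** * Polynomial models of planes standard at infinity *)

Section PolynomialModel.
Context {R : realType}.

(** If [|x| < r] and [|y| > 2 * r], then [y] may be pulled back radially to norm [r], where [f]
    still vanishes. The new distance is at most [2 * r] and the old one at least [r], whence the
    factor 2. *)
Lemma lipschitz_of_support (V W : normedModType R) (f : V -> W) (r k : R) :
  0 < r -> 0 <= k -> (forall x, r <= `|x| -> f x = 0) ->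
  (forall x y, `|x| <= 2 * r -> `|y| <= 2 * r -> `|f x - f y| <= k * `|x - y|) ->
  forall x y, `|f x - f y| <= 2 * k * `|x - y|.
Proof.
move=> r0 k0 supp lip x y.
wlog xy : x y / `|x| <= `|y|.
  by move=> H; case/orP: (le_total `|x| `|y|) => /H //; rewrite distrC (distrC y).
have kd : 0 <= k * `|x - y| by rewrite mulr_ge0.
have [y1|y1] := leP `|y| (2 * r).
  by apply: le_trans (lip x y (le_trans xy y1) y1) _; lra.
have y0 : 0 < `|y| by apply: lt_trans y1; rewrite mulr_gt0.
rewrite [f y]supp; last by apply: ltW; apply: le_lt_trans y1; lra.
have [x1|x1] := leP r `|x|; first by rewrite supp // subrr normr0; lra.
pose z := (r / `|y|) *: y.
have nz : `|z| = r by rewrite normrZ ger0_norm ?divfK ?gt_eqF // divr_ge0 ?ltW.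
have -> : 0 = f z by rewrite supp ?nz.
have x2 : `|x| <= 2 * r by lra.
have z2 : `|z| <= 2 * r by lra.
apply: le_trans (lip x z x2 z2) _.
have h1 : `|x - z| <= 2 * r by apply: le_trans (ler_normB _ _) _; rewrite nz; lra.
have h2 : r <= `|x - y| by rewrite distrC; apply: le_trans (lerB_dist _ _); lra.
by rewrite [2 * k]mulrC -mulrA ler_wpM2l //; lra.
Qed.

(** Both bounds go through one induction, as the variation of a product involves the size of its
    factors. *)
Lemma polyfun_growth f : polyfun f -> exists (C : R) (k : nat), 0 <= C /\ forall (m : R) u v,
  1 <= m -> `|u| <= m -> `|v| <= m ->
  `|f u| <= C * m ^+ k /\ `|f u - f v| <= C * m ^+ k * `|u - v|.
Proof.
have pw (m : R) a b : 1 <= m -> m ^+ a <= m ^+ (a + b) /\ m ^+ b <= m ^+ (a + b).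
  by move=> m1; split; apply: ler_weXn2l => //; rewrite ?leq_addr ?leq_addl.
have coord i : exists (C : R) (k : nat), 0 <= C /\ forall (m : R) (u v : 'rV[R]_2),
  1 <= m -> `|u| <= m -> `|v| <= m ->
  `|u 0 i| <= C * m ^+ k /\ `|u 0 i - v 0 i| <= C * m ^+ k * `|u - v|.
  exists 1, 1%N; split=> // m u v m1 hu hv; rewrite expr1 mul1r; split.
    exact: le_trans (le_coord_norm _ _) hu.
  have := le_coord_norm (u - v) i; rewrite !mxE => h; apply: le_trans h _.
  by rewrite ler_peMl.
move: f; apply: polyfun_ind => [c|||f g [C [k [C0 hf]]] [D [l [D0 hg]]]|
    f g [C [k [C0 hf]]] [D [l [D0 hg]]]].
- exists `|c|, 0%N; split=> // m u v _ _ _; rewrite expr0 mulr1 subrr normr0.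
  by split=> //; rewrite mulr_ge0.
- exact: coord.
- exact: coord.
- exists (C + D), (k + l)%N; split=> [|m u v m1 hu hv]; first exact: addr_ge0.
  have [f1 f2] := hf m u v m1 hu hv; have [g1 g2] := hg m u v m1 hu hv.
  have [p1 p2] := pw m k l m1.
  have q1 : C * m ^+ k <= C * m ^+ (k + l) by rewrite ler_wpM2l.
  have q2 : D * m ^+ l <= D * m ^+ (k + l) by rewrite ler_wpM2l.
  rewrite mulrDl; split.
    by apply: le_trans (ler_normD _ _) _; rewrite lerD //; [exact: le_trans q1|exact: le_trans q2].
  rewrite opprD addrACA; apply: le_trans (ler_normD _ _) _; rewrite mulrDl lerD //.
    by apply: le_trans f2 _; rewrite ler_wpM2r.
  by apply: le_trans g2 _; rewrite ler_wpM2r.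
- exists (2 * (C * D)), (k + l)%N; split=> [|m u v m1 hu hv].
    by rewrite !mulr_ge0.
  have [f1 f2] := hf m u v m1 hu hv; have [g1 g2] := hg m u v m1 hu hv.
  have [f3 _] := hf m v u m1 hv hu.
  have m0 : 0 <= m by apply: le_trans m1.
  have F0 : 0 <= C * m ^+ k by rewrite mulr_ge0 // exprn_ge0.
  have G0 : 0 <= D * m ^+ l by rewrite mulr_ge0 // exprn_ge0.
  have E : 2 * (C * D) * m ^+ (k + l) = 2 * ((C * m ^+ k) * (D * m ^+ l)).
    by rewrite exprD; ring.
  have FG0 : 0 <= (C * m ^+ k) * (D * m ^+ l) by rewrite mulr_ge0.
  rewrite E normrM; split.
    by apply: le_trans (ler_pM _ _ f1 g1) _ => //; lra.
  have -> : f u * g u - f v * g v = (f u - f v) * g u + f v * (g u - g v) by ring.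
  apply: le_trans (ler_normD _ _) _; rewrite !normrM.
  have h1 := ler_pM (normr_ge0 _) (normr_ge0 _) f2 g1.
  have h2 := ler_pM (normr_ge0 _) (normr_ge0 _) f3 g2.
  by apply: le_trans (lerD h1 h2) _; rewrite le_eqVlt; apply/orP; left; apply/eqP; ring.
Qed.

Lemma exp_unbounded (A : R) : exists N0 : nat, forall N, (N0 <= N)%N -> A <= 2 ^+ N.
Proof.
exists (Num.truncn `|A|).+1 => N hN.
apply: le_trans (ler_norm _) _; apply: le_trans (ltW (truncnS_gt _)) _.
apply: (@le_trans _ _ (N%:R)); first by rewrite ler_nat.
by rewrite -natrX ler_nat ltnW // ltn_expl.
Qed.

(** Up to radius [2 * rho] this is the C^1 approximation. Beyond it [m / rho >= 2], and
    [(m / rho) ^+ (2 * N)] splits into a [k]-th power, which matches the growth of [p], and a power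
    with exponent at least [N0], which absorbs the constants. The polynomial does not depend on
    [N]. *)
Lemma approx_growth (g : 'rV[R]_2 -> R) (R0 rho e : R) : Cinf setT g ->
  0 < R0 -> R0 <= rho -> 1 <= rho -> (forall u, R0 <= `|u| -> g u = 0) -> 0 < e ->
  exists p, polyfun p /\ exists N0 : nat, forall N, (N0 <= N)%N -> forall (m : R) u v,
    `|u| <= m -> `|v| <= m ->
    `|(p u - g u) - (p v - g v)| <= e * (1 + (m / rho) ^+ (2 * N)) * `|u - v|.
Proof.
move=> hg R00 Rr r1 g0 e0.
have r0 : 0 < rho by apply: lt_le_trans r1.
have R2 : R0 < 2 * rho by lra.
have [p pp hp] := c1_approx hg R00 R2 g0 e0.
have [Lg Lg0 hLg] : exists2 L : R, 0 <= L & forall u v, `|g u - g v| <= L * `|u - v|.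
  have [L L0 hL] := @smooth_lipschitz_on_ball R 2 1 (fun u => \row_(i < 1) g u) (2 * R0)
    (Cinf_rowE openT (fun _ => hg)).
  exists (2 * L) => [|u v]; first by rewrite mulr_ge0.
  apply: (lipschitz_of_support (f := g) R00 L0 g0) => {}u {}v hu hv.
  apply: le_trans (hL u v hu hv).
  by have := le_coord_norm ((\row_(i < 1) g u) - (\row_(i < 1) g v)) 0; rewrite !mxE.
have [C [k [C0 hC]]] := polyfun_growth pp.
exists p; split=> //.
have [N0 hN0] := exp_unbounded ((C + Lg) * rho ^+ k / e).
exists (N0 + k)%N => N hN m u v hu hv.
have [m2|m2] := leP m (2 * rho).
  apply: le_trans (hp u v (le_trans hu m2) (le_trans hv m2)) _.
  rewrite ler_wpM2r // ler_peMr ?(ltW e0) // lerDl exprn_even_ge0 //.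
  by rewrite oddM.
have m1 : 1 <= m by lra.
have [_ h1] := hC m u v m1 hu hv.
have h2 : `|(p u - g u) - (p v - g v)| <= (C * m ^+ k + Lg) * `|u - v|.
  have -> : (p u - g u) - (p v - g v) = (p u - p v) - (g u - g v) by ring.
  apply: le_trans (ler_normB _ _) _; rewrite mulrDl lerD //.
apply: le_trans h2 _; rewrite ler_wpM2r //.
have mk1 : 1 <= m ^+ k by rewrite exprn_ege1.
apply: (@le_trans _ _ ((C + Lg) * m ^+ k)).
  by rewrite mulrDl lerD2l ler_peMr.
apply: (@le_trans _ _ (e * (m / rho) ^+ (2 * N))); last first.
  by rewrite ler_wpM2l ?(ltW e0) // lerDr.
have mr2 : 2 <= m / rho by rewrite ler_pdivlMr // ltW.
have kN : (k <= N)%N by apply: leq_trans hN; exact: leq_addl.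
have -> : (2 * N)%N = (k + (N - k + N))%N by rewrite addnA subnKC // mul2n addnn.
rewrite exprD [(m / rho) ^+ k]exprMn exprVn.
have hN2 : (N0 <= N - k + N)%N := leq_trans (leq_trans (leq_addr k N0) hN) (leq_addl _ _).
have h3 : (C + Lg) * rho ^+ k / e <= (m / rho) ^+ (N - k + N).
  apply: le_trans (hN0 _ hN2) _; apply: lerXn2r; rewrite ?nnegrE //.
  exact: le_trans mr2.
move: h3; rewrite ler_pdivrMr // => h3.
have rk : 0 < rho ^+ k by rewrite exprn_gt0.
have h4 : (C + Lg) <= (m / rho) ^+ (N - k + N) * e / rho ^+ k by rewrite ler_pdivlMr.
have -> : e * (m ^+ k / rho ^+ k * (m / rho) ^+ (N - k + N)) =
  ((m / rho) ^+ (N - k + N) * e / rho ^+ k) * m ^+ k by ring.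
by rewrite ler_wpM2r // exprn_ge0 //; lra.
Qed.

End PolynomialModel.

(** * The standard plane and the radial term *)

Section StandardPlane.
Context {R : realType}.

Definition emb (u : 'rV[R]_2) : 'rV[R]_4 := \row_(k < 4) [:: u 0 0; u 0 1; 0; 0]`_k.
Definition prj (y : 'rV[R]_4) : 'rV[R]_2 := vec2 (y 0 0) (y 0 1).

Lemma prj0 y : prj y 0 0 = y 0 0. Proof. by rewrite mxE. Qed.
Lemma prj1 y : prj y 0 1 = y 0 1. Proof. by rewrite mxE. Qed.
Lemma emb0 u : emb u 0 0 = u 0 0. Proof. by rewrite mxE. Qed.
Lemma emb1 u : emb u 0 1 = u 0 1. Proof. by rewrite mxE. Qed.

Lemma rV2_eq (x y : 'rV[R]_2) : x 0 0 = y 0 0 -> x 0 1 = y 0 1 -> x = y.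
Proof.
move=> h0 h1; apply/rowP => -[[|[|//]] hi];
  [rewrite (_ : Ordinal hi = 0)|rewrite (_ : Ordinal hi = 1)] => //; exact: val_inj.
Qed.

Lemma embK : cancel emb prj.
Proof. by move=> u; apply: rV2_eq; rewrite ?prj0 ?prj1 ?emb0 ?emb1. Qed.

Lemma embB u v : emb u - emb v = emb (u - v).
Proof.
by apply/rowP => -[[|[|[|[|//]]]] h]; rewrite !mxE /= ?mxE ?subrr.
Qed.

Lemma prjB x y : prj x - prj y = prj (x - y).
Proof. by apply: rV2_eq; rewrite !mxE /= ?mxE. Qed.

Lemma norm_emb_le u : `|emb u| <= `|u|.
Proof.
apply: norm_le_coord => // -[[|[|[|[|//]]]] h]; rewrite mxE /= ?normr0 //;
  exact: le_coord_norm.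
Qed.

Lemma norm_prj_le y : `|prj y| <= `|y|.
Proof. by rewrite norm_rV2_le prj0 prj1 !le_coord_norm. Qed.

Lemma polyfun_emb k : polyfun (fun u => emb u 0 k).
Proof.
case: k => -[|[|[|[|//]]]] h.
- by apply: polyfun_ext polyfun_fst => u; rewrite mxE.
- by apply: polyfun_ext polyfun_snd => u; rewrite mxE.
- by apply: polyfun_ext (polyfun_cst 0) => u; rewrite mxE.
- by apply: polyfun_ext (polyfun_cst 0) => u; rewrite mxE.
Qed.

Lemma Cinf_emb : Cinf setT emb.
Proof. by apply: (Cinf_row openT) => i; exact: Cinf_polyfun (polyfun_emb i). Qed.

Lemma Cinf_prj : Cinf setT prj.
Proof.
apply: (Cinf_row openT) => -[[|[|//]] h].
- by apply: (Cinf_ext openT _ (Cinf_rV 0 openT)) => y _; rewrite mxE.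
- by apply: (Cinf_ext openT _ (Cinf_rV 1 openT)) => y _; rewrite mxE.
Qed.

(** An even power of the Euclidean norm, hence a polynomial, which may enter the polynomial
    embedding. *)
Definition radial_factor (rho : R) (N : nat) (y : 'rV[R]_4) : R := (sqnorm y / rho ^+ 2) ^+ N.

Lemma radial_factor_ge0 rho N y : 0 <= radial_factor rho N y.
Proof. by rewrite exprn_ge0 // divr_ge0 ?sqnorm_ge0 ?sqr_ge0. Qed.

Lemma Cinf_radial_factor rho N : Cinf setT (radial_factor rho N).
Proof.
apply: (Cinf_exp N openT).
exact: (Cinf_mul openT (Cinf_sqnorm openT (Cinf_id openT)) (Cinf_cst _ _)).
Qed.

Lemma sqnormB n (x y : 'rV[R]_n) : sqnorm (x - y) = sqnorm x - 2 * dot x y + sqnorm y.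
Proof.
by rewrite !sqnorm_dot dotDl !dotDr !dotNl !dotNr (dotC y x); ring.
Qed.

(** With weights [a] and [b] at [x] and [y], the two sides differ by
    [(a - b) (sqnorm x - sqnorm y) / 2], which is nonnegative because the weight increases with the
    norm. *)
Lemma radial_mono rho N x y :
  (radial_factor rho N x + radial_factor rho N y) / 2 * sqnorm (x - y) <=
  dot (radial_factor rho N x *: x - radial_factor rho N y *: y) (x - y).
Proof.
rewrite sqnormB dotDl !dotDr !dotNl !dotNr !dotZl (dotC y x) -!sqnorm_dot.
have : 0 <= (radial_factor rho N x - radial_factor rho N y) * (sqnorm x - sqnorm y).
  (* Division by 0 yields 0, so the radial factor is then constant. *)
  have [r0|r0] := eqVneq rho 0.
    rewrite /radial_factor r0 expr0n /= invr0 !mulr0; by rewrite subrr mul0r.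
  have r2 : 0 < rho ^+ 2 by rewrite exprn_even_gt0.
  have mono (a b : R) : 0 <= a -> a <= b -> 0 <= (b ^+ N - a ^+ N) * (b - a).
    move=> a0 ab; rewrite mulr_ge0 // subr_ge0 // lerXn2r // nnegrE //.
    exact: le_trans ab.
  have q0 (z : 'rV[R]_4) : 0 <= sqnorm z / rho ^+ 2 by rewrite divr_ge0 ?sqnorm_ge0 // ltW.
  have E : (radial_factor rho N x - radial_factor rho N y) * (sqnorm x - sqnorm y) =
     (radial_factor rho N x - radial_factor rho N y) * (sqnorm x / rho ^+ 2 - sqnorm y / rho ^+ 2) * rho ^+ 2.
    by field.
  rewrite E mulr_ge0 ?(ltW r2) // /radial_factor.
  case/orP: (le_total (sqnorm x / rho ^+ 2) (sqnorm y / rho ^+ 2)) => h; last exact: mono.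
  by rewrite -mulrNN !opprB; exact: mono.
move: (radial_factor _ _ _) (radial_factor _ _ _) (sqnorm x) (sqnorm y) (dot x y) => a b c d e h; lra.
Qed.

(** The constant [N q^(N-1)] is written with [q ^+ N / q], so that [N = 0] needs no truncated
    exponent. *)
Lemma exp_diff_le (a b q : R) N : 0 <= a <= q -> 0 <= b <= q -> 0 < q ->
  `|a ^+ N - b ^+ N| <= N%:R * q ^+ N / q * `|a - b|.
Proof.
move=> /andP[a0 aq] /andP[b0 bq] q0; elim: N => [|N IH].
  by rewrite !expr0 subrr normr0 mul0r mul0r mul0r.
have -> : a ^+ N.+1 - b ^+ N.+1 = a * (a ^+ N - b ^+ N) + (a - b) * b ^+ N.
  by rewrite !exprS; ring.
have -> : N.+1%:R * q ^+ N.+1 / q * `|a - b| =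
    q * (N%:R * q ^+ N / q * `|a - b|) + `|a - b| * q ^+ N.
  by rewrite -natr1 exprS; field; rewrite gt_eqF.
apply: le_trans (ler_normD _ _) _; rewrite !normrM (ger0_norm a0) lerD //.
  by apply: ler_pM.
by rewrite ler_wpM2l // ger0_norm ?exprn_ge0 // lerXn2r ?nnegrE // ltW.
Qed.

(** On the ball [sqnorm z / rho ^+ 2] is at most 1/4, including the factor 4 between the norms. The
    Lipschitz constant is thus at most [(1 + 2 N) / 4^N], and [1 + 2 N <= 2 * 2^N]. *)
Lemma radial_lipschitz rho (b : R) N x y : 0 < b -> 4 * b <= rho ->
  `|x| <= b -> `|y| <= b ->
  `|radial_factor rho N x *: x - radial_factor rho N y *: y| <= 2 / 2 ^+ N * `|x - y|.
Proof.
move=> b0 br hx hy; pose q : R := 1 / 4; have q0 : 0 < q by rewrite divr_gt0.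
have r0 : 0 < rho by apply: lt_le_trans br; rewrite mulr_gt0.
have r2 : 0 < rho ^+ 2 by rewrite exprn_gt0.
have br2 : 16 * b ^+ 2 <= rho ^+ 2.
  have -> : 16 * b ^+ 2 = (4 * b) ^+ 2 by ring.
  apply: lerXn2r; rewrite ?nnegrE //; [|exact: ltW].
  by rewrite mulr_ge0 // ltW.
have hq (z : 'rV[R]_4) : `|z| <= b -> 0 <= sqnorm z / rho ^+ 2 <= q.
  move=> hz; rewrite divr_ge0 ?sqnorm_ge0 ?(ltW r2) //= ler_pdivrMr //.
  have := sqnorm_le_norm z; have : `|z| ^+ 2 <= b ^+ 2 by rewrite ler_pXn2r ?nnegrE // ltW.
  by rewrite /q; lra.
have lq z : `|z| <= b -> radial_factor rho N z <= q ^+ N.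
  move=> hz; have /andP[h1 h2] := hq z hz.
  by rewrite lerXn2r ?nnegrE // ltW.
have -> : radial_factor rho N x *: x - radial_factor rho N y *: y =
    radial_factor rho N x *: (x - y) + (radial_factor rho N x - radial_factor rho N y) *: y.
  by rewrite scalerBr scalerBl addrA subrK.
apply: le_trans (ler_normD _ _) _; rewrite !normrZ.
have T1 : `|radial_factor rho N x| * `|x - y| <= q ^+ N * `|x - y|.
  by rewrite ler_wpM2r // ger0_norm ?radial_factor_ge0 // lq.
have T2 : `|radial_factor rho N x - radial_factor rho N y| * `|y| <= 2 * N%:R * q ^+ N * `|x - y|.
  have h1 := exp_diff_le N (hq x hx) (hq y hy) q0.
  have h2 : `|sqnorm x / rho ^+ 2 - sqnorm y / rho ^+ 2| <= 8 * b / rho ^+ 2 * `|x - y|.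
    have -> : sqnorm x / rho ^+ 2 - sqnorm y / rho ^+ 2 = dot (x - y) (x + y) / rho ^+ 2.
      by rewrite dotDl !dotDr !dotNl (dotC y x) -!sqnorm_dot; ring.
    rewrite normrM (gtr0_norm (x := _^-1)) ?invr_gt0 // mulrAC ler_wpM2r ?invr_ge0 ?(ltW r2) //.
    apply: le_trans (dot_le_norm _ _) _.
    have -> : 8 * b * `|x - y| = 4 * (`|x - y| * (2 * b)) by ring.
    rewrite ler_wpM2l // ler_wpM2l //; apply: le_trans (ler_normD _ _) _; lra.
  have Nq : 0 <= N%:R * q ^+ N / q by rewrite divr_ge0 ?mulr_ge0 ?exprn_ge0 // ltW.
  have h3 := le_trans h1 (ler_wpM2l Nq h2).
  apply: le_trans (ler_pM _ _ h3 hy) _ => //.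
  have h4 : 8 * b / rho ^+ 2 * b <= 1 / 2.
    rewrite mulrAC ler_pdivrMr //; lra.
  have -> : N%:R * q ^+ N / q * (8 * b / rho ^+ 2 * `|x - y|) * b =
    (N%:R * q ^+ N / q * `|x - y|) * (8 * b / rho ^+ 2 * b) by ring.
  have -> : 2 * N%:R * q ^+ N * `|x - y| = (N%:R * q ^+ N / q * `|x - y|) * (1 / 2).
    by rewrite /q; field.
  by rewrite ler_wpM2l // mulr_ge0.
apply: le_trans (lerD T1 T2) _; rewrite -mulrDl ler_wpM2r //.
have p2 : (0 : R) < 2 ^+ N by rewrite exprn_gt0.
have -> : q ^+ N = 1 / 2 ^+ N / 2 ^+ N.
  have -> : q = 1 / 2 * (1 / 2) by rewrite /q; field.
  by rewrite exprMn !mul1r exprVn.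
have hN : 1 + 2 * N%:R <= 2 * 2 ^+ N :> R.
  elim: (N) => [|l IH]; first by rewrite expr0; lra.
  have : (1 : R) <= 2 ^+ l by rewrite exprn_ege1 // ler1n.
  by rewrite -natr1 exprS; lra.
have -> : 1 / 2 ^+ N / 2 ^+ N + 2 * N%:R * (1 / 2 ^+ N / 2 ^+ N) =
   (1 + 2 * N%:R) * (1 / 2 ^+ N / 2 ^+ N) :> R by ring.
have -> : 2 / 2 ^+ N = 2 * 2 ^+ N * (1 / 2 ^+ N / 2 ^+ N) :> R.
  by field; rewrite gt_eqF.
by rewrite ler_wpM2r // !divr_ge0 // ltW.
Qed.

End StandardPlane.

(** * The diffeomorphism onto the polynomial model *)

Section PolynomialApproximation.
Context {R : realType}.

Lemma subrACA (V : zmodType) (a b c d : V) : a + b - (c + d) = (a - c) + (b - d).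
Proof. by rewrite opprD addrACA. Qed.

Lemma smooth_support_lipschitz n m (f : 'rV[R]_n -> 'rV[R]_m) (r : R) : 0 < r ->
  Cinf setT f -> (forall x, r <= `|x| -> f x = 0) ->
  exists2 C : R, 0 <= C & forall x y, `|f x - f y| <= C * `|x - y|.
Proof.
move=> r0 hf supp; have [C C0 hC] := smooth_lipschitz_on_ball (2 * r) hf.
exists (2 * C); first by rewrite mulr_ge0.
exact: lipschitz_of_support r0 C0 supp hC.
Qed.

(** The difference is supported in a fixed disk, where [emb] and [Phi] are bounded; once [rho] is
    large against that bound, both radial terms decay geometrically in [N]. *)
Lemma radial_difference_small (Phi : 'rV[R]_2 -> 'rV[R]_4) (R0 e : R) :
  Cinf setT Phi -> 0 < R0 -> (forall u, R0 <= `|u| -> Phi u = emb u) -> 0 < e ->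
  exists rho0 : R, forall rho, rho0 <= rho -> exists N0 : nat, forall N, (N0 <= N)%N ->
  forall u v, `|(radial_factor rho N (emb u) *: emb u - radial_factor rho N (Phi u) *: Phi u) -
     (radial_factor rho N (emb v) *: emb v - radial_factor rho N (Phi v) *: Phi v)| <= e * `|u - v|.
Proof.
move=> hP R00 hinf e0.
have [L L0 hL] := smooth_lipschitz_on_ball (2 * R0) hP.
have [B B0 hB] := @norm_bounded_on_ball R 2 _ Phi (2 * R0) (fun x => Cinf_continuous hP I).
(* Bounds both [emb] and [Phi] on the disk of radius [2 * R0] used by [lipschitz_of_support]. *)
pose b := 2 * R0 + B.
have b0 : 0 < b by rewrite ltr_wpDr // mulr_gt0.
exists (4 * b) => rho br.
have [N0 hN0] := exp_unbounded (4 * (1 + L) / e).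
exists N0 => N hN u v.
pose s u := radial_factor rho N (emb u) *: emb u - radial_factor rho N (Phi u) *: Phi u.
have s0 u' : R0 <= `|u'| -> s u' = 0 by move=> h; rewrite /s hinf // subrr.
have p2 : (0 : R) < 2 ^+ N by rewrite exprn_gt0.
have k0 : 0 <= (2 / 2 ^+ N : R) by rewrite divr_ge0 // ltW.
have kb : 2 * (2 / 2 ^+ N * (1 + L)) <= e.
  have := hN0 N hN; rewrite ler_pdivrMr // => h.
  have -> : 2 * (2 / 2 ^+ N * (1 + L)) = 4 * (1 + L) / 2 ^+ N by ring.
  by rewrite ler_pdivrMr // [e * _]mulrC.
have kk : 0 <= 2 / 2 ^+ N * (1 + L) by rewrite mulr_ge0 // addr_ge0.
apply: (@le_trans _ _ (2 * (2 / 2 ^+ N * (1 + L)) * `|u - v|)); last by rewrite ler_wpM2r.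
apply: (lipschitz_of_support (f := s) R00 kk s0) => {}u {}v hu hv.
have bB w : `|w| <= 2 * R0 -> `|Phi w| <= b.
  by move=> hw; apply: le_trans (hB w hw) _; rewrite lerDr mulr_ge0 // ltW.
have be w : `|w| <= 2 * R0 -> `|emb w| <= b.
  by move=> hw; apply: le_trans (norm_emb_le w) (le_trans hw _); rewrite lerDl.
have -> : s u - s v = (radial_factor rho N (emb u) *: emb u - radial_factor rho N (emb v) *: emb v) -
    (radial_factor rho N (Phi u) *: Phi u - radial_factor rho N (Phi v) *: Phi v).
  by rewrite /s !opprB addrACA [RHS]addrACA; congr (_ + _); rewrite addrC.
apply: le_trans (ler_normB _ _) _; rewrite mulrDr mulr1 mulrDl lerD //.
  apply: le_trans (radial_lipschitz N b0 br (be u hu) (be v hv)) _.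
  by rewrite ler_wpM2l // embB norm_emb_le.
apply: le_trans (radial_lipschitz N b0 br (bB u hu) (bB v hv)) _.
by rewrite -[leRHS]mulrA ler_wpM2l // hL.
Qed.

(** The order of choices matters: [e] from the Lipschitz constant of [r], then [rho], then the
    polynomials, then [N]. With [a], [b] the radial factors at [x], [y], the identity and the radial
    term contribute [1 + (a + b) / 2] times [sqnorm (x - y)], and the correction costs at most
    [(3 + a + b) / 8] times it. *)
Lemma standard_at_infinity_polynomial (Phi : 'rV[R]_2 -> 'rV[R]_4)
    (r : 'rV[R]_4 -> 'rV[R]_2) (R0 R1 : R) :
  0 < R0 -> 0 < R1 -> Cinf setT Phi -> Cinf setT r -> cancel Phi r ->
  (forall u, R0 <= `|u| -> Phi u = emb u) ->
  (forall y, R1 <= `|y| -> r y = prj y) ->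
  exists (psi : 'rV[R]_2 -> 'rV[R]_4) (H G : 'rV[R]_4 -> 'rV[R]_4),
    [/\ gdiffeo H G, forall i, polyfun (fun u => psi u 0 i) &
        forall u, H (Phi u) = psi u].
Proof.
move=> R00 R10 hP hr rP infP infr.
have hrp : Cinf setT (fun y => r y - prj y) by exact: (Cinf_sub2 openT hr Cinf_prj).
have [Lr Lr0 hLr] : exists2 L : R, 0 <= L & forall x y, `|r x - r y| <= L * `|x - y|.
  have [C C0 hC] := smooth_support_lipschitz R10 hrp
    (fun y hy => etrans (congr1 (fun z => z - prj y) (infr y hy)) (subrr _)).
  exists (C + 1) => [|x y]; first by rewrite addr_ge0.
  have -> : r x - r y = (r x - prj x - (r y - prj y)) + prj (x - y).
    by rewrite -prjB; apply/rowP => i; rewrite !rVE; ring.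
  apply: le_trans (ler_normD _ _) _; rewrite mulrDl mul1r lerD //.
  exact: norm_prj_le.
have [Br Br0 hBr] := @norm_bounded_on_ball R 4 _ r R1 (fun x => Cinf_continuous hr I).
(* Multiplied by [Lr] and by the 4 of [dot_le_norm] in R^4, this is at most 1/8. *)
pose e : R := 1 / (32 * (Lr + 1)).
have e0 : 0 < e by rewrite divr_gt0 // mulr_gt0 // ltr_wpDl.
have eL : e * Lr <= 1 / 32.
  rewrite /e mul1r mulrC ler_pdivrMr ?mulr_gt0 ?ltr_wpDl //; lra.
clearbody e; have e00 := ltW e0.
have [rho0 hrho0] := radial_difference_small hP R00 infP e0.
(* The summand [Br] bounds [r] on the ball where it may differ from [prj]; [growth] relies on it. *)
pose rho := 1 + R0 + Br + `|rho0|.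
have n0 := normr_ge0 rho0.
have rr0 : rho0 <= rho by rewrite /rho; have := ler_norm rho0; lra.
have r1 : 1 <= rho by rewrite /rho; lra.
have rR0 : R0 <= rho by rewrite /rho; lra.
have rBr : Br <= rho by rewrite /rho; lra.
clearbody rho.
have [N1 hN1] := hrho0 rho rr0.
pose g k u := Phi u 0 k - emb u 0 k.
have hg k : Cinf setT (g k).
  apply: (Cinf_sub2 openT (Cinf_coord k openT hP)).
  exact: Cinf_coord k openT Cinf_emb.
have g0 k u : R0 <= `|u| -> g k u = 0 by move=> h; rewrite /g infP // subrr.
have Hp k := approx_growth (hg k) R00 rR0 r1 (g0 k) e0.
have [p hp] := choice Hp.
have [Nk hNk] := choice (fun k => (hp k).2).
pose N := (N1 + \sum_(k < 4) Nk k)%N.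
have NN1 : (N1 <= N)%N by exact: leq_addr.
have NNk k : (Nk k <= N)%N.
  by apply: leq_trans (leq_addl _ _); rewrite (bigD1 k) //= leq_addr.
clearbody N.
pose P u : 'rV[R]_4 := \row_k p k u.
pose s u := radial_factor rho N (emb u) *: emb u - radial_factor rho N (Phi u) *: Phi u.
pose d u : 'rV[R]_4 := P u - (Phi u - emb u) + s u.
pose psi u : 'rV[R]_4 := emb u + P u + radial_factor rho N (emb u) *: emb u.
pose H y := y + radial_factor rho N y *: y + d (r y).
have hd : Cinf setT d.
  have hPp : Cinf setT P.
    by apply: (Cinf_rowE openT) => k; exact: Cinf_polyfun (hp k).1.
  have nu (f : 'rV[R]_2 -> 'rV[R]_4) : Cinf setT f -> Cinf setT (fun u => radial_factor rho N (f u) *: f u).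
    move=> hf; apply: (Cinf_scale openT _ hf).
    exact: (Cinf_compR (findim_rV 4) openT (fun _ _ => I) hf (@Cinf_radial_factor R rho N)).
  apply: (Cinf_add openT).
    exact: (Cinf_sub2 openT hPp (Cinf_sub2 openT hP Cinf_emb)).
  exact: (Cinf_sub2 openT (nu _ Cinf_emb) (nu _ hP)).
have hH : Cinf setT H.
  apply: (Cinf_add openT).
    apply: (Cinf_add openT (Cinf_id openT)).
    exact: (Cinf_scale openT (@Cinf_radial_factor R rho N) (Cinf_id openT)).
  exact: (Cinf_comp (findim_rV 2) openT openT (fun _ _ => I) hr hd).
have lipd (m : R) u v : `|u| <= m -> `|v| <= m ->
    `|d u - d v| <= e * (2 + (m / rho) ^+ (2 * N)) * `|u - v|.
  move=> hu hv.
  have -> : d u - d v = ((P u - (Phi u - emb u)) - (P v - (Phi v - emb v))) + (s u - s v).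
    exact: subrACA.
  apply: le_trans (ler_normD _ _) _.
  have -> : e * (2 + (m / rho) ^+ (2 * N)) * `|u - v| =
     e * (1 + (m / rho) ^+ (2 * N)) * `|u - v| + e * `|u - v| by ring.
  apply: lerD; last exact: hN1.
  have m0 : 0 <= (m / rho) ^+ (2 * N) by rewrite exprn_even_ge0 // oddM.
  apply: norm_le_coord => [|k]; first by rewrite mulr_ge0 // mulr_ge0 // addr_ge0.
  by have := hNk k N (NNk k) m u v hu hv; rewrite /g !mxE.
(* Far out, [r] is [prj], which does not increase the norm; elsewhere [|r x| <= rho], which accounts
   for the 1. *)
have growth (x : 'rV[R]_4) : (`|r x| / rho) ^+ (2 * N) <= 1 + radial_factor rho N x.
  have rp : 0 < rho by apply: lt_le_trans r1.
  have l0 := radial_factor_ge0 rho N x.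
  have [xR|xR] := leP R1 `|x|; last first.
    apply: (@le_trans _ _ 1); last by rewrite lerDl.
    rewrite exprn_ile1 ?divr_ge0 ?(ltW rp) // ler_pdivrMr // mul1r.
    exact: le_trans (hBr x (ltW xR)) rBr.
  apply: (@le_trans _ _ (radial_factor rho N x)); last by rewrite lerDr.
  rewrite infr // /radial_factor exprM; apply: lerXn2r; rewrite ?nnegrE ?sqr_ge0 //.
    by rewrite divr_ge0 ?sqnorm_ge0 ?sqr_ge0.
  rewrite exprMn exprVn ler_wpM2r ?invr_ge0 ?sqr_ge0 //.
  apply: le_trans (norm_le_sqnorm x).
  by apply: lerXn2r; rewrite ?nnegrE // norm_prj_le.
have mono : strong_mono (1 / 2) H.
  move=> x y.
  have -> : H x - H y = (x - y) + (radial_factor rho N x *: x - radial_factor rho N y *: y) + (d (r x) - d (r y)).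
    by rewrite /H subrACA [X in X + _ = _]subrACA.
  rewrite dotDl (dotDl (x - y)) -(sqnorm_dot (x - y)).
  have h1 := radial_mono rho N x y.
  have h2 := dot_le_norm (d (r x) - d (r y)) (x - y).
  have h3 := norm_le_sqnorm (x - y).
  have lx := radial_factor_ge0 rho N x; have ly := radial_factor_ge0 rho N y.
  pose m := Num.max `|r x| `|r y|.
  have hm : (m / rho) ^+ (2 * N) <= 1 + radial_factor rho N x + radial_factor rho N y.
    rewrite /m; case: (leP `|r x| `|r y|) => _.
      by have := growth y; lra.
    by have := growth x; lra.
  have hd1 : `|d (r x) - d (r y)| <= e * (3 + radial_factor rho N x + radial_factor rho N y) * (Lr * `|x - y|).
    apply: le_trans (@lipd m (r x) (r y) _ _) _; rewrite ?le_max ?lexx ?orbT //.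
    apply: ler_pM => //; last by rewrite ler_wpM2l ?(ltW e0) //; lra.
    rewrite mulr_ge0 ?(ltW e0) //.
    have : 0 <= (m / rho) ^+ (2 * N) by rewrite exprn_even_ge0 // oddM.
    lra.
  have h4 : `|dot (d (r x) - d (r y)) (x - y)| <=
      1 / 8 * (3 + radial_factor rho N x + radial_factor rho N y) * sqnorm (x - y).
    apply: le_trans h2 _.
    apply: (@le_trans _ _ (4 * (e * (3 + radial_factor rho N x + radial_factor rho N y) * (Lr * `|x - y|) * `|x - y|))).
      by rewrite ler_wpM2l // ler_wpM2r.
    have -> : 4 * (e * (3 + radial_factor rho N x + radial_factor rho N y) * (Lr * `|x - y|) * `|x - y|) =
      4 * (e * Lr) * (3 + radial_factor rho N x + radial_factor rho N y) * `|x - y| ^+ 2 by ring.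
    have w0 : 0 <= 3 + radial_factor rho N x + radial_factor rho N y by lra.
    apply: ler_pM => //; rewrite ?sqr_ge0 //.
      by rewrite mulr_ge0 // mulr_ge0 // mulr_ge0 // ltW.
    by rewrite ler_wpM2r //; lra.
  have h5 := ler_norm (- dot (d (r x) - d (r y)) (x - y)); rewrite normrN in h5.
  have sq0 := sqnorm_ge0 (x - y).
  have a0 : 0 <= radial_factor rho N x * sqnorm (x - y) by rewrite mulr_ge0.
  have b0 : 0 <= radial_factor rho N y * sqnorm (x - y) by rewrite mulr_ge0.
  lra.
have half0 : 0 < 1 / 2 :> R by rewrite divr_gt0.
have [G [h1 h2 h3]] := strong_mono_diffeo half0 hH mono.
exists psi, H, G; split=> // [i|u].
  have pl : polyfun (fun u => radial_factor rho N (emb u)).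
    apply: polyfun_exp; apply: polyfun_mul; last exact: polyfun_cst.
    by apply: polyfun_sum => k; apply: polyfun_exp; exact: polyfun_emb.
  apply: polyfun_ext (polyfun_add (polyfun_add (polyfun_emb i) (hp i).1)
    (polyfun_mul pl (polyfun_emb i))) => u.
  by rewrite /psi !rVD rVZ [P u 0 i]mxE.
rewrite /H rP /d /s /psi.
apply/rowP => i; rewrite !rVE; ring.
Qed.

End PolynomialApproximation.

(** * Smooth left inverses *)

Section Retraction.
Context {R : realType}.

(** After a linear left inverse [B] of its differential, [Phi] is the identity up to a constant and
    a germ with vanishing 1-jet. The map that [small_germ] puts in its place is invertible on all of
    R^n, so [rho] is smooth on the whole target. *)
Lemma local_left_inverse n m (Phi : 'rV[R]_n -> 'rV[R]_m) u0 : Cinf setT Phi ->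
  (forall v, 'D_v Phi u0 = 0 -> v = 0) ->
  exists rho : 'rV[R]_m -> 'rV[R]_n, Cinf setT rho /\
    exists2 d : R, 0 < d & forall u, `|u - u0| <= d -> rho (Phi u) = u.
Proof.
move=> hP imm; have dP : differentiable Phi u0 by exact: (Cinf_differentiable hP).
have /row_freeP[B AB] : row_free (jacobi Phi u0).
  by apply: inj_row_free => v; rewrite -derive_jacobi // => /imm.
pose f u := Phi u *m B - u.
have hPB : Cinf setT (fun u => Phi u *m B) by exact: (Cinf_mulmx B openT hP).
have hf : Cinf setT f by exact: (Cinf_sub2 openT hPB (Cinf_id openT)).
pose e u := f u - f u0.
have he : Cinf setT e by exact: (Cinf_sub2 openT hf (Cinf_cst _ _)).
have de v : 'D_v e u0 = 0.
  have d1 : derivable (fun u => Phi u *m B) u0 v := Cinf_derivable hPB.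
  have -> : e = (fun u => Phi u *m B) - id - cst (f u0) by [].
  have d2 : derivable (id : 'rV[R]_n -> 'rV[R]_n) u0 v by exact: derivable_id.
  have d3 : derivable (cst (f u0) : 'rV[R]_n -> 'rV[R]_n) u0 v by exact: derivable_cst.
  rewrite (deriveB (derivableB d1 d2) d3) (deriveB d1 d2) derive_cst derive_id subr0.
  pose L : {linear 'rV[R]_m -> 'rV[R]_n} := mulmxr B.
  have cL : continuous L by exact: mulmxr_continuous.
  rewrite (derive_linear_comp v cL dP) derive_jacobi // /L /= -mulmxA AB mulmx1.
  exact: subrr.
have e0 : e u0 = 0 by exact: subrr.
have [eta eta0 neta] := @lipschitz_constant_exists R n.
have [e' [he' [d d0 hd] _ lip]] := small_germ openT (I : setT u0) he e0 de eta0 ltr01.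
have [G [hF hG GF FG]] := lipschitz_gdiffeo (ltW eta0) he' lip neta
  (introT andP (conj ler01 (lexx (1 : R)))).
exists (fun y => G (y *m B - f u0)); split.
  apply: (Cinf_comp (findim_rV n) openT openT (fun _ _ => I) _ hG).
  exact: (Cinf_sub2 openT (Cinf_mulmx _ openT (Cinf_id openT)) (Cinf_cst _ _)).
exists d => // u hu; rewrite -[RHS]GF; congr G.
by rewrite scale1r hd // /e /f [RHS]addrA [u + _]addrC subrK.
Qed.

(* Minimize the sum of [|Phi u - Phi u0|] and a bump at [u0], which is positive
   everywhere. *)
Lemma embedding_isolates (Phi : 'rV[R]_2 -> 'rV[R]_4) (R0 : R) u0 (d : R) :
  Cinf setT Phi -> injective Phi -> (forall u, R0 <= `|u| -> Phi u = emb u) -> 0 < d ->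
  exists2 c : R, 0 < c & forall u, `|Phi u - Phi u0| < c -> `|u - u0| <= d.
Proof.
move=> hP inj inf d0.
pose S : R := 2 * (2%:R + 1); have S0 : 0 < S by rewrite mulr_gt0 // ltr_wpDl.
pose F u := `|Phi u - Phi u0| + cutoff ((S / d) *: (u - u0)).
have c1 : continuous (fun u => `|Phi u - Phi u0|).
  have hh : Cinf setT (fun u => Phi u - Phi u0) by exact: (Cinf_sub2 openT hP (Cinf_cst _ _)).
  move=> u; apply: (@continuous_comp _ _ _ (fun u => Phi u - Phi u0) (@Num.norm R _)).
    exact: (Cinf_continuous hh).
  exact: norm_continuous.
have c2 : continuous (fun u : 'rV[R]_2 => cutoff ((S / d) *: (u - u0))).
  have hc : Cinf setT (fun u : 'rV[R]_2 => cutoff ((S / d) *: (u - u0))).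
    apply: (Cinf_compR (findim_rV 2) openT (fun _ _ => I) _ (@Cinf_cutoff R 2)).
    apply: (Cinf_scale openT (Cinf_cst _ _)).
    exact: (Cinf_sub2 openT (Cinf_id openT) (Cinf_cst _ _)).
  by move=> u; exact: (Cinf_continuous hc).
have cF : continuous F by move=> u; exact: (cvgD (c1 u) (c2 u)).
have Fpos u : 0 < F u.
  have [->|uu] := eqVneq u u0.
    by rewrite /F !subrr scaler0 normr0 add0r cutoff1 // normr0.
  apply: ltr_pwDl; last by have /andP[] := cutoff01 ((S / d) *: (u - u0)).
  by rewrite normr_gt0 subr_eq0; apply: contra_neq uu => /inj.
pose R2 := `|R0| + `|Phi u0| + 1.
have R20 : 0 <= R2 by rewrite !addr_ge0.
have [||x0 _ hx0] := @EVT_min_rV R 2 F [set x | `|x| <= R2] _ (@ball_rV_compact _ _ R2).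
- by exists 0; rewrite /= normr0.
- exact: continuous_subspaceT.
exists (Num.min 1 (F x0)); first by rewrite lt_min ltr01 Fpos.
move=> u; rewrite lt_min => /andP[h1 h2].
have uR : `|u| <= R2.
  rewrite leNgt; apply/negP => uR.
  have R0u : R0 <= `|u|.
    apply: le_trans (ltW uR); apply: le_trans (ler_norm R0) _.
    by rewrite /R2 -addrA lerDl addr_ge0.
  have E : `|u| <= `|Phi u|.
    by rewrite inf // -{1}(embK u); exact: norm_prj_le.
  have := lerB_dist (Phi u) (Phi u0) => h3.
  by have := normr_ge0 R0; move: uR; rewrite /R2; lra.
have := hx0 u; rewrite inE => /(_ uR) h3.
have c0 : 0 < cutoff ((S / d) *: (u - u0)).
  by have := lt_le_trans h2 h3; rewrite {1}/F -subr_gt0 addrC addKr.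
rewrite leNgt; apply/negP => hd; move: c0; rewrite cutoff0 ?ltxx //.
rewrite normrZ -/S gtr0_norm ?divr_gt0 // mulrAC ler_pdivlMr //.
by rewrite ler_wpM2l ?(ltW S0) // ltW.
Qed.

(** The members of a finite subcover are added one at a time. Local left inverses can thus be glued
    in singly, without a partition of unity. *)
Lemma compact_ball_induction n (Q : set 'rV[R]_n -> Prop) (r : R) :
  (forall A B, A `<=` B -> Q B -> Q A) -> Q set0 ->
  (forall x, exists2 N, open N /\ N x & forall A, Q A -> Q (A `|` N)) ->
  Q [set x | `|x| <= r].
Proof.
move=> Qsub Q0 step.
have [N hN] := choice (fun x => let: ex_intro2 N h1 h2 := step x in
  ex_intro (fun N => (open N /\ N x) /\ forall A, Q A -> Q (A `|` N)) N (conj h1 h2)).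
have := @ball_rV_compact R n r; rewrite compact_cover.
move=> /(_ _ setT N) [||D _ Dcov].
- by move=> x _; exact: (hN x).1.1.
- by move=> x _; exists x => //; exact: (hN x).1.2.
have Ql (l : seq 'rV[R]_n) : Q [set x | exists2 y, y \in l & N y x].
  elim: l => [|y l IH]; first by apply: Qsub Q0 => x [z].
  apply: Qsub ((hN y).2 _ IH) => x [z]; rewrite inE => /orP[/eqP ->|zl] Nz; first by right.
  by left; exists z.
apply: Qsub (Ql (finmap.enum_fset D)) => x xr; have [y yD Ny] := Dcov x xr.
by exists y.
Qed.

(* If [r] inverts [Phi] on [A] and [rho] inverts it near [u0], then
   [r + b (rho - r)] inverts it on both when the cutoff [b] at [Phi u0] is
   supported where [Phi] only takes values from the domain of [rho]. *)
Lemma smooth_retraction (Phi : 'rV[R]_2 -> 'rV[R]_4) (R0 : R) :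
  Cinf setT Phi -> injective Phi -> (forall u v, 'D_v Phi u = 0 -> v = 0) ->
  (forall u, R0 <= `|u| -> Phi u = emb u) ->
  exists (r : 'rV[R]_4 -> 'rV[R]_2) (R1 : R),
    [/\ 0 < R1, Cinf setT r, cancel Phi r & forall y, R1 <= `|y| -> r y = prj y].
Proof.
move=> hP inj imm inf.
have [B B0 hB] := @norm_bounded_on_ball R 2 _ Phi R0 (fun x => Cinf_continuous hP I).
pose R1 := B + 1; have R10 : 0 < R1 by rewrite ltr_wpDl.
(* The conditions beyond [R0] and [R1] hold for [prj] from the start, and each gluing preserves
   them. *)
pose Q (A : set 'rV[R]_2) := exists r : 'rV[R]_4 -> 'rV[R]_2,
  [/\ Cinf setT r, forall u, R0 <= `|u| -> r (Phi u) = u,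
      forall u, A u -> `|u| <= R0 -> r (Phi u) = u & forall y, R1 <= `|y| -> r y = prj y].
have : Q [set u | `|u| <= R0]; last first.
  move=> [r [h1 h2 h3 h4]]; exists r, R1; split=> // u.
  by case/orP: (le_total `|u| R0) => h; [apply: h3|apply: h2].
apply: compact_ball_induction.
- by move=> A C AC [r [h1 h2 h3 h4]]; exists r; split=> // u /AC; exact: h3.
- exists prj; split=> //; first exact: Cinf_prj.
  by move=> u /inf ->; exact: embK.
move=> u0; have [u0R|u0R] := leP `|u0| R0; last first.
  exists [set u | R0 < `|u - 0|].
    by split; [exact: open_norm_gt|rewrite /= subr0].
  move=> A [r [h1 h2 h3 h4]]; exists r; split=> // u [/h3 //|/=].
  by rewrite subr0 => /lt_le_trans h /h; rewrite ltxx.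
have [rho [hrho [d d0 hd]]] := local_left_inverse hP (imm u0).
have [c c0 hc] := embedding_isolates u0 hP inj inf d0.
pose S : R := 2 * (4%:R + 1); have S0 : 0 < S by rewrite mulr_gt0 // ltr_wpDl.
(* The bound 1 keeps the bump inside [|y| < R1], as [|Phi u0| <= B = R1 - 1]. *)
pose c' := Num.min c 1; have c'0 : 0 < c' by rewrite lt_min c0 ltr01.
pose b (y : 'rV[R]_4) := cutoff ((S / c') *: (y - Phi u0)).
have Sc : 0 < S / c' by rewrite divr_gt0.
have hb : Cinf setT b.
  apply: (Cinf_compR (findim_rV 4) openT (fun _ _ => I) _ (@Cinf_cutoff R 4)).
  apply: (Cinf_scale openT (Cinf_cst _ _)).
  exact: (Cinf_sub2 openT (Cinf_id openT) (Cinf_cst _ _)).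
have b0 y : c' <= `|y - Phi u0| -> b y = 0.
  move=> h; apply: cutoff0; rewrite normrZ gtr0_norm // mulrAC ler_pdivlMr //.
  by rewrite -/S ler_wpM2l // ltW.
have b1 y : `|y - Phi u0| <= c' / S -> b y = 1.
  move=> h; apply: cutoff1; rewrite normrZ gtr0_norm // mulrC -ler_pdivlMr // mul1r.
  by rewrite invf_div.
clearbody b.
exists [set u | `|Phi u - Phi u0| < c' / S].
  split; last by rewrite /= subrr normr0 divr_gt0.
  rewrite (_ : mkset _ = Phi @^-1` [set y | `|y - Phi u0| < c' / S]) //.
  apply: open_comp; last exact: open_norm_lt.
  by move=> u _; exact: (Cinf_continuous hP).
move=> A [r [h1 h2 h3 h4]].
pose r' y := r y + b y *: (rho y - r y).
have keep u : r (Phi u) = u -> r' (Phi u) = u.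
  move=> ru; rewrite /r' ru.
  have [h|h] := leP c' `|Phi u - Phi u0|; first by rewrite b0 // scale0r addr0.
  rewrite hd ?subrr ?scaler0 ?addr0 //; apply: hc.
  by apply: lt_le_trans h _; rewrite ge_min lexx.
exists r'; split.
- apply: (Cinf_add openT h1 (Cinf_scale openT hb (Cinf_sub2 openT hrho h1))).
- by move=> u /h2; exact: keep.
- move=> u [Au uR|hu _]; first by apply: keep; exact: h3.
  rewrite /r' b1 ?scale1r; last exact: ltW.
  rewrite addrC subrK hd //; apply: hc; apply: lt_le_trans hu _.
  have S1 : c' / S <= c' by rewrite ler_pdivrMr // ler_peMr ?(ltW c'0) // /S; lra.
  by apply: le_trans S1 _; rewrite ge_min lexx.
- move=> y hy; rewrite /r' b0 ?scale0r ?addr0; first exact: h4.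
  apply: (@le_trans _ _ 1); first by rewrite ge_min lexx orbT.
  apply: le_trans (lerB_dist _ _).
  by have := hB u0 u0R; move: hy; rewrite /R1; lra.
Qed.

End Retraction.

(** * Inversion and stereographic charts *)

Section Inversion.
Context {R : realType}.

(** Since [0^-1 = 0], the origin is fixed and this is an involution of the whole space, smooth off
    0. *)
Definition inversion n (x : 'rV[R]_n) : 'rV[R]_n := (sqnorm x)^-1 *: x.

Lemma sqnormZ n (c : R) (x : 'rV[R]_n) : sqnorm (c *: x) = c ^+ 2 * sqnorm x.
Proof. by rewrite !sqnorm_dot dotZl dotZr mulrA expr2. Qed.

Lemma sqnorm0 n : sqnorm (0 : 'rV[R]_n) = 0.
Proof. by rewrite -(scale0r 0) sqnormZ expr0n mul0r. Qed.

Lemma sqnorm_gt0 n (x : 'rV[R]_n) : x != 0 -> 0 < sqnorm x.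
Proof.
move=> x0; rewrite lt_neqAle sqnorm_ge0 andbT; apply: contra_neq x0 => h.
by apply: sqnorm_eq0; rewrite -h.
Qed.

Lemma sqnorm_inversion n (x : 'rV[R]_n) : sqnorm (inversion x) = (sqnorm x)^-1.
Proof.
rewrite sqnormZ; have [->|x0] := eqVneq x 0; first by rewrite sqnorm0 invr0 mulr0.
by have := sqnorm_gt0 x0 => h; field; rewrite gt_eqF.
Qed.

Lemma inversionK n : involutive (@inversion n).
Proof.
move=> x; rewrite {1}/inversion sqnorm_inversion invrK /inversion.
have [->|x0] := eqVneq x 0; first by rewrite !scaler0.
by rewrite scalerA divff ?scale1r // gt_eqF // sqnorm_gt0.
Qed.

Lemma inversion0 n : inversion (0 : 'rV[R]_n) = 0.
Proof. exact: scaler0. Qed.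

Lemma inversion_neq0 n (x : 'rV[R]_n) : x != 0 -> inversion x != 0.
Proof. by apply: contra_neq => h; rewrite -(inversionK x) h inversion0. Qed.

Lemma norm_inversion_le n (x : 'rV[R]_n) : `|inversion x| <= `|x|^-1.
Proof.
have [->|x0] := eqVneq x 0; first by rewrite inversion0 normr0 invr0.
rewrite normrZ ger0_norm ?invr_ge0 ?sqnorm_ge0 // mulrC.
have nx : 0 < `|x| by rewrite normr_gt0.
rewrite ler_pdivrMr ?sqnorm_gt0 // -ler_pdivrMl ?invr_gt0 // invrK -expr2.
exact: norm_le_sqnorm.
Qed.

Lemma norm_inversion_ge n (x : 'rV[R]_n) : x != 0 ->
  `|x| <= (n%:R + 1)^-1 -> 1 <= `|inversion x|.
Proof.
move=> x0 h; have nx : 0 < `|x| by rewrite normr_gt0.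
have N1 : 0 < n%:R + 1 :> R by rewrite ltr_wpDl.
rewrite normrZ ger0_norm ?invr_ge0 ?sqnorm_ge0 // mulrC ler_pdivlMr ?sqnorm_gt0 // mul1r.
apply: le_trans (sqnorm_le_norm x) _; rewrite expr2 mulrA ler_piMl ?(ltW nx) //.
have h1 : n%:R * `|x| <= n%:R / (n%:R + 1) by rewrite ler_wpM2l.
by apply: le_trans h1 _; rewrite ler_pdivrMr // mul1r lerDl.
Qed.

Lemma open_neq0 n : open [set x : 'rV[R]_n | x != 0].
Proof.
rewrite (_ : mkset _ = [set x : 'rV[R]_n | 0 < `|x - 0|]); first exact: open_norm_gt.
by apply/seteqP; split=> x /=; rewrite subr0 normr_gt0.
Qed.

Lemma Cinf_inversion n : Cinf [set x : 'rV[R]_n | x != 0] (@inversion n).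
Proof.
have o := @open_neq0 n.
apply: (Cinf_scale o _ (Cinf_id o)); apply: (Cinf_inv o _ (Cinf_sqnorm o (Cinf_id o))).
by move=> x /= x0; rewrite gt_eqF // sqnorm_gt0.
Qed.

(** Near 0 the conjugate is the identity, because [D] is the identity far out; elsewhere neither
    inversion meets its singularity. *)
Lemma Cinf_conj_inversion n (D : 'rV[R]_n -> 'rV[R]_n) : Cinf setT D ->
  (forall y, D y = 0 -> y = 0) -> (forall y, 1 <= `|y| -> D y = y) -> D 0 = 0 ->
  Cinf setT (fun x => inversion (D (inversion x))).
Proof.
move=> hD D0 D1 D00; apply: Cinf_local => x _.
have [->|x0] := eqVneq x 0.
  exists [set x : 'rV[R]_n | `|x - 0| < (n%:R + 1)^-1]; split.
    by rewrite /= subrr normr0 invr_gt0 ltr_wpDl.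
  have oB := @open_norm_lt R n 0 (n%:R + 1)^-1.
  apply: (Cinf_ext oB _ (Cinf_id oB)) => y /=; rewrite subr0 => hy.
  have [->|y0] := eqVneq y 0; first by rewrite inversion0 D00 inversion0.
  by rewrite D1 ?inversionK // norm_inversion_ge // ltW.
exists [set x : 'rV[R]_n | x != 0]; split=> //.
have o := @open_neq0 n.
have h1 : Cinf [set x : 'rV[R]_n | x != 0] (fun x => D (inversion x)).
  exact: (Cinf_comp (findim_rV n) o openT (fun _ _ => I) (@Cinf_inversion n) hD).
apply: (Cinf_comp (findim_rV n) o o _ h1 (@Cinf_inversion n)) => y /= y0.
by apply: contra_neq (inversion_neq0 y0) => /D0.
Qed.

(** The conjugate of [D'] comes first: [D] carries the standard plane to the germ, and this has to
    be undone. *)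
Lemma gdiffeo_conj_inversion n (D D' : 'rV[R]_n -> 'rV[R]_n) : gdiffeo D D' ->
  D 0 = 0 -> (forall y, 1 <= `|y| -> D y = y) ->
  gdiffeo (fun x => inversion (D' (inversion x))) (fun x => inversion (D (inversion x))).
Proof.
move=> [hD hD' DK D'K] D0 D1.
have D'0 : D' 0 = 0 by rewrite -D0 DK.
split.
- apply: Cinf_conj_inversion => // y hy; first by rewrite -(D'K y) hy.
  by rewrite -{1}(D1 y hy) DK.
- apply: Cinf_conj_inversion => // y hy; by rewrite -(DK y) hy.
- by move=> x; rewrite inversionK D'K inversionK.
- by move=> x; rewrite inversionK DK inversionK.
Qed.

End Inversion.

(** * Twisted stereographic charts *)

Section Stereographic.
Context {R : realType}.

Lemma Cinf_sqrt : Cinf [set t : R | 0 < t] (@Num.sqrt R).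
Proof.
have o : open [set t : R | 0 < t] by exact: open_gt.
elim=> [|n IH]; first by move=> x _; exact: sqrt_continuous.
apply: (Cn_is_derive o (fun x x0 => is_derive1_sqrt x0)).
apply: (Cn_inv o _ (Cn_scale 2 o IH)) => x /= x0.
by rewrite gt_eqF // mulr_gt0 // sqrtr_gt0.
Qed.

Definition enorm n (x : 'rV[R]_n) : R := Num.sqrt (sqnorm x).

Lemma sqr_enorm n (x : 'rV[R]_n) : enorm x ^+ 2 = sqnorm x.
Proof. by rewrite sqr_sqrtr // sqnorm_ge0. Qed.

Lemma enorm_gt0 n (x : 'rV[R]_n) : x != 0 -> 0 < enorm x.
Proof. by move=> x0; rewrite sqrtr_gt0 sqnorm_gt0. Qed.

Lemma enormZ n (c : R) (x : 'rV[R]_n) : 0 <= c -> enorm (c *: x) = c * enorm x.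
Proof. by move=> c0; rewrite /enorm sqnormZ sqrtrM ?sqr_ge0 // sqrtr_sqr ger0_norm. Qed.

Lemma Cinf_enorm (V : normedModType R) n (U : set V) (f : V -> 'rV[R]_n) : open U ->
  (forall x, U x -> f x != 0) -> Cinf U f -> Cinf U (fun x => enorm (f x)).
Proof.
move=> oU f0 hf.
apply: (Cinf_compR findimR oU _ (Cinf_sqnorm oU hf) Cinf_sqrt) => x /f0 /=.
exact: sqnorm_gt0.
Qed.

Definition normalize n (x : 'rV[R]_n) := (enorm x)^-1 *: x.

Lemma normalizeZ n (c : R) (x : 'rV[R]_n) : 0 < c -> normalize (c *: x) = normalize x.
Proof.
move=> c0; rewrite /normalize enormZ ?(ltW c0) // scalerA; congr (_ *: _).
by rewrite invfM mulrAC mulVf ?mul1r // gt_eqF.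
Qed.

Lemma normalize_unit n (x : 'rV[R]_n) : sqnorm x = 1 -> normalize x = x.
Proof. by move=> x1; rewrite /normalize /enorm x1 sqrtr1 invr1 scale1r. Qed.

Lemma sqnorm_normalize n (x : 'rV[R]_n) : x != 0 -> sqnorm (normalize x) = 1.
Proof.
by move=> x0; rewrite sqnormZ -(sqr_enorm x) exprVn mulVf // expf_neq0 // gt_eqF // enorm_gt0.
Qed.

Variable n : nat.
Implicit Types (x y : 'rV[R]_n.+1) (w : 'rV[R]_n) (B C : 'M[R]_n.+1) (s : R).

Definition tail y : 'rV[R]_n := \row_j y 0 (lift ord0 j).

Lemma tailZ c y : tail (c *: y) = c *: tail y.
Proof. by apply/rowP => j; rewrite !mxE. Qed.

Lemma sqnorm_tail y : sqnorm y = y 0 0 ^+ 2 + sqnorm (tail y).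
Proof.
by rewrite /sqnorm big_ord_recl; congr (_ + _); apply: eq_bigr => j _; rewrite mxE.
Qed.

Lemma row_tail_eq y y' : y 0 0 = y' 0 0 -> tail y = tail y' -> y = y'.
Proof.
move=> h0 ht; apply/rowP => k; case: (unliftP ord0 k) => [j ->|-> //].
by have := congr1 (fun t : 'rV[R]_n => t 0 j) ht; rewrite !mxE.
Qed.

(** For [s] equal to 1 or -1, inverse stereographic projection from the pole [s e_0], multiplied by
    its denominator [sqnorm w + 1]. *)
Definition cone s w : 'rV[R]_n.+1 :=
  \row_k if unlift ord0 k is Some j then 2 * w 0 j else s * (sqnorm w - 1).

Lemma cone0 s w : cone s w 0 0 = s * (sqnorm w - 1).
Proof. by rewrite mxE unlift_none. Qed.

Lemma tail_cone s w : tail (cone s w) = 2 *: w.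
Proof. by apply/rowP => j; rewrite !mxE liftK. Qed.

Lemma enorm_cone s w : s ^+ 2 = 1 -> enorm (cone s w) = sqnorm w + 1.
Proof.
move=> s1; have -> : enorm (cone s w) = Num.sqrt ((sqnorm w + 1) ^+ 2).
  congr Num.sqrt; rewrite sqnorm_tail cone0 tail_cone sqnormZ exprMn s1.
  by move: (sqnorm w) => a; ring.
by rewrite sqrtr_sqr ger0_norm // addr_ge0 // sqnorm_ge0.
Qed.

Lemma cone_neq0 s w : s ^+ 2 = 1 -> cone s w != 0.
Proof.
move=> s1; apply/eqP => h; have := enorm_cone w s1; rewrite h /enorm sqnorm0 sqrtr0.
by have := sqnorm_ge0 w => h1 h2; lra.
Qed.

(* Stereographic charts of the unit sphere twisted by the linear isomorphism
   [C]: the rays of [cone s w] exhaust all rays except that of [s e_0]. *)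
Definition ster s C w := normalize (cone s w *m C).
Definition unster s B x : 'rV[R]_n := let y := x *m B in (enorm y - s * y 0 0)^-1 *: tail y.

Lemma mulmx_unit_neq0 x C : C \in unitmx -> x != 0 -> x *m C != 0.
Proof. by move=> uC; apply: contra_neq => h; rewrite -(mulmxK uC x) h mul0mx. Qed.

Lemma cone_mulmx_neq0 s w C : s ^+ 2 = 1 -> C \in unitmx -> cone s w *m C != 0.
Proof. by move=> s1 uC; apply: mulmx_unit_neq0 => //; exact: cone_neq0. Qed.

Lemma sqnorm_ster s C w : s ^+ 2 = 1 -> C \in unitmx -> sqnorm (ster s C w) = 1.
Proof. by move=> s1 uC; apply: sqnorm_normalize; exact: cone_mulmx_neq0. Qed.

Lemma ster_mulmx s C w : s ^+ 2 = 1 -> C \in unitmx ->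
  exists2 c : R, 0 < c & ster s C w *m invmx C = c *: cone s w.
Proof.
move=> s1 uC; exists (enorm (cone s w *m C))^-1.
  by rewrite invr_gt0 enorm_gt0 // cone_mulmx_neq0.
by rewrite /ster /normalize -scalemxAl mulmxK.
Qed.

Lemma sterK s C : s ^+ 2 = 1 -> C \in unitmx -> cancel (ster s C) (unster s (invmx C)).
Proof.
move=> s1 uC w; have [c c0 E] := ster_mulmx w s1 uC.
rewrite /unster E enormZ ?(ltW c0) // enorm_cone // tailZ tail_cone !scalerA.
rewrite [(c *: cone s w) 0 0]mxE cone0.
have -> : c * (sqnorm w + 1) - s * (c * (s * (sqnorm w - 1))) = 2 * c.
  have -> : s * (c * (s * (sqnorm w - 1))) = s ^+ 2 * (c * (sqnorm w - 1)) by ring.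
  by rewrite s1; ring.
rewrite [X in X *: _](_ : _ = 1) ?scale1r //.
by field; rewrite gt_eqF.
Qed.

(** Open in the ambient space, as smoothness on the sphere is expressed by ambient extensions;
    [sphere_domain] shows that it contains the sphere without the pole. *)
Definition unster_domain s B : set 'rV[R]_n.+1 :=
  [set x | x *m B != 0 /\ 0 < enorm (x *m B) - s * (x *m B) 0 0].

Lemma open_unster_domain s B : open (unster_domain s B).
Proof.
have cB := @mulmxr_continuous R _ _ B.
rewrite (_ : unster_domain s B = ((fun x : 'rV[R]_n.+1 => x *m B) @^-1` [set y | y != 0]) `&`
   ((fun x : 'rV[R]_n.+1 => enorm (x *m B) - s * (x *m B) 0 0) @^-1` [set t | 0 < t])) //.
apply: openI; apply: open_comp; [|exact: open_neq0| |exact: open_gt].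
  by move=> x _; exact: cB.
move=> x _.
have c1 : {for x, continuous (fun x : 'rV[R]_n.+1 => enorm (x *m B))}.
  have h : Cinf setT (fun x : 'rV[R]_n.+1 => sqnorm (x *m B)).
    exact: (Cinf_sqnorm openT (Cinf_mulmx B openT (Cinf_id openT))).
  apply: (@continuous_comp _ _ _ (fun x : 'rV[R]_n.+1 => sqnorm (x *m B)) Num.sqrt).
    exact: (Cinf_continuous h).
  exact: sqrt_continuous.
have c2 : {for x, continuous (fun x : 'rV[R]_n.+1 => s * (x *m B) 0 0)}.
  have h : Cinf setT (fun x : 'rV[R]_n.+1 => s * (x *m B) 0 0).
    exact: (Cinf_mul openT (Cinf_cst _ _) (Cinf_coord 0 openT (Cinf_mulmx B openT (Cinf_id openT)))).
  exact: (Cinf_continuous h).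
exact: (cvgB c1 c2).
Qed.

Lemma Cinf_unster s B : Cinf (unster_domain s B) (unster s B).
Proof.
have o := @open_unster_domain s B.
have hB : Cinf (unster_domain s B) (fun x => x *m B) by exact: (Cinf_mulmx B o (Cinf_id o)).
apply: (Cinf_scale o).
  apply: (Cinf_inv o) => [x [_ h]|]; first by rewrite gt_eqF.
  apply: (Cinf_sub2 o).
    by apply: (Cinf_enorm o _ hB) => x [].
  exact: (Cinf_mul o (Cinf_cst _ _) (Cinf_coord 0 o hB)).
by apply: (Cinf_rowE o) => j; exact: Cinf_coord.
Qed.

Lemma Cinf_ster s C : s ^+ 2 = 1 -> C \in unitmx -> Cinf setT (ster s C).
Proof.
move=> s1 uC.
have hc : Cinf setT (fun w => cone s w *m C).
  apply: (Cinf_mulmx C openT); apply: (Cinf_rowE openT) => k.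
  case: (unlift ord0 k) => [j|].
    exact: (Cinf_mul openT (Cinf_cst _ _) (Cinf_rV j openT)).
  apply: (Cinf_mul openT (Cinf_cst _ _)).
  exact: (Cinf_sub2 openT (Cinf_sqnorm openT (Cinf_id openT)) (Cinf_cst _ _)).
apply: (Cinf_scale openT _ hc); apply: (Cinf_inv openT).
  by move=> w _; rewrite gt_eqF // enorm_gt0 // cone_mulmx_neq0.
by apply: (Cinf_enorm openT _ hc) => w _; exact: cone_mulmx_neq0.
Qed.

Lemma ster_domain s C w : s ^+ 2 = 1 -> C \in unitmx ->
  unster_domain s (invmx C) (ster s C w).
Proof.
move=> s1 uC; have [c c0 E] := ster_mulmx w s1 uC; rewrite /unster_domain /= E; split.
  by rewrite scaler_eq0 negb_or cone_neq0 // gt_eqF.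
rewrite enormZ ?(ltW c0) // enorm_cone // [(c *: cone s w) 0 0]mxE cone0.
have -> : c * (sqnorm w + 1) - s * (c * (s * (sqnorm w - 1))) = 2 * c.
  have -> : s * (c * (s * (sqnorm w - 1))) = s ^+ 2 * (c * (sqnorm w - 1)) by ring.
  by rewrite s1; ring.
by rewrite mulr_gt0.
Qed.

(** [enorm y - s * y 0 0] is nonnegative and vanishes only if [tail y = 0]; unit length then forces
    [x] to be the excluded point. *)
Lemma sphere_domain s C x : s ^+ 2 = 1 -> C \in unitmx -> sqnorm (row 0 C) = 1 ->
  sqnorm x = 1 -> x != s *: row 0 C -> unster_domain s (invmx C) x.
Proof.
move=> s1 uC C1 x1 xs.
have x0 : x != 0 by apply: contra_eq_neq x1 => ->; rewrite sqnorm0 eq_sym oner_eq0.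
have y0 : x *m invmx C != 0 by apply: mulmx_unit_neq0; rewrite ?unitmx_inv.
split=> //; set y := x *m invmx C in y0 *.
have ss : s * y 0 0 <= `|y 0 0|.
  apply: le_trans (ler_norm _) _; rewrite normrM.
  have -> : `|s| = 1 by apply/eqP; rewrite -sqrp_eq1 // real_normK ?num_real // s1.
  by rewrite mul1r.
have E := sqr_enorm y; rewrite sqnorm_tail in E.
have e0 := enorm_gt0 y0; have t0 := sqnorm_ge0 (tail y).
rewrite subr_gt0 lt_neqAle; apply/andP; split; last first.
  apply: le_trans ss _; rewrite -(ler_pXn2r (n := 2)) ?nnegrE ?(ltW e0) //.
  by rewrite real_normK ?num_real // E lerDl.
apply: contra_neq xs => Es.
have tz : tail y = 0.
  apply: sqnorm_eq0; rewrite -(lerD2l (y 0 0 ^+ 2)) -E -Es exprMn s1 mul1r addr0 //.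
have yE : y = y 0 0 *: delta_mx 0 0.
  apply: row_tail_eq; first by rewrite !mxE mulr1.
  by rewrite tz; apply/rowP => j; rewrite !mxE /= mulr0.
have xE : x = y 0 0 *: row 0 C.
  by rewrite -(mulmxKV uC x) -/y {1}yE -scalemxAl -rowE.
have y2 : y 0 0 ^+ 2 = 1 by move: x1; rewrite {1}xE sqnormZ C1 mulr1.
rewrite xE; congr (_ *: _).
have e1 : enorm y = 1.
  by apply/eqP; rewrite -(sqrp_eq1 (ltW e0)) E tz sqnorm0 addr0 y2.
by rewrite -[LHS]mul1r -s1 expr2 -mulrA Es e1 mulr1.
Qed.

Lemma unsterK s C x : s ^+ 2 = 1 -> C \in unitmx -> sqnorm x = 1 ->
  unster_domain s (invmx C) x -> ster s C (unster s (invmx C) x) = x.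
Proof.
move=> s1 uC x1 [y0 D0]; rewrite /unster; set y := x *m invmx C in y0 D0 *.
set D := enorm y - s * y 0 0 in D0 *.
have E := sqr_enorm y; rewrite sqnorm_tail in E.
have cE : cone s (D^-1 *: tail y) = (2 / D) *: y.
  apply: row_tail_eq; last by rewrite tail_cone tailZ scalerA.
  rewrite cone0 sqnormZ [RHS]mxE exprVn.
  have -> : sqnorm (tail y) = D * (enorm y + s * y 0 0).
    rewrite /D; have -> : sqnorm (tail y) = enorm y ^+ 2 - y 0 0 ^+ 2 by rewrite E addrC addKr.
    have -> : y 0 0 ^+ 2 = s ^+ 2 * y 0 0 ^+ 2 by rewrite s1 mul1r.
    by ring.
  have -> : D ^- 2 * (D * (enorm y + s * y 0 0)) - 1 = (2 * (s * y 0 0)) / D.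
    have -> : 1 = D / D :> R by rewrite divff // gt_eqF.
    rewrite {3}/D; field; rewrite gt_eqF //.
  have -> : s * (2 * (s * y 0 0) / D) = s ^+ 2 * (2 / D * y 0 0) by ring.
  by rewrite s1 mul1r.
rewrite /ster cE -scalemxAl normalizeZ ?divr_gt0 // mulmxKV //.
exact: normalize_unit.
Qed.

Lemma ster_neq s C w : s ^+ 2 = 1 -> C \in unitmx -> ster s C w <> s *: row 0 C.
Proof.
move=> s1 uC h; have [_] := ster_domain w s1 uC; rewrite h -scalemxAl -row_mul mulmxV //.
have -> : s *: row 0 (1%:M : 'M[R]_n.+1) = s *: delta_mx 0 0 by rewrite rowE mulmx1.
rewrite /enorm sqnormZ s1 mul1r.
have -> : sqnorm (delta_mx 0 0 : 'rV[R]_n.+1) = 1.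
  rewrite sqnorm_tail (_ : tail _ = 0) ?sqnorm0 ?addr0 ?mxE ?expr1n //.
  by apply/rowP => j; rewrite !mxE.
by rewrite !mxE mulr1 -expr2 s1 sqrtr1 subrr ltxx.
Qed.

(** The cones of [w] and of its inversion, with opposite signs, are proportional with factor
    [sqnorm w], and the linear twist preserves this. *)
Lemma ster_inversion C w : w != 0 -> ster (-1) C (inversion w) = ster 1 C w.
Proof.
move=> w0; have q0 := sqnorm_gt0 w0.
have -> : ster 1 C w = normalize (sqnorm w *: (cone (-1) (inversion w) *m C)).
  rewrite /ster; congr normalize; rewrite scalemxAl; congr (_ *m _).
  apply: row_tail_eq; last first.
    by rewrite tailZ !tail_cone /inversion !scalerA; congr (_ *: _); field; rewrite gt_eqF.
  rewrite cone0 mxE cone0 sqnorm_inversion; field; rewrite gt_eqF //.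
by rewrite normalizeZ.
Qed.

Lemma unster_inversion B x : unster_domain (-1) B x -> unster_domain 1 B x ->
  inversion (unster (-1) B x) = unster 1 B x.
Proof.
move=> [_]; rewrite /unster; set y := x *m B; rewrite mulN1r opprK => d1 [_].
rewrite mul1r => d2; rewrite /inversion sqnormZ scalerA; congr (_ *: _).
have -> : sqnorm (tail y) = (enorm y - y 0 0) * (enorm y + y 0 0).
  have -> : sqnorm (tail y) = enorm y ^+ 2 - y 0 0 ^+ 2.
    by rewrite sqr_enorm sqnorm_tail addrC addKr.
  by ring.
by field; rewrite !gt_eqF.
Qed.

End Stereographic.

(** * Comparison of charts of the punctured sphere *)

Section Charts.
Context {R : realType}.

(** The Gaussian bases of [M] yield an invertible matrix whose first [m] rows are those of [M]; [B]
    is its inverse. *)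
Lemma row_free_complete m k (M : 'M[R]_(m, m + k)) : row_free M ->
  exists2 B : 'M[R]_(m + k), B \in unitmx & M *m B = row_mx 1%:M 0.
Proof.
move=> fM; have rM : \rank M = m by apply/eqP; exact: fM.
pose X : 'M[R]_(m + k) := block_mx (col_ebase M) 0 0 1%:M.
have uX : X \in unitmx.
  by rewrite unitmxE det_ublock det1 mulr1 -unitmxE col_ebase_unit.
have uR : row_ebase M \in unitmx by exact: row_ebase_unit.
have uXR : X *m row_ebase M \in unitmx by rewrite unitmx_mul uX.
exists (invmx (X *m row_ebase M)); first by rewrite unitmx_inv.
have ME : M = row_mx 1%:M 0 *m (X *m row_ebase M).
  rewrite mulmxA mul_row_block !mul1mx !mul0mx !addr0.
  rewrite -{1}(mulmx_ebase M) rM pid_mx_row mul_mx_row mulmx1 mulmx0 //.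
by rewrite {1}ME mulmxK.
Qed.

Lemma smooth_on_comp (V W : normedModType R) m (A : set W) (f : W -> 'rV[R]_m) (g : V -> W) :
  findim W -> smooth_on A f -> Cinf setT g -> (forall x, A (g x)) ->
  Cinf setT (fun x => f (g x)).
Proof.
move=> fW hf hg gA; apply: Cinf_local => x _.
have [U [F [oU Ux hF Ff]]] := hf (g x) (gA x).
exists (g @^-1` U); split=> //.
have oV : open (g @^-1` U).
  by apply: open_comp => // y _; exact: (Cinf_continuous hg).
apply: (Cinf_ext oV _ (Cinf_comp fW oV oU _ (Cinf_sub (@subsetT _ _) hg) hF)) => // y Uy.
by apply: Ff.
Qed.

(** The identification [b] is arbitrary; read in the stereographic chart from the same omitted point
    it becomes a diffeomorphism of R^n, to be absorbed in [T] or [al]. *)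
Lemma chart_gdiffeo n (C : 'M[R]_n.+1) s b pt : s ^+ 2 = 1 -> C \in unitmx ->
  sqnorm (row 0 C) = 1 -> pt = s *: row 0 C ->
  diffeomorphism setT (@sphere R n `\ pt) b ->
  exists b', [/\ gdiffeo (fun x => unster s (invmx C) (b x)) (fun w => b' (ster s C w)),
    forall x, @sphere R n (b x), forall x, unster_domain s (invmx C) (b x) &
    forall w, b (b' (ster s C w)) = ster s C w].
Proof.
move=> s1 uC C1 ptE [b' [[bA b'A b'K bK] sb sb']].
have bS x : @sphere R n (b x) by have [] := bA x I.
have bD x : unster_domain s (invmx C) (b x).
  have [h1 h2] := bA x I; apply: sphere_domain => //.
  by apply/eqP => E; apply: h2; rewrite ptE.
have sA w : (@sphere R n `\ pt) (ster s C w).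
  split; first exact: sqnorm_ster.
  by rewrite ptE; exact: ster_neq.
exists b'; split=> //; last by move=> w; apply: bK; exact: sA.
have hb : Cinf setT b by exact: (smooth_on_comp (findim_rV n) sb (Cinf_id openT)).
split.
- exact: (Cinf_comp (findim_rV n.+1) openT (@open_unster_domain R n s (invmx C))
    (fun x _ => bD x) hb (@Cinf_unster R n s (invmx C))).
- exact: (smooth_on_comp (findim_rV n.+1) sb' (Cinf_ster s1 uC) sA).
- by move=> x; rewrite (unsterK s1 uC (bS x) (bD x)); exact: b'K.
- by move=> w; rewrite bK ?sterK //; exact: sA.
Qed.

Lemma derive_precomp (V Y W : normedModType R) (f : Y -> W) (L : V -> Y) (w v : V) :
  (forall (h : R), L (h *: v + w) = h *: (L v) + L w) ->
  'D_v (fun x => f (L x)) w = 'D_(L v) f (L w).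
Proof.
move=> hL; rewrite /derive.
have E : (fun h : R => h^-1 *: (((fun x => f (L x)) \o shift w) (h *: v) - f (L w))) =
    (fun h : R => h^-1 *: ((f \o shift (L w)) (h *: L v) - f (L w))).
  by apply/funext => h /=; rewrite hL.
by rewrite E.
Qed.

Lemma derive_coord (V : normedModType R) m (f : V -> 'rV[R]_m) x v j : differentiable f x ->
  'D_v (fun y => f y 0 j) x = ('D_v f x) 0 j.
Proof. exact: (derive_linear_comp v (@coordmx_continuous R 1 m 0 j)). Qed.

Lemma ster0 n (C : 'M[R]_n.+1) : sqnorm (row 0 C) = 1 -> ster (-1) C 0 = row 0 C.
Proof.
move=> C1; rewrite /ster (_ : cone (-1) 0 = delta_mx 0 0); last first.
  apply: row_tail_eq; first by rewrite cone0 sqnorm0 mxE !eqxx sub0r mulrNN mulr1.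
  by rewrite tail_cone scaler0; apply/rowP => j; rewrite !mxE.
by rewrite -rowE normalize_unit.
Qed.

(* The velocity of [t |-> ster (-1) C (t w)] is a tangent vector of the sphere. *)
Lemma ster_immersion n m (C : 'M[R]_n.+1) (K : 'rV[R]_n.+1 -> 'rV[R]_m) w :
  C \in unitmx -> sqnorm (row 0 C) = 1 ->
  smooth_on (@sphere R n) K -> immersion_on (@sphere R n) K ->
  'D_w (fun v => K (ster (-1) C v)) 0 = 0 -> w = 0.
Proof.
move=> uC C1 sK iK; have s1 : (-1) ^+ 2 = 1 :> R by rewrite sqrrN expr1n.
set rho := ster (-1) C; have hrho : Cinf setT rho by exact: Cinf_ster.
have rS v : @sphere R n (rho v) by exact: sqnorm_ster.
have r0 : rho 0 = row 0 C by exact: ster0.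
have [U [F [oU Up hF Ff]]] := sK (rho 0) (rS 0).
have oV : open (rho @^-1` U).
  by apply: open_comp => // y _; exact: (Cinf_continuous hrho).
have -> : 'D_w (fun v => K (rho v)) 0 = 'D_w (fun v => F (rho v)) 0.
  by apply: near_eq_derive; apply: (open_near oV) => // v Uv; rewrite Ff.
have drho : differentiable rho 0 by exact: (Cinf_differentiable hrho).
have dF : differentiable F (rho 0) by exact: (Cinf_differentiable hF).
have -> : 'D_w (fun v => F (rho v)) 0 = 'd F (rho 0) ('D_w rho 0).
  apply: etrans (deriveE w (differentiable_comp drho dF)) _.
  by rewrite (diff_comp drho dF) (deriveE w drho).
move=> dw; have tg : tangent (@sphere R n) (rho 0) ('D_w rho 0).
  exists (fun t : R^o => rho (t *: w)); split.
  - apply: Cinf_smooth_on.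
    apply: (Cinf_comp (findim_rV n) openT openT (fun _ _ => I) _ hrho).
    exact: (fun k => Cn_scalel w openT (@Cn_id R R k setT openT)).
  - by move=> t; exact: rS.
  - by rewrite scale0r.
  - rewrite (@derive_precomp R^o _ _ rho (fun t : R^o => t *: w) 0 1).
      by rewrite scale1r scale0r.
    by move=> h; rewrite scale0r scale1r !addr0 -[h *: 1]/(h * 1) mulr1.
have Dw0 := iK (rho 0) U F (rS 0) (And4 oU Up hF Ff) _ tg dw.
have dom := ster_domain 0 s1 uC.
have dp : differentiable (unster (-1) (invmx C)) (rho 0).
  exact: (Cinf_differentiable (@Cinf_unster R n (-1) (invmx C))).
have E := left_inverse_diff w drho dp (sterK s1 uC).
rewrite (deriveE w drho) in Dw0.
exact: (etrans (esym E) (etrans (congr1 ('d (unster (-1) (invmx C)) (rho 0)) Dw0) (raddf0 _))).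
Qed.

End Charts.

(** * Long knots are standard at infinity *)

Section KnotGerm.
Context {R : realType}.
Notation e0 := (delta_mx 0 0 : 'rV[R]_2).
Notation e1 := (delta_mx 0 1 : 'rV[R]_2).

Lemma embZ (c : R) u : emb (c *: u) = c *: emb u.
Proof. by apply/rowP => -[[|[|[|[|//]]]] h]; rewrite !mxE /= ?mxE ?mulr0. Qed.

Lemma embD (u v : 'rV[R]_2) : emb (u + v) = emb u + emb v.
Proof. by apply/rowP => -[[|[|[|[|//]]]] h]; rewrite !mxE /= ?mxE ?addr0. Qed.

Lemma prjZ (c : R) y : prj (c *: y) = c *: prj y.
Proof. by apply: rV2_eq; rewrite !mxE /= ?mxE. Qed.

Lemma prjD (x y : 'rV[R]_4) : prj (x + y) = prj x + prj y.
Proof. by apply: rV2_eq; rewrite !mxE /= ?mxE. Qed.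

Lemma sqnorm_emb (u : 'rV[R]_2) : sqnorm (emb u) = sqnorm u.
Proof.
rewrite /sqnorm !big_ord_recl !big_ord0 /emb !mxE /= expr0n /= !addr0.
by congr (_ ^+ 2 + _ ^+ 2); congr (u _ _); apply: val_inj.
Qed.

Lemma derive_emb (w v : 'rV[R]_2) : 'D_w emb v = emb w.
Proof.
pose L (u : 'rV[R]_2) : 'rV[R]_4 := emb u.
have LL : linear L by move=> a x y; rewrite /L embD embZ.
pose LM := GRing.isLinear.Build _ _ _ _ _ LL.
pose LL' : {linear 'rV[R]_2 -> 'rV[R]_4} := HB.pack L LM.
have cL : continuous L by move=> x; exact: (Cinf_continuous Cinf_emb).
have did : differentiable (id : 'rV[R]_2 -> 'rV[R]_2) v.
  exact: (ex_diff (is_diff_def := is_diff_id v)).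
apply: etrans (derive_linear_comp (L := LL') w cL did) _.
by congr L; exact: derive_id.
Qed.

Lemma derive_rV2 (W : normedModType R) (f : 'rV[R]_2 -> W) x w : differentiable f x ->
  'D_w f x = w 0 0 *: 'D_e0 f x + w 0 1 *: 'D_e1 f x.
Proof.
move=> df; rewrite !(deriveE _ df) -!linearZ -linearD; congr ('d f x _).
by apply: rV2_eq; rewrite !mxE /= ?mulr0 ?mulr1 ?addr0 ?add0r.
Qed.

(** Differentiate [sqnorm (k v) = 1]. *)
Lemma unit_sphere_derive (V : normedModType R) m (k : V -> 'rV[R]_m) x w :
  Cinf setT k -> (forall v, sqnorm (k v) = 1) -> dot ('D_w k x) (k x) = 0.
Proof.
move=> hk k1; have dk : differentiable k x by exact: (Cinf_differentiable hk).
have dj j : is_derive x w (fun v => k v 0 j) (('D_w k x) 0 j).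
  apply: DeriveDef; last exact: derive_coord.
  exact: Cinf_derivable (Cinf_coord j openT hk).
have D := is_derive_sum (fun j => is_deriveM (dj j) (dj j)).
have : 'D_w (\sum_(j < m) ((fun v => k v 0 j) * (fun v => k v 0 j))) x = 0.
  rewrite (_ : \sum_(j < m) _ = cst 1) ?derive_cst //; apply/funext => v.
  rewrite fct_sumE -[RHS](k1 v); apply: eq_bigr => j _; exact: esym (expr2 _).
have [_ ->] := D => E.
have : 2 * dot ('D_w k x) (k x) = 0.
  rewrite -[RHS]E /dot mulr_sumr; apply: eq_bigr => j _.
  rewrite -[RHS]/(k x 0 j * ('D_w k x) 0 j + k x 0 j * ('D_w k x) 0 j); ring.
lra.
Qed.

(** The vector [k 0] is orthogonal to the two independent partial derivatives, so the three extend
    to a basis, which [B] straightens. The 2 matches the denominator of [unster (-1) B] at [k 0], so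
    that the germ becomes tangent to [emb]. *)
Lemma knot_germ_frame (k : 'rV[R]_2 -> 'rV[R]_5) : Cinf setT k ->
  (forall v, sqnorm (k v) = 1) -> (forall w, 'D_w k 0 = 0 -> w = 0) ->
  exists B : 'M[R]_5, [/\ B \in unitmx, k 0 *m B = delta_mx 0 0 &
    forall w, tail ('D_w k 0 *m B) = 2 *: emb w].
Proof.
move=> hk k1 imm; have dk : differentiable k 0 by exact: (Cinf_differentiable hk).
pose rows : seq 'rV[R]_5 := [:: k 0; 2^-1 *: 'D_e0 k 0; 2^-1 *: 'D_e1 k 0].
pose M : 'M[R]_(3, 3 + 2) := \matrix_(i < 3) rows`_i.
have vM (v : 'rV[R]_3) : v *m M = v 0 0 *: k 0 +
    'D_(vec2 (v 0 1 / 2) (v 0 2%:R / 2)) k 0.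
  rewrite mulmx_sum_row !big_ord_recl big_ord0 addr0 !rowK derive_rV2 //=.
  rewrite !mxE /= !scalerA; congr (_ *: _ + (_ *: _ + _ *: _));
    by congr (v _ _ * _); apply: val_inj.
have [B uB MB] : exists2 B : 'M[R]_(3 + 2), B \in unitmx & M *m B = row_mx 1%:M 0.
  apply: row_free_complete; apply: inj_row_free => v; rewrite vM => E.
  set w := vec2 _ _ in E.
  have v0 : v 0 0 = 0.
    have := congr1 (fun y => dot y (k 0)) E.
    rewrite dotDl dotZl unit_sphere_derive // -sqnorm_dot k1 addr0 mulr1 => ->.
    by rewrite -(scale0r (k 0)) dotZl mul0r.
  have w0 : w = 0 by apply: imm; move: E; rewrite v0 scale0r add0r.
  have v1 : v 0 1 = 0.
    by have := congr1 (fun y : 'rV[R]_2 => y 0 0) w0; rewrite !mxE /=; lra.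
  have v2 : v 0 2%:R = 0.
    by have := congr1 (fun y : 'rV[R]_2 => y 0 1) w0; rewrite !mxE /=; lra.
  apply/rowP => -[[|[|[|//]]] hi]; rewrite mxE.
  - by rewrite -[RHS]v0; congr (v _ _); apply: val_inj.
  - by rewrite -[RHS]v1; congr (v _ _); apply: val_inj.
  - by rewrite -[RHS]v2; congr (v _ _); apply: val_inj.
have rB i (j : 'I_(3 + 2)) : (rows`_i *m B) 0 j = ((i == j)%N && (i < 3)%N)%:R \/ (3 <= i)%N.
  have [i3|i3] := ltnP i 3; last by right.
  left; have := congr1 (fun N => row (Ordinal i3) N) MB.
  rewrite row_mul rowK /= => ->; rewrite -pid_mx_row !mxE /=.
  by rewrite i3.
exists B; split=> //.
- apply/rowP => j; have [E|//] := rB 0%N j.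
  by rewrite [LHS]E [RHS]mxE /= andbT; congr (_%:R); rewrite eq_sym.
- move=> w.
  have Ew : 'D_w k 0 = (2 * w 0 0) *: rows`_1 + (2 * w 0 1) *: rows`_2.
    rewrite derive_rV2 // /= !scalerA.
    by congr (_ *: _ + _ *: _); rewrite mulrAC divff // mul1r.
  move: (rB 1%N) (rB 2%N) Ew; move: (rows`_1) (rows`_2) => r1 r2 {}rB1 {}rB2 ->.
  apply/rowP => j.
  have [E1|//] := rB1 (lift ord0 j); have [E2|//] := rB2 (lift ord0 j).
  rewrite mulmxDl -(scalemxAl _ r1) -(scalemxAl _ r2) [LHS]mxE.
  rewrite rVD !rVZ [X in _ * X + _]E1 [X in _ + _ * X]E2 [emb w]/emb mxE.
  by case: j {E1 E2} => -[|[|[|[|//]]]] hj /=; rewrite ?mulr0 ?mulr1 ?addr0 ?add0r.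
Qed.

End KnotGerm.

(** * The germ at the point at infinity *)

Section Straightening.
Context {R : realType}.

(** Extended to R^4 through [prj], the germ [f - emb] has vanishing 1-jet, so [small_germ] applies
    to it; adding the result to the identity gives [D]. The radius 1 is the one that conjugation by
    the inversion expects. *)
Lemma straighten_germ (U : set 'rV[R]_2) (f : 'rV[R]_2 -> 'rV[R]_4) :
  open U -> U 0 -> Cinf U f -> f 0 = 0 -> (forall w, 'D_w f 0 = emb w) ->
  exists D D' : 'rV[R]_4 -> 'rV[R]_4,
    [/\ gdiffeo D D', D 0 = 0, forall y, 1 <= `|y| -> D y = y &
      exists2 d : R, 0 < d & forall v, `|v| <= d -> D (emb v) = f v].
Proof.
move=> oU U0 hf f0 Df.
have cprj : continuous (prj : 'rV[R]_4 -> 'rV[R]_2).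
  by move=> y; exact: (Cinf_continuous Cinf_prj).
have oV : open (prj @^-1` U) by apply: open_comp => // y _; exact: cprj.
pose g v := f v - emb v.
have hg : Cinf U g by exact: (Cinf_sub2 oU hf (Cinf_sub (@subsetT _ _) Cinf_emb)).
have p0 : prj (0 : 'rV[R]_4) = 0 by apply: rV2_eq; rewrite !mxE /= ?mxE.
have e0 : emb (0 : 'rV[R]_2) = 0 by apply/rowP => -[[|[|[|[|//]]]] h]; rewrite !mxE /= ?mxE.
have g0 : g 0 = 0 by rewrite /g f0 e0 subrr.
have df : differentiable f 0 by exact: (Cinf_differentiable hf).
have Dg w : 'D_w g 0 = 0.
  apply: etrans (deriveB (diff_derivable df) (Cinf_derivable Cinf_emb)) _.
  by apply: etrans (congr2 (fun a b => a - b) (Df w) (derive_emb w 0)) _; rewrite subrr.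
have he : Cinf (prj @^-1` U) (fun y => g (prj y)).
  exact: (Cinf_comp (findim_rV 2) oV oU _ (Cinf_sub (@subsetT _ _) Cinf_prj) hg).
have De v : 'D_v (fun y => g (prj y)) 0 = 0.
  apply: etrans (derive_precomp g _) _; last by rewrite p0.
  by move=> h; rewrite prjD prjZ.
have [eta eta0 etaE] := @lipschitz_constant_exists R 4.
have V0 : (prj @^-1` U) 0 by rewrite /preimage /= p0.
have E0 : g (prj 0) = 0 by rewrite p0.
have [e' [he' [d d0 e'd] e'1 e'L]] := small_germ oV V0 he E0 De eta0 ltr01.
have u01 : 0 <= (1 : R) <= 1 by rewrite ler01 lexx.
have [D' DD'] := lipschitz_gdiffeo (ltW eta0) he' e'L etaE u01.
exists (fun y => y + 1 *: e' y), D'; split=> //.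
- by rewrite e'd ?subrr ?normr0 ?(ltW d0) // E0 scaler0 addr0.
- by move=> y y1; rewrite e'1 ?subr0 // scaler0 addr0.
- exists d => // v vd; rewrite scale1r e'd ?embK ?subr0; last first.
    exact: le_trans (norm_emb_le v) vd.
  by rewrite /g addrC subrK.
Qed.

(** The tail vanishes at [k 0], so the product rule leaves only the derivative of the tail, divided
    by the denominator 2. *)
Lemma unster_germ (k : 'rV[R]_2 -> 'rV[R]_5) (B : 'M[R]_5) : Cinf setT k ->
  k 0 *m B = delta_mx 0 0 -> (forall w, tail ('D_w k 0 *m B) = 2 *: emb w) ->
  [/\ unster_domain (-1) B (k 0), unster (-1) B (k 0) = 0 &
    forall w, 'D_w (fun v => unster (-1) B (k v)) 0 = emb w].
Proof.
move=> hk k0 Dk.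
have n0 : enorm (k 0 *m B) = 1.
  rewrite k0 /enorm sqnorm_tail (_ : tail _ = 0).
    by rewrite sqnorm0 addr0 mxE !eqxx expr1n sqrtr1.
  by apply/rowP => j; rewrite !mxE.
have k00 : (k 0 *m B) 0 0 = 1 by rewrite k0 mxE !eqxx.
have t0 : tail (k 0 *m B) = 0 by rewrite k0; apply/rowP => j; rewrite !mxE.
have dom : unster_domain (-1) B (k 0).
  split; first by apply/eqP => E; move: k00; rewrite E mxE => /eqP; rewrite eq_sym oner_eq0.
  by rewrite n0 k00 mulN1r opprK addr_gt0.
split=> //; first by rewrite /unster t0 scaler0.
pose U := k @^-1` unster_domain (-1) B.
have oU : open U.
  by apply: open_comp (@open_unster_domain _ _ _ _) => y _; exact: (Cinf_continuous hk).
have hkB : Cinf setT (fun v => k v *m B) by exact: (Cinf_mulmx B openT hk).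
have hkU : Cinf U (fun v => k v *m B) := Cinf_sub (@subsetT _ _) hkB.
pose c v : R := (enorm (k v *m B) - -1 * (k v *m B) 0 0)^-1.
have hc : Cinf U c.
  apply: (Cinf_inv oU) => [v [_ h]|]; first by rewrite gt_eqF.
  apply: (Cinf_sub2 oU).
    by apply: (Cinf_enorm oU _ hkU) => v [].
  exact: (Cinf_mul oU (Cinf_cst _ _) (Cinf_coord 0 oU hkU)).
have hf : Cinf U (fun v => unster (-1) B (k v)).
  exact: (Cinf_comp (findim_rV 5) oU (@open_unster_domain _ _ _ _) (fun _ h => h)
    (Cinf_sub (@subsetT _ _) hk) (@Cinf_unster R 4 (-1) B)).
have df : differentiable (fun v => unster (-1) B (k v)) 0 by exact: (Cinf_differentiable hf).
have dkB : differentiable (fun v => k v *m B) 0 by exact: (Cinf_differentiable hkB).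
have dk : differentiable k 0 by exact: (Cinf_differentiable hk).
have dc : differentiable c 0 by exact: (Cinf_differentiable hc).
move=> w; apply/rowP => j.
have gj : is_derive (0 : 'rV[R]_2) w (fun v => (k v *m B) 0 (lift ord0 j)) (2 * emb w 0 j).
  apply: DeriveDef; first exact: (Cinf_derivable (Cinf_coord _ openT hkB)).
  rewrite (derive_coord w _ dkB).
  have -> : 'D_w (fun v => k v *m B) 0 = 'D_w k 0 *m B.
    exact: (derive_linear_comp (L := mulmxr B) w (@mulmxr_continuous R _ _ B) dk).
  by have := congr1 (fun t : 'rV[R]_4 => t 0 j) (Dk w); rewrite /tail !mxE.
have cj : is_derive (0 : 'rV[R]_2) w c ('D_w c 0).
  by apply: DeriveDef => //; exact: diff_derivable.
have [_ E] := is_deriveM cj gj.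
rewrite -(derive_coord w j df).
have -> : (fun v => unster (-1) B (k v) 0 j) =
    c * (fun v : 'rV[R]_2 => (k v *m B) 0 (lift ord0 j)).
  by apply/funext => v; rewrite {1}/unster [LHS]mxE /tail [X in _ * X]mxE.
apply: etrans E _.
have -> : (k 0 *m B) 0 (lift ord0 j) = 0 by rewrite k0 !mxE.
rewrite scale0r addr0 /c n0 k00 -[LHS]/(_ * (2 * emb w 0 j)).
by move: (emb w 0 j) => x; field.
Qed.

End Straightening.

(** * Normal form of a long knot at infinity *)

Section Standardization.
Context {R : realType}.

Lemma unit_vector_frame n (p : 'rV[R]_n.+1) : sqnorm p = 1 ->
  exists2 C : 'M[R]_n.+1, C \in unitmx & row 0 C = p.
Proof.
move=> p1; have p0 : p != 0 by apply: contra_eq_neq p1 => ->; rewrite sqnorm0 eq_sym oner_eq0.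
have fp : row_free (p : 'M[R]_(1, 1 + n)) by rewrite /row_free rank_rV p0.
have [B uB pB] := row_free_complete fp.
exists (invmx B); first by rewrite unitmx_inv.
rewrite -[RHS](mulmxK uB) pB rowE; congr (_ *m _).
by rewrite -pid_mx_row; apply/rowP => j; rewrite !mxE /= andbT eq_sym.
Qed.

Lemma smooth_embedding_immersive (phi : 'rV[R]_2 -> 'rV[R]_4) (x v : 'rV[R]_2) :
  smooth_embedding setT phi -> Cinf setT phi -> 'D_v phi x = 0 -> v = 0.
Proof.
move=> [_ iphi _] hphi dv.
have tg : tangent [set: 'rV[R]_2] x v.
  exists (fun t : R^o => t *: v + x); split=> //.
  - apply: Cinf_smooth_on.
    apply: (Cinf_add openT _ (Cinf_cst _ _)).
    exact: (fun k => Cn_scalel v openT (@Cn_id R R k setT openT)).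
  - by rewrite scale0r add0r.
  - rewrite (@derive_precomp R R^o _ _ (fun y : 'rV[R]_2 => y + x) (fun t : R^o => t *: v) 0 1).
      rewrite scale1r scale0r.
      have E := derive_translate (fun y : 'rV[R]_2 => y) x v 0.
      by rewrite E; exact: derive_id.
    by move=> h; rewrite scale0r scale1r !addr0 -[h *: 1]/(h * 1) mulr1.
have ext : smooth_extension [set: 'rV[R]_2] phi x setT phi by split=> //; exact: openT.
apply: (iphi x setT phi I ext v tg).
by rewrite -(deriveE v (Cinf_differentiable hphi (x := x) I)).
Qed.

(** The charts with [s = 1] omit [p] and [K p] and give coordinates on R^2 and R^4; those with
    [s = -1] are centred at these points and show the germ. The inversion passes from one kind to
    the other. *)
Lemma standard_at_infinity (phi : 'rV[R]_2 -> 'rV[R]_4) : Cinf setT phi -> long_two_knot phi ->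
  exists T T' al al' (R0 : R), [/\ gdiffeo T T', gdiffeo al al', 0 < R0 &
    forall u, R0 <= `|u| -> T (phi (al u)) = emb u].
Proof.
move=> hphi [K [p [a [b [[KS _ [sK iK _] _] p1 da db bK]]]]].
have s1 : (1 : R) ^+ 2 = 1 by rewrite expr1n.
have sN : (-1 : R) ^+ 2 = 1 by rewrite sqrrN expr1n.
have [C2 uC2 C2p] := unit_vector_frame p1.
have C21 : sqnorm (row 0 C2) = 1 by rewrite C2p.
pose k v := K (ster (-1) C2 v).
have rS s v : s ^+ 2 = 1 -> @sphere R 2 (ster s C2 v) by move=> ?; exact: sqnorm_ster.
have hk : Cinf setT k.
  exact: (smooth_on_comp (findim_rV 3) sK (Cinf_ster sN uC2) (fun v => rS _ v sN)).
have k1 v : sqnorm (k v) = 1 by exact: (KS _ (rS _ v sN)).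
have kq : k 0 = K p by rewrite /k ster0 // C2p.
have [B [uB k0B Dk]] := knot_germ_frame hk k1 (fun w => ster_immersion uC2 C21 sK iK).
(* The twist of the target chart is dictated by the tangent frame of the knot; [C2] only has to
   start with [p]. *)
pose C4 := invmx B; have uC4 : C4 \in unitmx by rewrite unitmx_inv.
have BE : invmx C4 = B by exact: invmxK.
have C4q : row 0 C4 = K p by rewrite rowE -k0B -kq mulmxK.
have C41 : sqnorm (row 0 C4) = 1 by rewrite C4q -kq.
have [dom0 f0 Df] := unster_germ hk k0B Dk.
have oV : open (k @^-1` unster_domain (-1) B).
  by apply: open_comp (@open_unster_domain _ _ _ _) => y _; exact: (Cinf_continuous hk).
have hf : Cinf (k @^-1` unster_domain (-1) B) (fun v => unster (-1) B (k v)).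
  exact: (Cinf_comp (findim_rV 5) oV (@open_unster_domain _ _ _ _) (fun _ h => h)
    (Cinf_sub (@subsetT _ _) hk) (@Cinf_unster R 4 (-1) B)).
have [D [D' [DD' D0 D1 [d d0 Dd]]]] := straighten_germ oV dom0 hf f0 Df.
have [r r0 rV] := near_closed_ball (open_near oV (fun _ h => h) dom0).
have gT1 := gdiffeo_conj_inversion DD' D0 D1.
have ptb : K p = 1 *: row 0 C4 by rewrite scale1r C4q.
have pta : p = 1 *: row 0 C2 by rewrite scale1r C2p.
have [b' [gT0 bS bD b'K]] := chart_gdiffeo s1 uC4 C41 ptb db.
have [a' [ga aS aD a'K]] := chart_gdiffeo s1 uC2 C21 pta da.
rewrite BE in gT0 bD.
have [_ D'D _ _] := DD'; have [_ _ DK _] := DD'.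
(* For such [u] the inverse point lies both where [D] maps the plane to the germ and where [k] stays
   in the chart. *)
pose R0 := Num.max d^-1 r^-1 + 1.
have R0gt : 0 < R0 by rewrite ltr_wpDl // le_max invr_ge0 (ltW d0).
eexists; eexists; eexists; eexists; exists R0; split.
- exact: (gdiffeo_comp gT0 gT1).
- exact: (gdiffeo_sym ga).
- by [].
move=> u uR /=; set v := inversion u.
have u0 : u != 0 by rewrite -normr_gt0; exact: lt_le_trans uR.
have nu : 0 < `|u| by rewrite normr_gt0.
have vd : `|v| <= d.
  apply: le_trans (norm_inversion_le u) _; rewrite -(invrK d) lef_pV2 ?posrE ?invr_gt0 //.
  by apply: le_trans uR; rewrite /R0 ler_wpDr // le_max lexx.
have vr : `|v - 0| <= r.
  rewrite subr0; apply: le_trans (norm_inversion_le u) _.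
  rewrite -(invrK r) lef_pV2 ?posrE ?invr_gt0 //.
  by apply: le_trans uR; rewrite /R0 ler_wpDr // le_max lexx orbT.
have bk : b (phi (a' (ster 1 C2 u))) = k v.
  by rewrite bK a'K /k /v ster_inversion.
have dom1 := bD (phi (a' (ster 1 C2 u))); rewrite bk in dom1.
(* In the far chart [k v] is the inversion of the germ at [v]. The first inversion in the conjugate
   cancels it, [D'] turns the germ into [emb v], and the last inversion gives [emb u]. *)
rewrite bk -(unster_inversion (rV _ vr) dom1) inversionK -(Dd _ vd) DK.
rewrite /inversion sqnorm_emb -embZ; congr emb.
exact: (inversionK u).
Qed.

End Standardization.

Theorem theorem3p1 (R : realType) (phi : 'rV[R]_2 -> 'rV[R]_4)
    (phi_smooth : smooth_embedding setT phi) (phi_long : long_two_knot phi) :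
  exists x y z w : {poly {poly R}},
    smooth_embedding setT (poly_map x y z w) /\
    ambient_isotopic phi (poly_map x y z w).
Proof.
have [sphi _ [g0 [[_ _ g0K _] _ _]]] := phi_smooth.
have hphi : Cinf setT phi by exact: (smooth_on_comp (findim_rV 2) sphi (Cinf_id openT)).
have [T [T' [al [al' [R0 [gT gal R0gt Tphi]]]]]] := standard_at_infinity hphi phi_long.
have [hT hT' TK T'K] := gT; have [hal hal' alK al'K] := gal.
pose F u := phi (al u).
have hF : Cinf setT F.
  exact: (Cinf_comp (findim_rV 2) openT openT (fun _ _ => I) hal hphi).
have hPhi : Cinf setT (fun u => T (F u)).
  exact: (Cinf_comp (findim_rV 4) openT openT (fun _ _ => I) hF hT).
have injPhi : injective (fun u => T (F u)).
  move=> u v /(can_inj TK) /(congr1 g0).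
  by rewrite (g0K (al u) I) (g0K (al v) I) => /(can_inj alK).
have immPhi u v : 'D_v (fun u => T (F u)) u = 0 -> v = 0.
  have dal : differentiable al u by exact: (Cinf_differentiable hal).
  have dal' : differentiable al' (al u) by exact: (Cinf_differentiable hal').
  have dphi : differentiable phi (al u) by exact: (Cinf_differentiable hphi).
  have dF : differentiable F u by exact: (Cinf_differentiable hF).
  have dT : differentiable T (F u) by exact: (Cinf_differentiable hT).
  have dT' : differentiable T' (T (F u)) by exact: (Cinf_differentiable hT').
  have dTF : differentiable (fun u => T (F u)) u by exact: (Cinf_differentiable hPhi).
  move=> E.
  have E1 : 'd T (F u) ('d F u v) = 0.
    apply: etrans _ (etrans (esym (deriveE v dTF)) E).
    exact: (congr1 (fun L : _ -> _ => L v) (esym (diff_comp dF dT))).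
  have E2 : 'd F u v = 0.
    apply: etrans (esym (left_inverse_diff ('d F u v) dT dT' TK)) _.
    exact: (etrans (congr1 ('d T' (T (F u))) E1) (raddf0 _)).
  have E3 : 'D_('d al u v) phi (al u) = 0.
    apply: etrans (deriveE _ dphi) _; apply: etrans _ E2.
    exact: (congr1 (fun L : _ -> _ => L v) (esym (diff_comp dal dphi))).
  have E4 := smooth_embedding_immersive phi_smooth hphi E3.
  apply: etrans (esym (left_inverse_diff v dal dal' alK)) _.
  exact: (etrans (congr1 ('d al' (al u)) E4) (raddf0 _)).
have [r [R1 [R1gt hr rK r1]]] := smooth_retraction hPhi injPhi immPhi Tphi.
have [psi [H [G [gH ppsi HE]]]] :=
  standard_at_infinity_polynomial R0gt R1gt hPhi hr rK Tphi r1.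
have [hH hG HK GK] := gH.
(* The diffeomorphism is [H \o T], and [psi] has left inverse [r \o G]; [al] drops out because only
   images are compared. *)
apply: (polynomial_representation_reduction (l := fun y => r (G y)) (gdiffeo_comp gT gH) _ ppsi).
- apply/seteqP; split=> [_ [_ [x _ <-] <-]|_ [u _ <-]] /=.
    by exists (al' x) => //; rewrite -HE /F al'K.
  by exists (phi (al u)); [exists (al u)|rewrite -HE].
- exact: (Cinf_comp (findim_rV 4) openT openT (fun _ _ => I) hG hr).
- by move=> u; rewrite -HE HK; exact: rK.
Qed.
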